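(* Every t-perfect graph is $199053$-colourable.
   Context: All graphs are finite and simple. For a graph $G=(V,E)$, the stable set polytope $\mathrm{STAB}(G)\subseteq\mathbb{R}^{V}$ is the convex hull of the incidence vectors of the stable sets of $G$. Let $\mathrm{TSTAB}(G)$ be the set of all $x\in\mathbb{R}^V$ satisfying $x_v\ge 0$ for every vertex $v$, $x_u+x_v\le 1$ for every edge $uv$, and $\sum_{v\in V(C)}x_v\le \frac{|V(C)|-1}{2}$ for every odd cycle $C$ of $G$. A graph $G$ is t-perfect if $\mathrm{STAB}(G)=\mathrm{TSTAB}(G)$. A graph is $k$-colourable if its vertex set is a union of $k$ stable sets. *)

(* Defs.v *)
From mathcomp Require Import all_boot all_order all_algebra.
From mathcomp Require Import classical_sets reals convex.

Set Implicit Arguments.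
Unset Strict Implicit.
Unset Printing Implicit Defensive.

Import Order.TTheory GRing.Theory Num.Theory.

Local Open Scope ring_scope.

Record sgraph := SGraph {
  vertex :> finType;
  edge : rel vertex;
  edge_sym : symmetric edge;
  edge_irr : irreflexive edge }.

Definition stable (G : sgraph) (S : {set G}) : bool :=
  [forall u in S, forall v in S, ~~ edge u v].

(* A cycle of G is given by listing its vertices in cyclic order; it need not
   be induced. *)
Definition odd_cycle (G : sgraph) (c : seq G) : bool :=
  [&& (2 < size c)%N, odd (size c) & ucycleb (@edge G) c].

Definition convex_hull (R : numDomainType) (M : lmodType R) (A : set M) :
    set M :=
  smallest (@convex_set R M) A.

(* R^o is R as a module over itself, which makes R^V an lmodType R. *)
Definition incidence (R : realType) (G : sgraph) (S : {set G}) :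
    {ffun G -> R^o} :=
  [ffun v => (v \in S)%:R].

Definition STAB (R : realType) (G : sgraph) : set {ffun G -> R^o} :=
  convex_hull [set incidence R S | S in [set S : {set G} | stable S]]%classic.

Arguments STAB : clear implicits.

Definition TSTAB (R : realType) (G : sgraph) : set {ffun G -> R^o} :=
  [set x : {ffun G -> R^o} |
    [/\ forall v : G, 0 <= x v,
        forall u v : G, edge u v -> x u + x v <= 1
      & forall c : seq G, odd_cycle c ->
          \sum_(v <- c) x v <= ((size c)%:R - 1) / 2]]%classic.

Arguments TSTAB : clear implicits.

Definition t_perfect (R : realType) (G : sgraph) : Prop :=
  STAB R G = TSTAB R G.

Definition colourable (G : sgraph) (k : nat) : Prop :=
  exists S : 'I_k -> {set G},
    (forall i, stable (S i)) /\ \bigcup_(i < k) S i = [set: G].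

(* Main.v *)
(** Let G be t-perfect. Maximising, over the stable sets, the number of incidences with the
    cycles of length 2k+1 in a set without shorter odd cycles yields a stable set meeting all
    these cycles, because the point with all coordinates k/(2k+1) lies in TSTAB(G). For
    k = 1, 2 this removes two stable sets and leaves a set W without odd cycles of length 3, 5.

    A point with coordinates 1/3 and 2/3 gives the wheel lemma: if a connected set X with a
    proper 2-colouring is disjoint from an odd hole C, and one of its classes has no neighbour
    on C, then the parity of the indices of C touched by the other class changes at most once
    along C. In particular two vertices joined by an induced path of even length whose interior
    is anticomplete to C touch C jointly in such a way. This is all that is used about W.

    In a connected set of large chromatic number, attached to a vertex z, breadth-first search
    produces an odd hole through which z is joined by induced paths of both parities to a
    connected set which still has large chromatic number (a link). With links and the wheel
    lemma one bounds the chromatic number of the vertices having a neighbour ("leg") that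
    touches a fixed odd hole. With this bound, links can be chained to a rope: a closed odd
    hole inside a breadth-first layer, with six marked vertices and three odd holes along which
    it can be rerouted to change the parity of its parts, so that any three marked vertices can
    be made to sit at odd distances. Two steps of the search tree above the marked vertices
    there is a minimal connected set containing their grandparents; it is 2-colourable, and
    three of the grandparents in one class form, with the parents, a hub contradicting the
    wheel lemma. *)

Require Import Defs.
From mathcomp Require Import all_boot all_order all_algebra.
From mathcomp Require Import classical_sets reals convex.
From mathcomp Require Import interval_inference zify ring lra.
From mathcomp Require Import fintype finset.
From Stdlib Require Import Classical ClassicalEpsilon.

Set Implicit Arguments.
Unset Strict Implicit.
Unset Printing Implicit Defensive.

Import Order.TTheory GRing.Theory Num.Theory.

(** The wheel lemma always leaves room for one parity change along a hole, so a contradiction needs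
    contacts at three indices of alternating parity; this is why the marks come in triples. In the
    rope the legs are the parents, one level closer to the root of the search tree. A rope can be
    closed only through a parent that does not touch it, and the bound for legs on a hole is what
    supplies such a parent.

    Each of the three stages carries two marks of opposite parity. The first two links adjust the
    distances between marks of different stages, the third is kept for the parity of the closed
    hole.

    The colour count: what survives three stages is not [core_col]-colourable, and [core_col] is
    4307. Each stage doubles the number, since a link is found inside one level; so do the choice of
    the level carrying the rope and of the level that needs many colours in the whole graph. With
    the summands for conflicts and deleted neighbourhoods this gives 138916 for [2 * rope_col 13],
    to which the two removed stable sets add 2. *)

(* The hole is c 0, ..., c n.-1; a triangle counts as a hole. *)
Definition is_hole (V : finType) (e : rel V) (c : nat -> V) (n : nat) : Prop :=
  [/\ 2 < n, odd n & forall i j, i < j -> j < n ->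
      c i <> c j /\ e (c i) (c j) = (j == i.+1) || ((i == 0) && (j == n.-1))].

(** Connectivity as an induction principle: a property that holds somewhere in [X] and passes along
    edges holds on all of [X]. The empty set counts as connected. *)
Definition connected (V : finType) (e : rel V) (X : {set V}) : Prop :=
  forall P : V -> Prop, (exists2 x, x \in X & P x) ->
  (forall x y, x \in X -> y \in X -> e x y -> P x -> P y) ->
  forall x, x \in X -> P x.

(* What is used of the graph induced by W: it has no odd hole of length 3 or 5, and it
   satisfies the wheel lemma. *)
Record wgraph := WGraph {
  wv :> finType;
  adj : rel wv;
  adj_sym : symmetric adj;
  adj_irr : irreflexive adj;
  adj_hole7 : forall c n, is_hole adj c n -> 7 <= n;
  adj_wheel : forall c n (X : {set wv}) (ka : wv -> bool),
    is_hole adj c n -> connected adj X ->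
    (forall x y, x \in X -> y \in X -> adj x y -> ka x != ka y) ->
    (forall i, i < n -> c i \notin X) ->
    (forall x i, x \in X -> ka x -> i < n -> ~~ adj x (c i)) ->
    exists k b, forall x i, x \in X -> ~~ ka x -> i < n -> adj x (c i) ->
      odd i = b (+) (k <= i) }.

(** * Extremal and choice principles *)

Lemma min_nat (P : nat -> Prop) :
  (exists n, P n) -> exists n, P n /\ forall m, m < n -> ~ P m.
Proof.
case=> n Pn; elim/ltn_ind: n Pn => n IH Pn.
case: (classic (exists2 m, m < n & P m)) => [[m ltmn Pm]|H]; first exact: IH ltmn Pm.
by exists n; split=> // m ltmn Pm; apply: H; exists m.
Qed.

Lemma max_nat (P : nat -> Prop) (b : nat) :
  (exists n, P n) -> (forall n, P n -> n <= b) ->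
  exists n, P n /\ forall m, n < m -> ~ P m.
Proof.
move=> [n Pn] Pb.
have [|m [Pm mm]] := @min_nat (fun m => P (b - m)).
  by exists (b - n); rewrite subKn // Pb.
exists (b - m); split=> // k ltk Pk; have := Pb _ Pk => lek.
by apply: (mm (b - k)); [lia | rewrite subKn].
Qed.

Lemma min_set (T : finType) (P : {set T} -> Prop) :
  (exists A, P A) -> exists A, P A /\ forall B : {set T}, B \proper A -> ~ P B.
Proof.
case=> A PA.
have [|n [[B [PB cB]] mB]] := @min_nat (fun n => exists B : {set T}, P B /\ #|B| = n).
  by exists #|A|, A.
exists B; split=> // C /proper_card; rewrite cB => ltC PC.
by apply: mB ltC _; exists C.
Qed.

Lemma choose_fun (A B : Type) (b : B) (P : A -> B -> Prop) (Q : A -> Prop) :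
  (forall a, Q a -> exists b, P a b) -> exists f, forall a, Q a -> P a (f a).
Proof.
move=> H.
have H' a : exists b, Q a -> P a b.
  by case: (classic (Q a)) => [/H [b' Pb]|nQ]; [exists b' | exists b].
exists (fun a => proj1_sig (constructive_indefinite_description _ (H' a))) => a.
by case: constructive_indefinite_description.
Qed.

(* zify is slow on hypotheses that are not arithmetic, so they are cleared first. *)
Ltac is_arith T := lazymatch T with
  | and ?A ?B => is_arith A; is_arith B
  | or ?A ?B => is_arith A; is_arith B
  | not ?A => is_arith A
  | is_true (leq _ _) => idtac
  | is_true (odd _) => idtac
  | is_true (eq_op _ _) => idtac
  | is_true (negb ?b) => is_arith (is_true b)
  | is_true (orb ?a ?b) => is_arith (is_true a); is_arith (is_true b)
  | is_true (andb ?a ?b) => is_arith (is_true a); is_arith (is_true b)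
  | @eq ?A _ _ => first [unify A nat | unify A bool]
  end.
Ltac arith_clear := repeat match goal with
  | H : ?T |- _ => tryif is_arith T then fail else clear H
  end.
Ltac arith_goal := lazymatch goal with
  | |- is_true (in_mem _ _) => exfalso
  | |- is_true (negb (in_mem _ _)) => exfalso
  | |- is_true (adj _ _) => exfalso
  | |- is_true (negb (adj _ _)) => exfalso
  | |- _ => idtac
  end.
Tactic Notation "lia" := intros; arith_goal; arith_clear; Lia.lia.

(** * Adjacency and rotation of holes *)

Section Hole.
Variables (V : finType) (e : rel V).
Hypotheses (e_sym : symmetric e) (e_irr : irreflexive e).

Lemma is_hole_e (c : nat -> V) n i j : is_hole e c n -> i < n -> j < n -> e (c i) (c j) =
  [|| j == i.+1, i == j.+1, (i == 0) && (j == n.-1) | (j == 0) && (i == n.-1)].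
Proof.
move=> [n2 _ H] hi hj; case: (ltngtP i j) => [lt|lt|->].
- by have [_ ->] := H _ _ lt hj; lia.
- by rewrite e_sym; have [_ ->] := H _ _ lt hi; lia.
- by rewrite e_irr; lia.
Qed.

Lemma is_hole_inj (c : nat -> V) n i j : is_hole e c n -> i < n -> j < n -> c i = c j -> i = j.
Proof.
move=> [n2 _ H] hi hj E; case: (ltngtP i j) => [lt|lt|//].
- by have [/(_ E)] := H _ _ lt hj.
- by have [/(_ (esym E))] := H _ _ lt hi.
Qed.

Lemma is_hole_rot (c : nat -> V) n k : is_hole e c n -> is_hole e (fun i => c ((i + k) %% n)) n.
Proof.
move=> H; have [n2 on _] := H; split=> // i j ltij ltjn.
have Hm x : (x %% n) < n by rewrite ltn_pmod //; lia.
have [q [r [-> ltr]]] : exists q r, k = q * n + r /\ r < n.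
  by exists (k %/ n), (k %% n); split; [exact: divn_eq | exact: Hm].
have E x : x < n -> (x + (q * n + r)) %% n = if x + r < n then x + r else x + r - n.
  move=> ltx; rewrite addnCA modnMDl; case: ltnP => h; first by rewrite modn_small.
  have -> : x + r = n + (x + r - n) by lia.
  by rewrite modnDl modn_small ?addKn //; lia.
have lti := ltn_trans ltij ltjn; split.
  by move/(is_hole_inj H (Hm _) (Hm _)); rewrite !E //; do 2 case: ltnP => ?; lia.
by rewrite (is_hole_e H) // !E //; do 2 case: ltnP => ?; lia.
Qed.

End Hole.

Definition propb (P : Prop) : bool := if excluded_middle_informative P then true else false.
Lemma propbP P : reflect P (propb P).
Proof. by rewrite /propb; case: excluded_middle_informative => ?; constructor. Qed.

Definition sel (V : finType) (K : {set V}) (P : V -> Prop) : {set V} := [set t in K | propb (P t)].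
Lemma selP (V : finType) (K : {set V}) P t : (t \in sel K P) <-> (t \in K /\ P t).
Proof. by rewrite inE; split=> [/andP[? /propbP]|[-> /propbP]]. Qed.

Lemma sel_sub (V : finType) (K : {set V}) P : sel K P \subset K.
Proof. by apply/subsetP=> t /selP[]. Qed.

(** * Graphs satisfying the wheel lemma *)

Section Graphs.
Variable G : wgraph.
Local Notation e := (@adj G).
Implicit Types (A B C D J K L S T X Y : {set G}) (f g h c : nat -> G) (u v z : G).

Definition col S k :=
  exists f : G -> nat, (forall v, v \in S -> f v < k) /\
    (forall u v, u \in S -> v \in S -> e u v -> f u <> f v).

Definition nb (v : G) : {set G} := [set u | e v u].
Definition hole c n := is_hole e c n.
Definition conn S := connected e S.

(* Induced paths f 0, ..., f n of length n. *)
Definition ipath f n :=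
  forall i j, i < j -> j <= n -> f i <> f j /\ e (f i) (f j) = (j == i.+1).

Lemma eC u v : e u v = e v u. Proof. exact: adj_sym. Qed.
Lemma eI u : e u u = false. Proof. exact: adj_irr. Qed.
Lemma e_neq u v : e u v -> u <> v.
Proof. by move=> euv E; rewrite E eI in euv. Qed.

Lemma colS S T k m : T \subset S -> k <= m -> col S k -> col T m.
Proof.
move=> /subsetP sTS lekm [f [fk fp]]; exists f; split=> [v /sTS /fk|u v /sTS uS /sTS].
  by move/leq_trans; apply.
exact: fp.
Qed.

Lemma colU S T k m : col S k -> col T m -> col (S :|: T) (k + m).
Proof.
move=> [f [fk fp]] [g [gm gp]].
exists (fun v => if v \in S then f v else k + g v); split=> [v|u v].
  rewrite inE; case: ifP => [/fk|_ /gm]; lia.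
rewrite !inE; case: ifP => [uS _|_ /= uT]; case: ifP => [vS _|_ /= vT] euv.
- exact: fp.
- by have := fk _ uS; lia.
- by have := fk _ vS; lia.
- by have := gp _ _ uT vT euv; lia.
Qed.

Lemma col_stable S : (forall u v, u \in S -> v \in S -> ~~ e u v) -> col S 1.
Proof.
by move=> st; exists (fun=> 0); split=> // u v uS vS euv; have := st u v uS vS; rewrite euv.
Qed.

Lemma ncolD S T k m : ~ col S (k + m) -> col T m -> ~ col (S :\: T) k.
Proof.
move=> nS cT cD; apply: nS; apply: colS (colU cD cT) => //.
by apply/subsetP=> v; rewrite !inE; case: (v \in T); rewrite ?orbT //= => ->.
Qed.

Lemma ncol_ex S k : ~ col S k -> exists x, x \in S.
Proof.
move=> nS; case: (set_0Vmem S) => [E|[x xS]]; last by exists x.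
by case: nS; exists (fun=> 0); split=> u; rewrite E inE.
Qed.

Lemma ncolS S T k m : T \subset S -> m <= k -> ~ col T k -> ~ col S m.
Proof. by move=> s1 s2 nT cS; apply: nT; apply: colS s1 s2 cS. Qed.

(** Take a smallest subset that is closed under adjacency in [S] and not [k]-colourable. A property
    separating two of its vertices would split it into two smaller closed parts without edges
    between them, and their colourings would combine. *)
Lemma component S k : ~ col S k -> exists T,
  [/\ T \subset S, conn T, ~ col T k & forall u v, u \in T -> v \in S -> e u v -> v \in T].
Proof.
move=> nS.
have [|T [[sTS nT clT] mT]] := @min_set _ (fun T => [/\ T \subset S, ~ col T k &
    forall u v, u \in T -> v \in S -> e u v -> v \in T]).
  by exists S; split.
exists T; split=> // P [x xT Px] Pst y yT; apply: NNPP => nPy.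
pose bP v := if excluded_middle_informative (P v) then true else false.
have bPP v : reflect (P v) (bP v).
  by rewrite /bP; case: excluded_middle_informative => ?; constructor.
pose T1 := [set v in T | bP v]; pose T2 := [set v in T | ~~ bP v].
have cut u v : u \in T -> v \in T -> e u v -> bP u = bP v.
  move=> uT vT euv; apply/bPP/bPP; first exact: Pst.
  by apply: Pst => //; rewrite eC.
have c1 : col T1 k.
  apply: NNPP => n1; apply: (mT T1).
    apply/properP; split; first by apply/subsetP=> v; rewrite inE => /andP[].
    by exists y => //; rewrite inE yT /=; apply/bPP.
  split=> //; first by apply/subsetP=> v; rewrite inE => /andP[/(subsetP sTS)].
  move=> u v; rewrite !inE => /andP[uT Pu] vS euv.
  by have vT := clT _ _ uT vS euv; rewrite vT -(cut u v).
have c2 : col T2 k.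
  apply: NNPP => n1; apply: (mT T2).
    apply/properP; split; first by apply/subsetP=> v; rewrite inE => /andP[].
    by exists x => //; rewrite inE xT /= negbK; apply/bPP.
  split=> //; first by apply/subsetP=> v; rewrite inE => /andP[/(subsetP sTS)].
  move=> u v; rewrite !inE => /andP[uT Pu] vS euv.
  by have vT := clT _ _ uT vS euv; rewrite vT -(cut u v).
case: c1 c2 => [f [fk fp]] [g [gk gp]]; apply: nT.
exists (fun v => if bP v then f v else g v); split=> [v vT|u v uT vT euv].
  by case: ifP => Pv; [apply: fk | apply: gk]; rewrite inE vT Pv.
rewrite (cut u v) //; case: ifP => Pv.
  by apply: fp => //; rewrite inE ?uT ?vT ?(cut u v) ?Pv.
by apply: gp => //; rewrite inE ?uT ?vT ?(cut u v) ?Pv.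
Qed.

Lemma col_parity S (d : G -> nat) b :
  (forall u v, u \in S -> v \in S -> e u v -> odd (d u) != odd (d v)) -> b = 2 -> col S b.
Proof.
move=> H ->; exists (fun v => odd (d v) : nat); split=> [v _|u v uS vS euv].
  by case: odd.
by have := H u v uS vS euv; case: odd; case: odd.
Qed.

Lemma conn_edge S A : conn S -> (exists2 x, x \in S & x \in A) ->
  (exists2 y, y \in S & y \notin A) ->
  exists u v, [/\ u \in S, v \in S, u \in A, v \notin A & e u v].
Proof.
move=> cS [x xS xA] [y yS yA]; apply: NNPP => nE.
have /negP[] := yA; apply: (cS (fun v => v \in A)) => //; first by exists x.
move=> u v uS vS euv uA; apply: contraT => vA.
by case: nE; exists u, v.
Qed.

Lemma conn1 x : conn [set x].
Proof. by move=> P [y /set1P-> Px] _ z /set1P->. Qed.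

Lemma conn_spread S X (P : G -> Prop) w : conn S -> S \subset X ->
  (forall u v, u \in X -> v \in X -> e u v -> P u -> P v) ->
  w \in S -> P w -> forall v, v \in S -> P v.
Proof.
move=> cS /subsetP sSX Pst wS Pw; apply: cS; first by exists w.
by move=> u v /sSX uX /sSX vX; apply: Pst.
Qed.

Lemma conn_star S T : conn S -> (forall t, t \in T -> exists2 s, s \in S & e t s) ->
  conn (S :|: T).
Proof.
move=> cS H P [z zST Pz] Pst; have spS w := conn_spread (w := w) cS (subsetUl S T) Pst.
have [w wS Pw] : exists2 w, w \in S & P w.
  move: (zST); rewrite inE => /orP[zS|zT]; first by exists z.
  by have [s sS ets] := H _ zT; exists s => //; apply: Pst Pz => //; rewrite inE sS.
move=> v; rewrite inE => /orP[vS|vT]; first exact: spS wS Pw v vS.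
have [s sS ets] := H _ vT.
apply: (Pst s v); rewrite ?inE ?sS ?vT ?orbT ?[e s v]eC //.
exact: spS wS Pw s sS.
Qed.

Lemma conn_overlap S T x : conn S -> conn T -> x \in S -> x \in T -> conn (S :|: T).
Proof.
move=> cS cT xS xT P [y yST Py] Pst.
have spS w := conn_spread (w := w) cS (subsetUl S T) Pst.
have spT w := conn_spread (w := w) cT (subsetUr S T) Pst.
have Px : P x by move: yST; rewrite inE => /orP[yS|yT]; [apply: spS yS Py x xS|apply: spT yT Py x xT].
by move=> v; rewrite inE => /orP[vS|vT]; [apply: spS xS Px v vS | apply: spT xT Px v vT].
Qed.

Lemma connU S T x y : conn S -> conn T -> x \in S -> y \in T -> e x y -> conn (S :|: T).
Proof.
move=> cS cT xS yT exy.
have -> : S :|: T = (S :|: [set y]) :|: T by rewrite -setUA (setUidPr (_ : [set y] \subset T)) ?sub1set.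
apply: (conn_overlap (x := y) _ cT) => //; last by rewrite !inE eqxx orbT.
by apply: conn_star cS _ => t /set1P->; exists x; rewrite // eC.
Qed.

Definition pset f n : {set G} := [set v | [exists i : 'I_n.+1, f i == v]].

Lemma psetP f n v : reflect (exists2 i, i <= n & f i = v) (v \in pset f n).
Proof.
rewrite inE; apply: (iffP existsP) => [[i /eqP<-]|[i lein <-]].
  by exists i => //; rewrite -ltnS.
by exists (Ordinal (lein : i < n.+1)).
Qed.

Lemma mem_pset f n i : i <= n -> f i \in pset f n.
Proof. by move=> H; apply/psetP; exists i. Qed.

Lemma conn_pset f n : (forall i, i < n -> e (f i) (f i.+1)) -> conn (pset f n).
Proof.
move=> H P [x /psetP[i0 lei0 <-] P0] Pst y /psetP[j lej <-].
have up i : i + i0 <= n -> P (f (i + i0)).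
  elim: i => [//|i IH] le; apply: (Pst (f (i + i0))); rewrite ?mem_pset //; try lia.
    by apply: H; lia.
  by apply: IH; lia.
have dn i : i <= i0 -> P (f (i0 - i)).
  elim: i => [|i IH] le; first by rewrite subn0.
  apply: (Pst (f (i0 - i))); rewrite ?mem_pset //; try lia.
    have -> : i0 - i = (i0 - i.+1).+1 by lia.
    by rewrite eC; apply: H; lia.
  by apply: IH; lia.
case: (leqP j i0) => hj.
  have -> : j = i0 - (i0 - j). lia. apply: dn. lia.
have -> : j = (j - i0) + i0. lia. apply: up. lia.
Qed.

Lemma ipath_step f n i : ipath f n -> i < n -> e (f i) (f i.+1).
Proof. by move=> H lt; have [|//|_ ->] := H i i.+1; rewrite ?eqxx. Qed.

Lemma ipathE f n i j : ipath f n -> i <= n -> j <= n ->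
  e (f i) (f j) = (j == i.+1) || (i == j.+1).
Proof.
move=> H hi hj; case: (ltngtP i j) => [lt|lt|->].
- by have [_ ->] := H _ _ lt hj; lia.
- by rewrite eC; have [_ ->] := H _ _ lt hi; lia.
- by rewrite eI; lia.
Qed.

Lemma ipath_inj f n i j : ipath f n -> i <= n -> j <= n -> f i = f j -> i = j.
Proof.
move=> H hi hj E; case: (ltngtP i j) => [lt|lt|//].
- by have [/(_ E)] := H _ _ lt hj.
- by have [/(_ (esym E))] := H _ _ lt hi.
Qed.
Lemma conn_ipath f n : ipath f n -> conn (pset f n).
Proof. by move=> H; apply: conn_pset => i; apply: ipath_step. Qed.

(** * Breadth-first search and shortest paths *)

Lemma bfs S L : conn S -> L \subset S -> (exists x, x \in L) ->
  exists (d : G -> nat) (par : G -> G),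
  [/\ forall v, v \in S -> (d v = 0 <-> v \in L),
      forall v, v \in S -> 0 < d v -> [/\ par v \in S, e v (par v) & d v = (d (par v)).+1]
    & forall u v, u \in S -> v \in S -> e u v -> d u <= (d v).+1].
Proof.
move=> cS /subsetP sLS [x0 x0L].
pose B n := iter n (fun B => B :|: [set v in S | [exists u in B, e u v]]) L.
have BS n v : v \in B n -> v \in S.
  by elim: n v => [v /sLS //|n IH v] /=; rewrite !inE => /orP[/IH|/andP[]].
have Bst n u v : u \in B n -> v \in S -> e u v -> v \in B n.+1.
  move=> uB vS euv; rewrite /= !inE vS; apply/orP; right; apply/existsP; exists u.
  by rewrite uB.
have ex v : v \in S -> exists n, v \in B n.
  move: v; apply: cS; first by exists x0; [apply: sLS | exists 0].
  by move=> u v uS vS euv [n uB]; exists n.+1; apply: Bst uB vS euv.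
(* The distance to [L] is the least index of a ball containing [v]; 0 is a default for vertices that
   no ball reaches. *)
pose d v := if excluded_middle_informative (exists n, v \in B n) is left H then ex_minn H else 0.
have dP v : v \in S -> v \in B (d v) /\ forall n, v \in B n -> d v <= n.
  by move/ex=> H; rewrite /d; case: excluded_middle_informative => // H'; case: ex_minnP.
have step v : v \in S -> 0 < d v -> exists u, [/\ u \in S, e v u & d v = (d u).+1].
  move=> vS d0; have [vB mB] := dP _ vS.
  case E: (d v) vB d0 => [//|n] /=; rewrite !inE => /orP[vB _|/andP[_ /existsP[u /andP[uB euv]]] _].
    by have := mB _ vB; lia.
  have uS := BS _ _ uB; exists u; split=> //; first by rewrite eC.
  have [uB' mB'] := dP _ uS; have := mB' _ uB.
  have := mB _ (Bst _ _ _ uB' vS euv); lia.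
have [par parP] := @choose_fun G G x0 (fun v u => [/\ u \in S, e v u & d v = (d u).+1])
   (fun v => v \in S /\ 0 < d v) (fun v H => step v H.1 H.2).
exists d, par; split=> [v vS|v vS d0|u v uS vS euv].
- have [vB mB] := dP _ vS; split=> [E|vL]; first by rewrite E in vB.
  by have := mB 0 vL; lia.
- exact: parP.
- have [uB mB] := dP _ uS; have [vB' mB'] := dP _ vS.
  by apply: mB; apply: Bst vB' uS _; rewrite eC.
Qed.

(* Shortest paths in S; d plays the role of the distance to the end f k. *)
Definition geod S f k := (forall i, i <= k -> f i \in S) /\
  exists d : G -> nat, (forall u v, u \in S -> v \in S -> e u v -> d u <= (d v).+1) /\
    (forall i, i <= k -> d (f i) = k - i) /\ (forall i, i < k -> e (f i) (f i.+1)).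

Lemma geod_ipath S f k : geod S f k -> ipath f k.
Proof.
move=> [fS [d [dl [dE st]]]] i j ltij lejk; split.
  by move/(congr1 d); rewrite !dE; lia.
apply/idP/idP => [eij|/eqP->]; last by apply: st; lia.
have := dl (f i) (f j); rewrite !dE ?fS; try lia.
by move/(_ isT isT eij); lia.
Qed.

(** Start at a vertex of [J] nearest to [L] and follow parents. Minimality keeps all but the first
    two vertices from touching [J]; the distances keep all but the last two from touching [L]. *)
Lemma shortest_path S J L : conn S -> J \subset S -> L \subset S ->
  (exists x, x \in J) -> (exists x, x \in L) ->
  exists f k, [/\ geod S f k, f 0 \in J, f k \in L,
    (forall i u, i <= k -> u \in J -> f i = u \/ e (f i) u -> i <= 1 /\ (f i = u -> i = 0)) &
    (forall i u, i <= k -> u \in L -> f i = u \/ e (f i) u -> k <= i.+1 /\ (f i = u -> i = k))].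
Proof.
move=> cS sJ sL [x0 xJ] nL.
have [d [par [d0 dp dl]]] := bfs cS sL nL.
have [|k [[x [xJ' dx]] mk]] := @min_nat (fun n => exists x, x \in J /\ d x = n).
  by exists (d x0), x0.
have mk' u : u \in J -> k <= d u.
  by move=> uJ; rewrite leqNgt; apply/negP=> /mk; apply; exists u.
have xS := subsetP sJ _ xJ'.
pose f i := iter i par x.
have fP i : i <= k -> f i \in S /\ d (f i) = k - i.
  elim: i => [|i IH] le; first by rewrite subn0.
  have [|fS df] := IH; first lia.
  have [|pS _ dE] := dp (f i) fS; first by rewrite df; lia.
  by split=> //=; rewrite -/(f i); lia.
exists f, k; split.
- split=> [i /fP[]//|]; exists d; split=> //; split=> i le; first by have [] := fP i le.
  have [|fS df] := fP i; first lia.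
  by have [|] := dp (f i) fS; first by rewrite df; lia.
- by [].
- have [fS dE] := fP k (leqnn k); apply/(d0 _ fS); lia.
- move=> i u le uJ H; have [fS dE] := fP i le; have := mk' u uJ; have uS := subsetP sJ _ uJ.
  move=> du; split; last by move=> E; move: dE; rewrite E; lia.
  case: H => [E|]; first by move: dE; rewrite E; lia.
  by rewrite eC => eu; have := dl _ _ uS fS eu; lia.
- move=> i u le uL H; have [fS dE] := fP i le; have uS := subsetP sL _ uL.
  have du := (d0 _ uS).2 uL.
  split; last by move=> E; move: dE; rewrite E; lia.
  case: H => [E|eu]; first by move: dE; rewrite E; lia.
  by have := dl _ _ fS uS eu; lia.
Qed.

(** * Holes, neighbourhoods and levels *)

Lemma hole_e c n i j : hole c n -> i < n -> j < n -> e (c i) (c j) =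
  [|| j == i.+1, i == j.+1, (i == 0) && (j == n.-1) | (j == 0) && (i == n.-1)].
Proof. exact: (is_hole_e (@adj_sym G) (@adj_irr G)). Qed.

Lemma hole_inj c n i j : hole c n -> i < n -> j < n -> c i = c j -> i = j.
Proof. exact: is_hole_inj. Qed.

Lemma hole_ge7 c n : hole c n -> 7 <= n.
Proof. exact: adj_hole7. Qed.

Lemma hole_rot c n k : hole c n -> hole (fun i => c ((i + k) %% n)) n.
Proof. by move=> H; apply: (is_hole_rot (@adj_sym G) (@adj_irr G) k H). Qed.

Lemma hole_ipath c n m : hole c n -> m.+1 < n -> ipath c m.
Proof.
move=> H ltm i j ltij lejm; have [n2 on Hc] := H.
have [|ne ->] := Hc i j ltij; first lia.
by split=> //; lia.
Qed.

Lemma no_triangle u v w : e u v -> e v w -> ~~ e u w.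
Proof.
move=> uv vw; apply/negP=> uw.
suff /hole_ge7 : hole (fun i => if i == 0 then u else if i == 1 then v else w) 3 by [].
split=> // [] [|[|[|i]]] [|[|[|j]]] //= _ _; split=> //; exact: e_neq.
Qed.

Lemma nb_col (v : G) : col (nb v) 1.
Proof.
apply: col_stable => x y; rewrite !inE => vx vy; apply/negP=> xy.
by have := no_triangle vx xy; rewrite vy.
Qed.

Definition pcol f m (b : bool) (v : G) := [exists i : 'I_m.+1, (f i == v) && (odd i == b)].

Lemma pcolE f m b i : ipath f m -> i <= m -> pcol f m b (f i) = (odd i == b).
Proof.
move=> H lei; apply/existsP/idP => [[j /andP[/eqP E]]|oi].
  by rewrite (ipath_inj H _ lei E) // -ltnS.
by exists (Ordinal (lei : i < m.+1)); rewrite eqxx.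
Qed.

Lemma pcol_proper f m b x y : ipath f m -> x \in pset f m -> y \in pset f m ->
  e x y -> pcol f m b x != pcol f m b y.
Proof.
move=> H /psetP[i hi <-] /psetP[j hj <-]; rewrite (ipathE H) // => E.
by rewrite !pcolE //; case: b; lia.
Qed.

(** Two palettes of [k] colours alternate with the parity of the level; edges join vertices of equal
    or consecutive levels. *)
Lemma level_col S (d : G -> nat) k : (forall u v, u \in S -> v \in S -> e u v -> d u <= (d v).+1) ->
  (forall j, col [set v in S | d v == j] k) -> col S (2 * k).
Proof.
move=> dl H.
have ex j : True -> exists f : G -> nat, (forall v, v \in S -> d v = j -> f v < k) /\
   (forall u v, u \in S -> v \in S -> d u = j -> d v = j -> e u v -> f u <> f v).
  move=> _; have [f [fk fp]] := H j; exists f; split=> [v vS E|u v uS vS Eu Ev euv].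
    by apply: fk; rewrite inE vS E eqxx.
  by apply: fp => //; rewrite inE ?uS ?vS ?Eu ?Ev eqxx.
have [f fP] := choose_fun (fun=> 0) ex.
exists (fun v => (if odd (d v) then k else 0) + f (d v) v); split=> [v vS|u v uS vS euv].
  by have [/(_ v vS erefl) lt _] := fP (d v) I; case: odd; lia.
have [/(_ v vS erefl) ltv prop] := fP (d v) I.
have [/(_ u uS erefl) ltu _] := fP (d u) I.
have l1 := dl _ _ uS vS euv; have l2 : d v <= (d u).+1 by apply: dl; rewrite // eC.
case: (d u =P d v) => [E|ne].
  by rewrite E => /addnI; apply: prop.
have : odd (d u) != odd (d v) by lia.
by case: odd; case: odd => //= _; lia.
Qed.

(** Levels 0 and 1 are stable, the latter because a neighbourhood contains no edge, so the level
    that needs many colours lies further down. *)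
Lemma deep_level S z (d : G -> nat) (par : G -> G) k : 0 < k ->
  (forall v, v \in S -> (d v = 0 <-> v \in [set z])) ->
  (forall v, v \in S -> 0 < d v -> [/\ par v \in S, e v (par v) & d v = (d (par v)).+1]) ->
  (forall u v, u \in S -> v \in S -> e u v -> d u <= (d v).+1) ->
  ~ col S (2 * k) -> exists2 j, 1 < j & ~ col [set v in S | d v == j] k.
Proof.
move=> k0 d0 dp dl nS; apply: NNPP => H; apply: nS; apply: level_col dl _ => j.
case: (ltnP 1 j) => hj; first by apply: NNPP => nj; apply: H; exists j.
apply: (@colS _ [set v in S | d v == j] 1) => //.
apply: col_stable => u v /setIdP[uS /eqP du] /setIdP[vS /eqP dv].
have zof w : w \in S -> d w = 1 -> e z w.
  move=> wS dw; have [|pS ew dw'] := dp w wS; first by rewrite dw.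
  have /(d0 _ pS)/set1P E : d (par w) = 0 by lia.
  by rewrite -E eC.
case: (d u =P 1) => du1.
  apply/negP=> euv; have := no_triangle (zof u uS du1) euv.
  by rewrite zof //; lia.
have /(d0 _ uS)/set1P-> : d u = 0 by lia.
have /(d0 _ vS)/set1P-> : d v = 0 by lia.
by rewrite eI.
Qed.

(** * Odd holes from an edge inside a level *)

Section OddHole.
Variables (S : {set G}) (z : G) (d : G -> nat) (par : G -> G).
Hypotheses (d0 : forall v, v \in S -> (d v = 0 <-> v \in [set z]))
  (dp : forall v, v \in S -> 0 < d v -> [/\ par v \in S, e v (par v) & d v = (d (par v)).+1])
  (dl : forall u v, u \in S -> v \in S -> e u v -> d u <= (d v).+1).

Definition anc v n := iter n par v.

Lemma ancS v n : v \in S -> n <= d v -> anc v n \in S /\ d (anc v n) = d v - n.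
Proof.
move=> vS; elim: n => [|n IH] le; first by rewrite subn0.
have [|aS da] := IH; first lia.
have [|pS _ E] := dp aS; first by rewrite da; lia.
by split=> //=; rewrite -/(anc v n); lia.
Qed.

Lemma anc_e v n : v \in S -> n < d v -> e (anc v n) (anc v n.+1).
Proof.
move=> vS lt; have [|aS da] := @ancS v n vS; first lia.
by have [|//] := dp aS; rewrite da; lia.
Qed.

Lemma anc_z v : v \in S -> anc v (d v) = z.
Proof.
move=> vS; have [aS da] := ancS vS (leqnn _).
by apply/set1P/(d0 aS); rewrite da subnn.
Qed.

Lemma lev_e x y : x \in S -> y \in S -> e x y -> (d x <= (d y).+1) && (d y <= (d x).+1).
Proof. by move=> xS yS exy; rewrite !dl // eC. Qed.

(** Follow the parents from both ends of the edge. Let [ns] be the last index at which the two lines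
    of ancestors are adjacent at equal height, and [n'] the first later index reached by an edge
    between the lines at consecutive heights; it exists because both lines end in [z]. The segments
    in between close to an odd hole. Up to exchanging [u] and [v], the last edge ends on the line of
    [a]. *)
Lemma odd_hole_layer u v : u \in S -> v \in S -> e u v -> d u = d v ->
  exists a b ns n', [/\ (a = u /\ b = v) \/ (a = v /\ b = u), ns < n' <= d u,
    e (anc a ns) (anc b ns) /\ e (anc b n'.-1) (anc a n'),
    (forall i, i < n' -> anc a i <> anc b i) &
    (forall p q, ns <= p <= n' -> ns <= q < n' -> e (anc a p) (anc b q) ->
       (p = ns /\ q = ns) \/ (p = n' /\ q = n'.-1))].
Proof.
move=> uS vS euv duv.
have [|n le|ns [[lens ens] mns]] := @max_nat (fun n => n <= d u /\ e (anc u n) (anc v n)) (d u).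
- by exists 0.
- by case: le.
have zz : anc u (d u) = anc v (d u) by rewrite anc_z // duv anc_z.
have ltns : ns < d u.
  rewrite ltn_neqAle lens andbT; apply/eqP=> E.
  by move: ens; rewrite E zz eI.
have [|n' [[ltn' len' en'] mn']] := @min_nat (fun n => [/\ ns < n, n <= d u &
   e (anc u n.-1) (anc v n) || e (anc v n.-1) (anc u n)]).
  exists (d u); split=> //; apply/orP; left; rewrite -zz.
  have E : d u = (d u).-1.+1 by lia.
  by rewrite {2}E; apply: anc_e => //; lia.
(* A common vertex of the lines is adjacent to its predecessor on the other line, so the lines stay
   disjoint before [n']. *)
have neq i : i < n' -> anc u i <> anc v i.
  move=> lti E; case: (leqP i ns) => h.
    have E' k : anc u (k + i) = anc v (k + i) by rewrite /anc !iterD -/(anc u i) E.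
    by move: ens; have := E' (ns - i); rewrite subnK // => ->; rewrite eI.
  apply: (mn' i lti); split=> //; first lia.
  have Ei : i = i.-1.+1 by lia.
  apply/orP; left; rewrite -E {2}Ei; apply: anc_e => //; lia.
have dA i : i <= d u -> anc u i \in S /\ d (anc u i) = d u - i by exact: ancS.
have dB i : i <= d u -> anc v i \in S /\ d (anc v i) = d u - i.
  by rewrite duv; apply: ancS.
have key p q : ns <= p <= n' -> ns <= q <= n' -> e (anc u p) (anc v q) ->
    [\/ p = ns /\ q = ns, p = n' /\ q = n'.-1 | p = n'.-1 /\ q = n'].
  move=> /andP[p1 p2] /andP[q1 q2] epq.
  have [|pS dp'] := dA p; first lia.
  have [|qS dq'] := dB q; first lia.
  have := lev_e pS qS epq; rewrite dp' dq' => le.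
  case: (ltngtP p q) => hpq.
  - have Ep : p = q.-1 by lia.
    case: (ltnP q n') => hq; last by constructor 3; lia.
    by case: (mn' q hq); split; [lia|lia|rewrite -Ep epq].
  - have Ep : q = p.-1 by lia.
    case: (ltnP p n') => hq; last by constructor 2; lia.
    by case: (mn' p hq); split; [lia|lia|rewrite eC -Ep in epq *; rewrite epq orbT].
  - subst q; case: (ltnP ns p) => h; last by constructor 1; lia.
    by case: (mns p h); split=> //; lia.
case/orP: en' => en'.
  exists v, u, ns, n'; split=> //; first by right.
  - by rewrite ltn'.
  - by rewrite eC.
  - by move=> i /neq /nesym.
  - move=> p q hp hq; rewrite eC => epq.
    have [||[? ?]|[? ?]|[? ?]] := key q p _ _ epq; try lia.
exists u, v, ns, n'; split=> //; first by left.
- by rewrite ltn'.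
- move=> p q hp hq epq.
  have [||[? ?]|[? ?]|[? ?]] := key p q _ _ epq; try lia.
Qed.

(** The hole starts at [anc a n'], its vertex closest to [z], runs down the line of [a] to index
    [ns], crosses to the line of [b] and returns to index [n'.-1]. *)
Definition layer_hole a b ns n' i :=
  if i <= n' - ns then anc a (n' - i) else anc b (i + ns - (n' - ns).+1).

Lemma layer_holeP a b ns n' : a \in S -> b \in S -> d a = d b -> ns < n' <= d a ->
  e (anc a ns) (anc b ns) -> e (anc b n'.-1) (anc a n') ->
  (forall i, i < n' -> anc a i <> anc b i) ->
  (forall p q, ns <= p <= n' -> ns <= q < n' -> e (anc a p) (anc b q) ->
       (p = ns /\ q = ns) \/ (p = n' /\ q = n'.-1)) ->
  hole (layer_hole a b ns n') (2 * (n' - ns)).+1.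
Proof.
move=> aS bS dab /andP[lt le] e1 e2 ne key.
split; [lia| by rewrite /= oddM | ] => i j ltij ltj.
have dA k : k <= d a -> anc a k \in S /\ d (anc a k) = d a - k by exact: ancS.
have dB k : k <= d a -> anc b k \in S /\ d (anc b k) = d a - k.
  by rewrite dab; apply: ancS.
rewrite /layer_hole; case: (leqP i (n' - ns)) => hi; case: (leqP j (n' - ns)) => hj; try lia.
- have [|iS di] := dA (n' - i); first lia.
  have [|jS dj] := dA (n' - j); first lia.
  split; first by move/(congr1 d); rewrite di dj; lia.
  apply/idP/idP => [/(lev_e iS jS)|]; first by rewrite di dj; lia.
  case/orP => [/eqP E|]; last lia.
  have -> : n' - i = (n' - j).+1 by lia.
  by rewrite eC; apply: anc_e => //; lia.
- have [|iS di] := dA (n' - i); first lia.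
  have [|jS dj] := dB (j + ns - (n' - ns).+1); first lia.
  split.
    case: (n' - i =P j + ns - (n' - ns).+1) => [->|h]; first by apply: ne; lia.
    by move/(congr1 d); rewrite di dj; lia.
  apply/idP/idP => [/key|]; first by case; try lia; case; lia.
  case/orP => [/eqP E|/andP[/eqP E1 /eqP E2]].
    have -> : n' - i = ns by lia.
    by have -> : j + ns - (n' - ns).+1 = ns by lia.
  have -> : n' - i = n' by lia.
  have -> : j + ns - (n' - ns).+1 = n'.-1 by lia.
  by rewrite eC.
- have [|iS di] := dB (i + ns - (n' - ns).+1); first lia.
  have [|jS dj] := dB (j + ns - (n' - ns).+1); first lia.
  split; first by move/(congr1 d); rewrite di dj; lia.
  apply/idP/idP => [/(lev_e iS jS)|]; first by rewrite di dj; lia.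
  case/orP => [/eqP E|]; last lia.
  have -> : j + ns - (n' - ns).+1 = (i + ns - (n' - ns).+1).+1 by lia.
  by apply: anc_e => //; lia.
Qed.

End OddHole.

(** If no edge lies inside a level, the parity of the level is a 2-colouring; an edge inside a level
    yields an odd hole. *)
Lemma ncol2_hole K : ~ col K 2 -> exists c n, hole c n /\ forall i, i < n -> c i \in K.
Proof.
move=> nK; have [S [sSK cS nS _]] := component nK.
have [z zS] := ncol_ex nS.
have [||d [par [d0 dp dl]]] := @bfs S [set z] cS; [by rewrite sub1set|by exists z; rewrite inE|].
have [[u [v [uS vS euv duv]]]|H] := classic (exists u v, [/\ u \in S, v \in S, e u v & d u = d v]).
  have [a [b [ns [n' [ab lt [e1 e2] ne key]]]]] := odd_hole_layer d0 dp dl uS vS euv duv.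
  have [aS bS dau dbu] : [/\ a \in S, b \in S, d a = d u & d b = d u].
    by case: ab => [[-> ->]|[-> ->]].
  exists (layer_hole par a b ns n'), (2 * (n' - ns)).+1; split.
    by apply: (layer_holeP dp dl) => //; rewrite ?dau ?dbu.
  move=> i lti; apply: (subsetP sSK); rewrite /layer_hole; case: leqP => hi.
    by have [|] := @ancS S d par dp a (n' - i) aS; first by rewrite dau; lia.
  by have [|] := @ancS S d par dp b (i + ns - (n' - ns).+1) bS; first by rewrite dbu; lia.
case: nS; apply: (@col_parity _ d) => // u v uS vS euv.
have l1 := dl _ _ uS vS euv; have l2 := dl _ _ vS uS; rewrite eC in l2; have := l2 euv.
have : d u <> d v by move=> E; apply: H; exists u, v.
lia.
Qed.

(** * Sets attached to bipartite connected hubs *)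

(** On an odd hole in [K] every index would be touched by the same class of [X], and already the
    indices 0 to 3 have more than one parity change. *)
Lemma hub_touch_col X (ka : G -> bool) K : conn X ->
  (forall x y, x \in X -> y \in X -> e x y -> ka x != ka y) ->
  (forall t, t \in K -> t \notin X) ->
  (forall t, t \in K -> exists x, [/\ x \in X, ~~ ka x & e x t]) ->
  (forall t x, t \in K -> x \in X -> ka x -> ~~ e x t) -> col K 2.
Proof.
move=> cX pX KX tK nK; apply: NNPP => /ncol2_hole[c [n [H cK]]].
have n7 := hole_ge7 H.
have [i lt|x i xX kx lt|k [b kb]] := adj_wheel H cX pX.
- exact: KX (cK i lt).
- exact: nK (cK i lt) xX kx.
have kb' i : i < n -> odd i = b (+) (k <= i).
  by move=> lt; have [x [xX nk exi]] := tK _ (cK i lt); apply: kb exi.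
have [h0 h1 h2 h3] : [/\ 0 < n, 1 < n, 2 < n & 3 < n] by split; lia.
have := kb' _ h0; have := kb' _ h1; have := kb' _ h2; have := kb' _ h3.
by case: b {kb kb'} => /=; lia.
Qed.

(** The legs themselves are touched by [X] and so need only 2 colours. Adding one stable class of
    legs to [X] gives a bipartite hub with these legs in the touching class, so the vertices with a
    leg in that class need 2 colours again. *)
Lemma hub_leg_col X (ka : G -> bool) K : conn X ->
  (forall x y, x \in X -> y \in X -> e x y -> ka x != ka y) ->
  (forall t, t \in K -> t \notin X) ->
  (forall t x, t \in K -> x \in X -> ~~ e x t) ->
  (forall t, t \in K -> exists a, [/\ e a t, exists x, [/\ x \in X, ka x & e x a] &
      forall x, x \in X -> ~~ ka x -> ~~ e x a]) -> col K 4.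
Proof.
move=> cX pX KX nK tK.
case: (set_0Vmem K) => [->|[t0 _]]; first by exists (fun=> 0); split=> v; rewrite inE.
have [l lP] := @choose_fun G G t0 (fun t a => [/\ e a t, exists x, [/\ x \in X, ka x & e x a] &
      forall x, x \in X -> ~~ ka x -> ~~ e x a]) (fun t => t \in K) tK.
pose A := [set l t | t in K].
have AX a : a \in A -> a \notin X.
  move=> /imsetP[t tK' ->]; apply/negP=> lX; have [elt _ _] := lP t tK'.
  by have := nK t _ tK' lX; rewrite elt.
have [g [g2 gp]] : col A 2.
  apply: (@hub_touch_col X (fun x => ~~ ka x)) => //.
  - by move=> x y xX yX /(pX _ _ xX yX); case: (ka x); case: (ka y).
  - by move=> a /imsetP[t tK' ->]; have [_ [x [xX kx ex]] _] := lP t tK'; exists x; rewrite negbK.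
  - by move=> a x /imsetP[t tK' ->] xX kx; have [_ _ H] := lP t tK'; apply: H.
have half m : col [set t in K | g (l t) == m] 2.
  pose A1 := [set a in A | g a == m].
  apply: (@hub_touch_col (X :|: A1) (fun x => (x \in X) && ka x)).
  - apply: conn_star => // a; rewrite inE => /andP[/imsetP[t tK' ->] _].
    by have [_ [x [xX kx ex]] _] := lP t tK'; exists x; rewrite // eC.
  - have one x a : x \in X -> a \in A1 -> e x a -> ka x.
      move=> xX; rewrite inE => /andP[/imsetP[t tK' ->] _] ex.
      by have [_ _ H] := lP t tK'; apply: contraLR ex; apply: H.
    have A1X a : a \in A1 -> (a \in X) = false.
      by rewrite inE => /andP[/AX/negbTE].
    move=> x y; rewrite !(in_setU _ X); case/orP=> hx; case/orP=> hy exy.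
    + by rewrite hx hy; apply: pX.
    + by rewrite hx (A1X _ hy) (one _ _ hx hy exy).
    + by rewrite hy (A1X _ hx) (one _ _ hy hx) // eC.
    + move: hx hy; rewrite !inE => /andP[xA /eqP gx] /andP[yA /eqP gy].
      by case: (gp _ _ xA yA exy); rewrite gx gy.
  - move=> t; rewrite !inE => /andP[tK' _]; rewrite (negbTE (KX t tK')) /=.
    apply/negP=> /andP[/imsetP[t' tK'' E] _]; have [_ [x [xX _ ex]] _] := lP t' tK''.
    by have := nK t x tK' xX; rewrite E ex.
  - move=> t; rewrite inE => /andP[tK' gt]; exists (l t).
    have lA : l t \in A by apply: imset_f.
    rewrite !inE lA gt orbT (negbTE (AX _ lA)); split=> //.
    by have [] := lP t tK'.
  - by move=> t x; rewrite inE => /andP[tK' _] _ /andP[xX _]; apply: nK.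
apply: (colS _ _ (colU (half 0) (half 1))) => //.
apply/subsetP=> t tK'; rewrite !inE tK' /=.
have := g2 (l t) (imset_f _ tK'); by case: (g (l t)) => [|[|]].
Qed.

Lemma path_leg_col f m K b : ipath f m ->
  (forall t i, t \in K -> i <= m -> f i <> t /\ ~~ e (f i) t) ->
  (forall t, t \in K -> exists a, [/\ e a t, exists i, i <= m /\ e (f i) a &
      forall i, i <= m -> e (f i) a -> odd i = b]) -> col K 4.
Proof.
move=> H nK tK; apply: (@hub_leg_col (pset f m) (pcol f m b)).
- exact: conn_ipath.
- by move=> x y; apply: pcol_proper.
- by move=> t tK'; apply/psetP=> [[i hi E]]; have [/(_ E)] := nK t i tK' hi.
- by move=> t x tK' /psetP[i hi <-]; have [] := nK t i tK' hi.
- move=> t /tK[a [eat [i [hi ei]] H1]]; exists a; split=> //.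
    by exists (f i); rewrite mem_pset // pcolE // (H1 i hi ei) eqxx.
  move=> x /psetP[j hj <-]; rewrite pcolE // => oj; apply/negP=> ej.
  by rewrite (H1 j hj ej) eqxx in oj.
Qed.

Lemma vertex_leg_col v K : (forall t, t \in K -> v <> t /\ ~~ e v t) ->
  (forall t, t \in K -> exists a, e a t /\ e v a) -> col K 4.
Proof.
move=> nK tK; apply: (@path_leg_col (fun=> v) 0 K false).
- by move=> i j; lia.
- by move=> t i tK' _; apply: nK.
- move=> t /tK[a [ea ev]]; exists a; split=> //; first by exists 0.
  by move=> [|i].
Qed.

(** The path takes 2 colours. Its neighbours are coloured by the index, modulo 4, of a chosen
    neighbour on the path: for adjacent vertices these indices differ by at most 3, and equal
    indices would form a triangle. *)
Lemma geod_nbhd_col S f k : geod S f k ->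
  col (sel S (fun v => exists i, i <= k /\ (v = f i \/ e v (f i)))) 6.
Proof.
move=> gd; have H := geod_ipath gd; have [fS [d [dl [dE st]]]] := gd.
pose P v := fun i => (i <= k) && e v (f i).
pose T := sel S (fun v => exists i, P v i).
have cT : col T 4.
  have exT v : v \in T -> exists i, P v i by move/selP=> [].
  have [l lP] := @choose_fun G nat 0 P (fun v => v \in T) exT.
  exists (fun v => l v %% 4); split=> [v _|u v uT vT euv E]; first by rewrite ltn_mod.
  have /andP[lu eu] := lP _ uT; have /andP[lv ev] := lP _ vT.
  have [uS _] := (selP _ _ _).1 uT; have [vS _] := (selP _ _ _).1 vT.
  have l1 := dl _ _ uS vS euv.
  have l2 := dl _ _ uS (fS _ lu) eu.
  have l3 := dl _ _ vS (fS _ lv) ev.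
  have l1' : d v <= (d u).+1 by apply: dl; rewrite // eC.
  have l2' : d (f (l u)) <= (d u).+1 by apply: dl; rewrite ?fS // eC.
  have l3' : d (f (l v)) <= (d v).+1 by apply: dl; rewrite ?fS // eC.
  have d1 := dE _ lu; have d2 := dE _ lv.
  have El : l u = l v by lia.
  by rewrite -El in ev; have := no_triangle euv ev; rewrite eu.
have cf : col (pset f k) 2.
  apply: (@col_parity _ (fun v => pcol f k true v : nat)) => // u v uf vf euv.
  by have := pcol_proper true H uf vf euv; case: pcol; case: pcol.
apply: (colS _ _ (colU cf cT)) => //; apply/subsetP=> v /selP[vS [i [le [->|ev]]]].
  by rewrite inE mem_pset.
by rewrite inE; apply/orP; right; apply/selP; split=> //; exists i; rewrite /P le.
Qed.

(* k is the index where the parity of the touched indices changes from b to ~~ b; k = 0 and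
   k = n allow for no change. *)
Definition lin c n k b (a : G) := forall i, i < n -> e a (c i) -> odd i = b (+) (k <= i).

Definition even_touches c n f m (a : G) (be : bool) :=
  [/\ forall i, i < n -> c i <> a, forall j, j <= m -> f j <> a,
      exists2 j, j <= m & e a (f j) & forall j, j <= m -> e a (f j) -> odd j = be].

(* The path together with a and a' is a bipartite hub in which a and a' lie in the same class. *)
Lemma even_link c n f m a a' be : hole c n -> ipath f m ->
  (forall i j, i < n -> j <= m -> c i <> f j /\ ~~ e (c i) (f j)) ->
  ~~ e a a' -> even_touches c n f m a be -> even_touches c n f m a' be ->
  exists k b, lin c n k b a /\ lin c n k b a'.
Proof.
move=> Hc Hf an naa' [a1 a2 [j hj ej] a4] [b1 b2 [j' hj' ej'] b4].
pose X := pset f m :|: [set a; a'].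
have [|x y xX yX exy|i lt|x i xX kx lt|k [b kb]] :=
    @adj_wheel G c n X (fun x => (x \in pset f m) && pcol f m be x) Hc.
- apply: conn_star; first exact: conn_ipath.
  by move=> t; rewrite !inE => /orP[/eqP->|/eqP->]; [exists (f j)|exists (f j')]; rewrite ?mem_pset.
- have one t i : t \in [set a; a'] -> i <= m -> e (f i) t -> odd i = be.
    by rewrite eC !inE => /orP[/eqP->|/eqP->] le; [apply: a4|apply: b4].
  have out t : t \in [set a; a'] -> (t \in pset f m) = false.
    move=> tA; apply/negbTE/psetP=> [[i le E]]; move: tA; rewrite !inE => /orP[/eqP Et|/eqP Et].
      by apply: (a2 i le); rewrite E.
    by apply: (b2 i le); rewrite E.
  move: xX yX; rewrite !(in_setU _ (pset f m)); case/orP=> hx; case/orP=> hy.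
  + by rewrite hx hy; apply: pcol_proper.
  + case/psetP: (hx) => i le E; subst x.
    by rewrite hx (out _ hy) /= pcolE // (one _ _ hy le exy) eqxx.
  + case/psetP: (hy) => i le E; subst y.
    by rewrite hy (out _ hx) /= pcolE // (one _ _ hx le) ?eqxx // eC.
  + by move: exy hx hy; rewrite !inE => exy /orP[/eqP Ex|/eqP Ex] /orP[/eqP Ey|/eqP Ey];
    subst x y; move: exy naa'; rewrite ?eI // 1?eC => ->.
- rewrite !inE; apply/negP => /orP[/existsP[q /eqP E]|/orP[/eqP E|/eqP E]].
  + exact: (an i q lt (ltn_ord q)).1 (esym E).
  + exact: a1 E.
  + exact: b1 E.
- by case/andP: kx => /psetP[q le <-] _; rewrite eC; have [] := an i q lt le.
have out t : t \in [set a; a'] -> (t \in pset f m) = false.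
  move=> tA; apply/negbTE/psetP=> [[i le E]]; move: tA; rewrite !inE => /orP[/eqP Et|/eqP Et].
    by apply: (a2 i le); rewrite E.
  by apply: (b2 i le); rewrite E.
by exists k, b; split=> i lt ei; apply: kb ei; rewrite ?out // !inE eqxx ?orbT.
Qed.

(** * Chains and links *)

(** [pglue] identifies the end of [f] with the start of [g]; [pjoin] keeps both vertices and relies
    on an edge between them. *)
Definition pglue f p g i := if i <= p then f i else g (i - p).
Definition pjoin f p g i := if i <= p then f i else g (i - p.+1).

Lemma pglue_ipath f p g m : ipath f p -> ipath g m -> g 0 = f p ->
  (forall i j, i < p -> 0 < j <= m -> f i <> g j /\ ~~ e (f i) (g j)) ->
  ipath (pglue f p g) (p + m).
Proof.
move=> Hf Hg E an i j ltij lej; rewrite /pglue; case: (leqP i p) => hi; case: (leqP j p) => hj; try lia.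
- exact: Hf.
- case: (ltnP i p) => hip.
    have [|ne na] := an i (j - p) hip; first lia.
    by split=> //; rewrite (negbTE na); lia.
  have -> : i = p by lia.
  rewrite -E; have [||ne ->] := Hg 0 (j - p); try lia.
  by split=> //; lia.
- by have [||ne ->] := Hg (i - p) (j - p); try lia; split=> //; lia.
Qed.

Lemma pjoin_ipath f p g m : ipath f p -> ipath g m -> e (f p) (g 0) ->
  (forall i j, i <= p -> j <= m -> f i <> g j /\ (e (f i) (g j) -> i = p /\ j = 0)) ->
  ipath (pjoin f p g) (p + m).+1.
Proof.
move=> Hf Hg E an i j ltij lej; rewrite /pjoin; case: (leqP i p) => hi; case: (leqP j p) => hj; try lia.
- exact: Hf.
- have [||ne na] := an i (j - p.+1); try lia.
  split=> //; apply/idP/idP => [/na|/eqP E']; first lia.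
  have -> : i = p by lia.
  by have -> : j - p.+1 = 0 by lia.
- by have [||ne ->] := Hg (i - p.+1) (j - p.+1); try lia; split=> //; lia.
Qed.

Lemma pjoin_hole f p g m : ipath f p -> ipath g m -> e (f p) (g 0) -> e (g m) (f 0) ->
  (forall i j, i <= p -> j <= m ->
     f i <> g j /\ (e (f i) (g j) -> (i = p /\ j = 0) \/ (i = 0 /\ j = m))) ->
  0 < p + m -> odd (p + m) -> hole (pjoin f p g) (p + m).+2.
Proof.
move=> Hf Hg E1 E2 an h0 ho; split=> //=; first by rewrite negbK.
move=> i j ltij lej; rewrite /pjoin; case: (leqP i p) => hi; case: (leqP j p) => hj; try lia.
- by have [|ne ->] := Hf i j ltij; first lia; split=> //; lia.
- have [||ne na] := an i (j - p.+1); try lia.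
  split=> //; apply/idP/idP => [/na|]; first by case; lia.
  case/orP => [/eqP E'|/andP[/eqP E3 /eqP E4]].
    have -> : i = p by lia.
    by have -> : j - p.+1 = 0 by lia.
  by rewrite E3 E4 eC; have -> : (p + m).+1 - p.+1 = m by lia.
- by have [||ne ->] := Hg (i - p.+1) (j - p.+1); try lia; split=> //; lia.
Qed.

Lemma ipath_rev f n : ipath f n -> ipath (fun i => f (n - i)) n.
Proof.
move=> H i j ltij lej; have [||ne E] := H (n - j) (n - i); try lia.
by split; [apply/nesym | rewrite eC E; lia].
Qed.

Lemma ipath_sub f n k m : ipath f n -> k + m <= n -> ipath (fun i => f (k + i)) m.
Proof.
move=> H le i j ltij lej; have [||ne ->] := H (k + i) (k + j); try lia.
by split=> //; lia.
Qed.

Lemma ipathS f n m : ipath f n -> m <= n -> ipath f m.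
Proof. by move=> H le i j ltij lej; apply: H => //; lia. Qed.

(* An induced path outside L whose last vertex is the only one with a neighbour in L. *)
Definition chain P p L := [/\ ipath P p, conn L, forall i, i <= p -> P i \notin L,
  forall i x, i < p -> x \in L -> ~~ e (P i) x & exists2 x, x \in L & e (P p) x].

Lemma chain_glue P p L f k : chain P p L -> ipath f k -> f 0 = P p ->
  (forall i, 0 < i <= k -> f i \in L) -> ipath (pglue P p f) (p + k).
Proof.
move=> [HP _ PL na _] Hf E fL; apply: pglue_ipath => // i j hi hj; split.
  by move=> E'; have := PL i (ltnW hi); rewrite E' fL.
by apply: na => //; apply: fL.
Qed.

Lemma chain_reach S L z : conn S -> conn L -> L \subset S -> (exists x, x \in L) ->
  z \in S -> z \notin L ->
  exists P p, [/\ chain P p L, P 0 = z & forall i, i <= p -> P i \in S].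
Proof.
move=> cS cL /subsetP sL [y yL] zS zL.
pose T := [set v in S | (v \notin L) && [exists w in L, e v w]].
have [||u [v [uS vS uA vA euv]]] := @conn_edge S L cS; [by exists y => //; apply: sL|by exists z|].
have [||||f [k [gd f0 fT _ Tp]]] := @shortest_path S [set z] T cS.
- by rewrite sub1set.
- by apply/subsetP=> x; rewrite inE => /andP[].
- by exists z; rewrite inE.
- by exists v; rewrite inE vS vA /=; apply/existsP; exists u; rewrite uA eC.
have Hf := geod_ipath gd; have [fS _] := gd.
move: f0 => /set1P f0.
have fnT i : i < k -> f i \notin T.
  move=> lt; apply/negP=> h; have [_ /(_ erefl)] := Tp i (f i) (ltnW lt) h (or_introl erefl); lia.
have fnL i : i <= k -> f i \notin L.
  elim: i => [|i IH] le; first by rewrite f0.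
  apply/negP=> h; have := fnT i le; rewrite inE fS ?(ltnW le) // IH ?(ltnW le) //=.
  by move/negP; apply; apply/existsP; exists (f i.+1); rewrite h /=; exact: ipath_step Hf le.
exists f, k; split=> //; split=> //.
  move=> i x lt xL; have := fnT i lt; rewrite inE fS ?(ltnW lt) // fnL ?(ltnW lt) //=.
  by apply: contra => ex; apply/existsP; exists x; rewrite xL.
by move: fT; rewrite inE => /and3P[_ _ /existsP[w /andP[wL ew]]]; exists w.
Qed.

(** Deleting the neighbours of the end of the chain costs one colour and forces at least one new
    vertex; [R] is deleted too, so that the new set [L'] avoids it. *)
Lemma chain_ext P p L R N r : chain P p L -> col R r -> ~ col L (N + 1 + r) ->
  exists P' p' L', [/\ chain P' p' L', p < p', forall i, i <= p -> P' i = P i,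
    forall i, p < i <= p' -> P' i \in L & L' \subset L :\: R /\ ~ col L' N].
Proof.
move=> ch cR nL; have [HP cL PL na [x0 x0L ex0]] := ch.
set z := P p in ex0 *.
have n1 : ~ col (L :\: (nb z :|: R)) N.
  by apply: (@ncolD L (nb z :|: R) N (1 + r)); rewrite ?addnA //; apply: colU (nb_col z) cR.
have [L' [sL' cL' nL' clL']] := component n1.
have L'L v : v \in L' -> [/\ v \in L, ~~ e z v & v \notin R].
  by move/(subsetP sL'); rewrite !inE negb_or => /andP[/andP[? ?] ?].
have zL : z \notin L by apply: PL.
have cS : conn (z |: L) by apply: connU (conn1 (x:=z)) cL _ x0L ex0; rewrite inE.
have [||||f [k [[Hf _ fnL' fna [w wL' ew]] f0 fS]]] := @chain_reach (z |: L) L' z cS cL'.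
- by apply/subsetP=> v /L'L[vL _ _]; rewrite inE vL orbT.
- exact: ncol_ex nL'.
- by rewrite !inE eqxx.
- by apply/negP=> /L'L[h _ _]; rewrite h in zL.
have k0 : 0 < k.
  by rewrite lt0n; apply/eqP=> E; have [_ nzw _] := L'L w wL'; move: nzw; rewrite -f0 -E ew.
have fL i : 0 < i <= k -> f i \in L.
  move=> /andP[i0 ik]; have := fS i ik; rewrite !inE => /orP[/eqP E|//].
  by have := ipath_inj Hf ik (leq0n k); rewrite E f0 => /(_ erefl); lia.
exists (pglue P p f), (p + k), L'; split.
- split=> //.
  + exact: chain_glue ch Hf f0 fL.
  + move=> i le; rewrite /pglue; case: leqP => hi; last by apply: fnL'; lia.
    by apply/negP=> /L'L[h _ _]; have := PL i hi; rewrite h.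
  + move=> i x lt xL'; rewrite /pglue; case: leqP => hi; last by apply: fna => //; lia.
    have [xL nz _] := L'L x xL'; move: hi; rewrite leq_eqVlt => /orP[/eqP->|lt'] //.
    exact: na.
  + by exists w => //; rewrite /pglue; case: leqP => ?; [lia | rewrite addKn].
- lia.
- by move=> i le; rewrite /pglue le.
- move=> i /andP[h1 h2]; rewrite /pglue leqNgt h1 /=; apply: fL; lia.
split=> //; apply/subsetP=> v /L'L[vL _ vR]; by rewrite inE vR.
Qed.

(** [W] leads from [z] to [c 0], and [L'] is attached to the odd hole at one other vertex, [c ie];
    the two arcs between these vertices have different parities. The part [C], which is hard to
    colour, sees no vertex of the hole. *)
Definition raw_link z L N W w c n ie L' C :=
  [/\ [/\ ipath W w, W 0 = z, forall i, 0 < i <= w -> W i \in L, hole c n & c 0 = W w],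
      [/\ 1 < ie < n.-1, forall i, 0 < i < n -> c i \in L &
          forall i j, i < w -> 0 < j < n -> W i <> c j /\ ~~ e (W i) (c j)],
      [/\ conn L', L' \subset L, exists2 x, x \in L' & e (c ie) x,
          forall x i, x \in L' -> i <= w -> W i <> x /\ ~~ e (W i) x &
          forall x i, x \in L' -> i < n -> c i <> x /\ (i <> ie -> ~~ e (c i) x)] &
      [/\ C \subset L', conn C, ~ col C N & forall x i, x \in C -> i < n -> ~~ e (c i) x]].

(** An edge [u v] inside a level closes to an odd hole through ancestors. The four extra colours pay
    for deleting the neighbours of [q], [v], [u] and [q'], after which the rest [K3] of the level
    sees neither line of ancestors. It is joined to the hole by a path [h] in the level and, if the
    hole begins further up, by a piece of the line of [u]. *)
Lemma raw_link_exists z L N : conn L -> z \notin L -> (exists2 x, x \in L & e z x) ->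
  ~ col L (2 * (N + 4)) -> exists W w c n ie L' C, raw_link z L N W w c n ie L' C.
Proof.
move=> cL zL [x0 x0L ex0] nL.
have cS : conn (z |: L) by apply: connU (conn1 (x:=z)) cL _ x0L ex0; rewrite inE.
set S := z |: L in cS.
have zS : z \in S by rewrite !inE eqxx.
have nS : ~ col S (2 * (N + 4)) by apply: ncolS nL => //; apply: subsetUr.
have [||d [par0 [d0 dp0 dl]]] := @bfs S [set z] cS; [by rewrite sub1set|by exists z; rewrite inE|].
have dz : d z = 0 by apply/(d0 z zS); rewrite inE.
have [j j2 nj] := deep_level (ltn_addl N (isT : 0 < 4)) d0 dp0 dl nS.
have [K [sK cK nK clK]] := component nj.
have KP v : v \in K -> v \in S /\ d v = j by move/(subsetP sK); rewrite inE => /andP[? /eqP].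
have [xk xkK] := ncol_ex nK.
have [xkS dxk] := KP _ xkK.
have [|qS exq dq] := dp0 xk xkS; first by lia.
set q := par0 xk in qS exq dq.
have nK1 : ~ col (K :\: nb q) (N + 3).
  by apply: ncolD (nb_col q); rewrite -addnA.
have [K1 [sK1 cK1 nK1' clK1]] := component nK1.
have K1P x : x \in K1 -> x \in K /\ ~~ e q x.
  by move/(subsetP sK1); rewrite !inE => /andP[].
have [y1 y1K1] := ncol_ex nK1'.
have [||u' [v [u'K vK u'K1 vK1 eu'v]]] := @conn_edge K K1 cK.
- by exists y1 => //; case: (K1P _ y1K1).
- exists xk => //; apply/negP=> /K1P[_]; rewrite eC exq //.
(* [K1] is a component after deletion of the neighbours of [q]; a neighbour of [K1] in [K] outside
   it must have been deleted. *)
have eqv : e q v.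
  apply/idPn=> nq; case/negP: vK1; apply: clK1 eu'v => //.
  by rewrite !inE nq.
have [vS dv] := KP _ vK.
have nK2 : ~ col (K1 :\: nb v) (N + 2).
  by apply: ncolD (nb_col v); rewrite -addnA.
have [K2 [sK2 cK2 nK2' clK2]] := component nK2.
have K2P x : x \in K2 -> x \in K1 /\ ~~ e v x.
  by move/(subsetP sK2); rewrite !inE => /andP[].
have [y2 y2K2] := ncol_ex nK2'.
have [||x [u [xK1 uK1 xK2 uK2 exu]]] := @conn_edge K1 K2 cK1.
- by exists y2 => //; case: (K2P _ y2K2).
- exists u' => //; apply/negP=> /K2P[_]; rewrite eC eu'v //.
have evu : e v u.
  apply/idPn=> nq; case/negP: uK2; apply: clK2 exu => //.
  by rewrite !inE nq.
have [uK nqu] := K1P _ uK1; have [uS du] := KP _ uK.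
have uv : u <> v by move=> E; rewrite E eI in evu.
(* Any neighbour in the previous level may serve as parent. The choice of [q] for [v] controls the
   line of [v], because [K1] avoids the neighbours of [q]. *)
pose par w := if w == v then q else par0 w.
have dp w : w \in S -> 0 < d w -> [/\ par w \in S, e w (par w) & d w = (d (par w)).+1].
  rewrite /par; case: eqP => [->|_]; last exact: dp0.
  by rewrite eC eqv dv -dq dxk qS.
have [|q'S euq' dq'] := dp u uS; first lia.
set q' := par u in q'S euq' dq'.
have A1 : anc par v 1 = q by rewrite /= /par eqxx.
have nK3 : ~ col (K2 :\: (nb u :|: nb q')) N.
  by apply: (@ncolD _ _ _ 2) => //; apply: (colU (nb_col u) (nb_col q')).
have [K3 [sK3 cK3 nK3' clK3]] := component nK3.
have K3P y : y \in K3 -> [/\ y \in K2, ~~ e u y & ~~ e q' y].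
  by move/(subsetP sK3); rewrite !inE negb_or => /andP[/andP[? ?] ?].
have [y3 y3K3] := ncol_ex nK3'.
pose T := [set t in K2 | e u t || e q' t].
have [||||h [k [gd h0 hT _ Tp]]] := @shortest_path K2 K3 T cK2.
- by apply/subsetP=> y /K3P[].
- by apply/subsetP=> y; rewrite inE => /andP[].
- by exists y3.
- by exists x; rewrite inE xK2 eC exu.
have Hh := geod_ipath gd; have [hK2 _] := gd.
have hnT i : i < k -> h i \notin T.
  move=> lt; apply/negP=> hi; have [_ /(_ erefl)] := Tp i (h i) (ltnW lt) hi (or_introl erefl); lia.
(* The index on the line of [u] of the vertex that sees the end of [h]. It is unique: [u] and [q']
   are adjacent and there is no triangle. *)
pose cc := if e u (h k) then 0 else 1.
have ecc : e (anc par u cc) (h k).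
  rewrite /cc; case: ifP => [//|nu]; move: hT; rewrite inE nu => /andP[_ /= ].
  by [].
pose X0 := pset h k :|: K3.
have X0K2 y : y \in X0 -> y \in K2.
  by rewrite inE => /orP[/psetP[i le <-]|/K3P[]//]; apply: hK2.
have X0P y : y \in X0 -> [/\ y \in S, d y = j, y <> u /\ y <> v, ~~ e v y & ~~ e q y].
  move=> /X0K2 yK2; have [yK1 nv] := K2P y yK2; have [yK nq] := K1P y yK1.
  have [yS dy] := KP y yK; split=> //; split.
  - by move=> E; rewrite -E yK2 in uK2.
  - by move=> E; rewrite -E yK1 in vK1.
have X0u y i : y \in X0 -> i <= j -> e (anc par u i) y -> i = cc.
  move=> yX le ey; have [yS dy _ _ _] := X0P y yX.
  have [|aS da] := @ancS S d par dp u i uS; first by rewrite du.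
  have := lev_e dl aS yS ey; rewrite da dy du => hi.
  have ey' : e u y || e q' y.
    by move: ey; case: i le aS da hi => [|[|i]] //=; [move=> _ _ _ _ ->|move=> _ _ _ _ ->; rewrite orbT|lia].
  have yT : y \in T by rewrite inE X0K2.
  have yh : y = h k.
    move: yX; rewrite inE => /orP[/psetP[i' le' E]|/K3P[_ h1 h2]]; last first.
      by rewrite (negbTE h1) (negbTE h2) in ey'.
    move: le'; rewrite leq_eqVlt => /orP[/eqP <-//|/hnT]; by rewrite E yT.
  have nb : ~~ (e u (h k) && e q' (h k)).
    apply/negP=> /andP[h1 h2]; have := no_triangle euq' h2; by rewrite h1.
  move: ey; rewrite yh /cc; case: i le aS da hi => [|[|i]] le aS da hi ey.
  - by move: ey; rewrite /= => ->.
  - by move: ey nb; rewrite /= -/q' => ->; rewrite andbT => /negbTE->.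
  - lia.
have X0v y i : y \in X0 -> i <= j -> ~~ e (anc par v i) y.
  move=> yX le; have [yS dy _ nv nq] := X0P y yX; apply/negP=> ey.
  have [|aS da] := @ancS S d par dp v i vS; first by rewrite dv.
  have := lev_e dl aS yS ey; rewrite da dy dv => hi.
  case: i le ey aS da hi => [|[|i]] le ey aS da hi; last lia.
    by move: ey; rewrite /= (negbTE nv).
  by move: ey; rewrite A1 (negbTE nq).
have X0ne y s i : y \in X0 -> s = u \/ s = v -> i <= j -> anc par s i <> y.
  move=> yX hs le E; have [yS dy [n1 n2] _ _] := X0P y yX.
  have [sS ds] : s \in S /\ d s = j by case: hs => ->.
  have [|aS da] := @ancS S d par dp s i sS; first by rewrite ds.
  move: da; rewrite E dy ds => da; have i0 : i = 0 by lia.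
  move: E; rewrite i0 /=; case: hs => -> E; [exact: n1|exact: n2].
have [a [b [ns [n' [ab lt [e1 e2] ne key]]]]] := odd_hole_layer d0 dp dl uS vS (etrans (eC _ _) evu) (etrans du (esym dv)).
have [aS bS da db] : [/\ a \in S, b \in S, d a = j & d b = j].
  by case: ab => [[-> ->]|[-> ->]].
move: lt; rewrite du => lt.
(* The exit must differ from the top vertex of the hole. Otherwise [n' = 1] and [ns = 0], which
   leaves a triangle or the excluded edge from [q] to [u]. *)
have xlt : maxn ns cc < n'.
  have : cc <= 1 by rewrite /cc; case: ifP.
  case: (ltnP cc n') => hc; first lia.
  move=> cc1; have [E1 E2] : n' = 1 /\ ns = 0 by lia.
  move: e2; rewrite E1 /=; case: ab => [[-> ->]|[-> ->]].
    by rewrite -/q' => h1; have := no_triangle evu euq'; rewrite h1.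
  by rewrite /par eqxx eC (negbTE nqu).
(* The piece of the line of [u] between the end of [h] and a hole that begins only at a later
   index. *)
pose E := if cc < ns then pset (fun i => anc par u (cc + i)) (ns - cc).-1 else set0.
have EP y : y \in E -> exists i, cc <= i < ns /\ y = anc par u i.
  rewrite /E; case: ltnP => hcc; last by rewrite inE.
  by move=> /psetP[i le <-]; exists (cc + i); split=> //; lia.
have ancSu i : i <= j -> anc par u i \in S /\ d (anc par u i) = j - i.
  by move=> le; have := @ancS S d par dp u i uS; rewrite du; apply.
have ancSv i : i <= j -> anc par v i \in S /\ d (anc par v i) = j - i.
  by move=> le; have := @ancS S d par dp v i vS; rewrite dv; apply.
have euvns : e (anc par u ns) (anc par v ns).
  by case: ab e1 => [[-> ->]|[-> ->]] //; rewrite eC.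
have cX0 : conn X0 by apply: (conn_overlap (conn_ipath Hh) cK3 _ h0); apply/psetP; exists 0.
pose L' := X0 :|: E.
have hkX : h k \in X0 by rewrite inE mem_pset.
have cL' : conn L'.
  rewrite /L' /E; case: ltnP => hcc; last by rewrite setU0.
  apply: (@connU _ _ (h k) (anc par u cc)) => //; last by rewrite eC.
  - apply: conn_pset => i lti; rewrite addnS; apply: (anc_e dp) => //; lia.
  - by apply/psetP; exists 0; rewrite ?addn0.
have sepu y i : y \in L' -> ns <= i <= j -> anc par u i <> y /\ (e (anc par u i) y -> i = maxn ns cc).
  rewrite inE => /orP[yX|/EP[i' [hi' ->]]] hi.
    have le : i <= j by lia.
    split; first by apply: X0ne yX (or_introl erefl) le.
    by move/(X0u y i yX le); lia.
  have [|S1 D1] := ancSu i; first lia.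
  have [|S2 D2] := ancSu i'; first lia.
  split; first by move/(congr1 d); rewrite D1 D2; lia.
  by move/(lev_e dl S1 S2); rewrite D1 D2; lia.
have sepv y i : y \in L' -> ns <= i <= j -> anc par v i <> y /\ ~~ e (anc par v i) y.
  rewrite inE => /orP[yX|/EP[i' [hi' ->]]] hi.
    have le : i <= j by lia.
    split; first by apply: X0ne yX (or_intror erefl) le.
    exact: X0v.
  have [|S1 D1] := ancSv i; first lia.
  have [|S2 D2] := ancSu i'; first lia.
  split; first by move/(congr1 d); rewrite D1 D2; lia.
  apply/negP=> h'; have := lev_e dl S1 S2 h'; rewrite D1 D2 => le.
  have Ei : i = ns by lia.
  have Ei' : ns = i'.+1 by lia.
  have e3 : e (anc par u i') (anc par u ns) by rewrite Ei'; apply: (anc_e dp) => //; lia.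
  by have := no_triangle e3 euvns; rewrite eC -Ei h'.
pose n := (2 * (n' - ns)).+1.
pose c := layer_hole par a b ns n'.
have Hc : hole c n by apply: (layer_holeP dp dl) => //; rewrite ?da ?db //; case/andP: lt => ->.
have cP i : i < n -> exists s i', [/\ (s = u) \/ (s = v), c i = anc par s i', ns <= i' <= n', 0 < i -> i' < n' &
   (s = u /\ i' = maxn ns cc -> i = if a == u then n' - maxn ns cc else maxn ns cc - ns + (n' - ns).+1)].
  move=> lti; rewrite /c /layer_hole; case: (leqP i (n' - ns)) => hi.
    exists a, (n' - i); split=> //; try lia; first by case: ab => [[-> _]|[-> _]]; [left|right].
    by move=> [-> Ex]; rewrite eqxx /=; lia.
  rewrite /n in lti; exists b, (i + ns - (n' - ns).+1); split=> //; try lia; first by case: ab => [[_ ->]|[_ ->]]; [right|left].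
  move=> [Eb Ex]; have -> : (a == u) = false.
    by apply/eqP=> Ea; case: ab => [[_]|[Ea' _]]; [rewrite Eb => /uv|rewrite Ea in Ea'; move: (uv Ea')].
  by lia.
pose ie := if a == u then n' - maxn ns cc else maxn ns cc - ns + (n' - ns).+1.
have cie : c ie = anc par u (maxn ns cc).
  rewrite /c /layer_hole /ie; case: ab => [[-> _]|[-> ->]].
    rewrite eqxx; case: (leqP (n' - maxn ns cc)) => h'; last lia.
    by congr anc; lia.
  have -> : (v == u) = false by apply/eqP=> /esym.
  case: (leqP (_ - ns + _)) => h'; first lia.
  by congr anc; lia.
exists (fun i => anc par a (j - i)), (j - n'), c, n, ie, L', K3.
have jn i : i <= j - n' -> j - (j - i) = i by lia.
have ancSa i : i <= j -> anc par a i \in S /\ d (anc par a i) = j - i.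
  by case: ab => [[-> _]|[-> _]]; [apply: ancSu|apply: ancSv].
have inL y : y \in S -> 0 < d y -> y \in L.
  by rewrite !inE => /orP[/eqP->|//]; rewrite dz.
split; split.
- move=> i1 i2 l1 l2.
  have [|S1 D1] := ancSa (j - i1); first lia.
  have [|S2 D2] := ancSa (j - i2); first lia.
  split; first by move/(congr1 d); rewrite D1 D2; lia.
  apply/idP/idP=> [/(lev_e dl S1 S2)|/eqP E']; first by rewrite D1 D2; lia.
  rewrite eC; have -> : j - i1 = (j - i2).+1 by lia.
  by apply: (anc_e dp) => //; rewrite da; lia.
- by rewrite subn0 -{1}da (anc_z d0 dp).
- move=> i hi; have [|S1 D1] := ancSa (j - i); first lia.
  by apply: inL S1 _; rewrite D1; lia.
- exact: Hc.
- by rewrite /c /layer_hole /= subn0; congr anc; lia.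
- have := hole_ge7 Hc; have : cc <= 1 by rewrite /cc; case: ifP.
  by rewrite /ie /n; case: ifP; lia.
- move=> i /andP[i0 lti]; have [s [i' [hs -> hi' hi'' _]]] := cP i lti.
  have [sS ds] : s \in S /\ d s = j by case: hs => ->.
  have [|S1 D1] := @ancS S d par dp s i' sS; first by rewrite ds; lia.
  by apply: inL S1 _; rewrite D1 ds; have := hi'' i0; lia.
- move=> i i1 hi /andP[h1 h2]; have [s [i' [hs -> hi' hi'' _]]] := cP i1 h2.
  have [sS ds] : s \in S /\ d s = j by case: hs => ->.
  have [|S1 D1] := @ancS S d par dp s i' sS; first by rewrite ds; lia.
  have [|S2 D2] := ancSa (j - i); first lia.
  have l3 := hi'' h1.
  split; first by move/(congr1 d); rewrite D1 D2 ds; lia.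
  by apply/negP=> /(lev_e dl S2 S1); rewrite D1 D2 ds; lia.
- exact: cL'.
- apply/subsetP=> y; rewrite inE => /orP[/X0P[yS dy _ _ _]|/EP[i [hi ->]]]; first by apply: inL yS _; lia.
  by have [|S1 D1] := ancSu i; [lia|apply: inL S1 _; lia].
- rewrite cie; case: (ltnP cc ns) => hcc.
    exists (anc par u ns.-1); last first.
      have E' : ns = ns.-1.+1 by lia.
      by rewrite eC {2}E'; apply: (anc_e dp) => //; lia.
    rewrite inE /E hcc; apply/orP; right; apply/psetP; exists (ns - cc).-1 => //.
    by congr anc; lia.
  by exists (h k); first by rewrite inE hkX.
- move=> y i yL' hi; case: ab => [[Ea _]|[Ea _]]; rewrite Ea.
    have [|ne' ad] := sepu y (j - i) yL'; first lia.
    by split=> //; apply/negP=> /ad; lia.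
  by apply: sepv yL' _; lia.
- move=> y i yL' hi; have [s [i' [hs Ec hi' hi'' back]]] := cP i hi; rewrite Ec.
  case: hs => Es; rewrite Es in back *.
    have [|ne' ad] := sepu y i' yL'; first lia.
    by split=> // nie; apply/negP=> /ad E'; apply: nie; apply: back.
  by have [|ne' ad] := sepv y i' yL'; first lia.
- by apply/subsetP=> y yK3; rewrite !inE yK3 orbT.
- exact: cK3.
- exact: nK3'.
- move=> y i yK hi; have [s [i' [hs -> hi' hi'' _]]] := cP i hi.
  have yX : y \in X0 by rewrite inE yK orbT.
  have le : i' <= j by lia.
  case: hs => ->; last exact: X0v.
  apply/negP=> h'; have Ei := X0u y i' yX le h'; move: h'; rewrite Ei /cc.
  by have [_ n1 n2] := K3P y yK; case: ifP => _ /=; rewrite ?(negbTE n1) -/q' ?(negbTE n2).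
Qed.

(* The chain P extends through L in two ways, F true and F false, which agree up to the index
   w and then follow the two arcs of the odd hole c; L' is where to continue, and C is a part
   of L' that is still hard to colour. *)
Record link P p L N w (F : bool -> nat -> G) (len : bool -> nat) c n L' C : Prop := Link {
  lk_w : p <= w;
  lk_len : forall b, w < len b;
  lk_pre : forall b i, i <= p -> F b i = P i;
  lk_in : forall b i, p < i <= len b -> F b i \in L;
  lk_common : forall b i, i <= w -> F b i = F true i;
  lk_par : odd (len true) != odd (len false);
  lk_hole : hole c n;
  lk_c : forall i, i < n -> c i \in L \/ c i = P p;
  lk_arc : forall b i, w <= i <= len b -> exists2 j, j < n & F b i = c j;
  lk_end : forall b, F b (len b) = F true (len true);
  lk_chain : forall b, chain (F b) (len b) L';
  lk_sub : L' \subset L;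
  lk_C : C \subset L';
  lk_conn : conn C;
  lk_ncol : ~ col C N;
  lk_sepC : forall x b i, x \in C -> i <= len b -> ~~ e (F b i) x;
  lk_cC : forall x i, x \in C -> i < n -> c i <> x /\ ~~ e (c i) x;
  lk_cL : forall x i, x \in L' -> i < n ->
    c i <> x /\ (c i <> F true (len true) -> ~~ e (c i) x) }.

Lemma link_exists P p L N : chain P p L -> ~ col L (2 * (N + 4)) ->
  exists w F len c n L' C, link P p L N w F len c n L' C.
Proof.
move=> ch nL; have [HP cL PL na exz] := ch.
have [W [w [c [n [ie [L' [C [[HW W0 WL Hc c0] [hie cin Wc] [cL' sL' [xe xeL' exe] WL' cL'n] [sC cC nC cCn]]]]]]]]] :=
  raw_link_exists cL (PL p (leqnn p)) exz nL.
have n7 := hole_ge7 Hc; have on : odd n by case: Hc.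
pose q := p + w; pose V := pglue P p W.
(* [F true] follows the hole from [c 0] with increasing indices, [F false] with decreasing ones
   through [c n.-1]. As [n] is odd, the arc lengths [ie] and [n - ie] have different parities. *)
pose F b i := if i <= q then V i else c (if b then i - q else n - (i - q)).
pose len b := q + (if b then ie else n - ie).
have HV : ipath V q by exact: chain_glue ch HW W0 WL.
have Vq : V q = c 0.
  rewrite /V /pglue /q c0; case: leqP => h; last by rewrite addKn.
  have w0 : w = 0 by lia.
  by rewrite w0 addn0 W0.
have FV b i : i <= q -> F b i = V i by rewrite /F => ->.
have Vpre i : i <= p -> V i = P i by rewrite /V /pglue => ->.
have Vin i : p < i <= q -> V i \in L.
  by move=> hi; rewrite /V /pglue leqNgt; case/andP: (hi) => -> _ /=; apply: WL; rewrite /q in hi; lia.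
have Farc b i : q <= i <= len b -> exists2 j, j < n & F b i = c j /\
   (i = q /\ j = 0) \/ (q < i /\ F b i = c j /\ j = (if b then i - q else n - (i - q)) /\ 0 < j).
  rewrite /len => hi; case: (ltnP q i) => h; last first.
    have Ei : i = q by lia.
    by exists 0; [lia|left; rewrite Ei FV].
  exists (if b then i - q else n - (i - q)); first by case: b hi; lia.
  by right; rewrite /F leqNgt h /=; split=> //; split=> //; split=> //; case: b hi; lia.
have Vc i j : i < q -> 0 < j < n -> V i <> c j /\ ~~ e (V i) (c j).
  move=> hi hj; rewrite /V /pglue; case: leqP => h; last by apply: Wc => //; rewrite /q in hi; lia.
  have cj := cin j hj; case: (ltnP i p) => hip.
    split; last exact: na.
    by move=> E; have := PL i h; rewrite E cj.
  have -> : i = p by lia.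
  rewrite -W0; apply: Wc => //; rewrite /q in hi; lia.
have Fend b : F b (len b) = c ie.
  rewrite /F /len leqNgt; case: b.
    by rewrite (_ : q < q + ie) /=; [congr c|]; lia.
  by rewrite (_ : q < q + (n - ie)) /=; [congr c|]; lia.
exists q, F, len, c, n, L', C; split.
- by rewrite /q leq_addr.
- by move=> b; rewrite /len; case: b; lia.
- by move=> b i le; rewrite FV ?Vpre // /q; lia.
- move=> b i hi; case: (leqP i q) => h; first by rewrite FV // Vin //; lia.
  have [|j jn [[_ [E _]]|[_ [-> [_ j0]]]]] := Farc b i; try lia.
  by apply: cin; rewrite j0.
- by move=> b i le; rewrite !FV.
- by rewrite /len; lia.
- exact: Hc.
- move=> i lti; case: i lti => [_|i lti]; last by left; apply: cin.
  case: (posnP w) => w0; first by right; rewrite c0 w0 W0.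
  by left; rewrite c0; apply: WL; lia.
- by move=> b i /Farc[j jn [[E _]|[_ [E _]]]]; exists j.
- by move=> b; rewrite !Fend.
- move=> b; split=> //.
  + move=> i j ltij lej; case: (leqP j q) => hj.
      by rewrite !FV //; [apply: HV|lia].
    have [|j' jn [[_ [E _]]|[_ [Ej [Ej' j0]]]]] := Farc b j; try lia.
    case: (ltnP i q) => hi.
      rewrite FV ?(ltnW hi) // Ej; have [|ne na'] := Vc i j' hi; first by rewrite j0.
      by split=> //; rewrite (negbTE na'); lia.
    have [|i' in' Hi] := Farc b i; first lia.
    have Ei : F b i = c i' by case: Hi => [[]|[_ []]].
    have Ei' : i' = 0 /\ i = q \/ q < i /\ i' = (if b then i - q else n - (i - q)).
      by case: Hi => [[_ [-> ->]]|[? [_ [? _]]]]; [left|right].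
    rewrite Ei Ej; split.
      move/(hole_inj Hc in' jn); move: Ei' Ej' lej; rewrite /len; case: b {Ei Ej Hi}; lia.
    rewrite (hole_e Hc in' jn); move: Ei' Ej' lej; rewrite /len; case: b {Ei Ej Hi}; lia.
  + move=> i le; apply/negP=> h; case: (leqP i q) => hi.
      move: h; rewrite FV // /V /pglue; case: leqP => hp h.
        by have := PL i hp; rewrite (subsetP sL' _ h).
      by have [|] := WL' _ (i - p) h; first by rewrite /q in hi; lia.
    have [|j jn [[_ [E _]]|[_ [E _]]]] := Farc b i; try lia.
    by rewrite E in h; have [] := cL'n _ j h jn.
  + move=> i x lt xL'; case: (leqP i q) => hi.
      rewrite FV // /V /pglue; case: leqP => hp; last first.
        by have [|] := WL' x (i - p) xL'; first by rewrite /q in hi; lia.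
      case: (ltnP i p) => hip; first by apply: na; rewrite // (subsetP sL').
      have -> : i = p by lia.
      by rewrite -W0; have [|] := WL' x 0 xL'.
    have [|j jn [[_ [E _]]|[_ [E [Ej _]]]]] := Farc b i; try lia.
    rewrite E; have [_] := cL'n _ j xL' jn; apply.
    by move: Ej lt; rewrite /len; case: b {E}; lia.
  + by exists xe; rewrite // Fend.
- exact: sL'.
- exact: sC.
- exact: cC.
- exact: nC.
- move=> x b i xC le; have xL' := subsetP sC _ xC; case: (leqP i q) => hi.
    rewrite FV // /V /pglue; case: leqP => hp; last first.
      by have [|] := WL' x (i - p) xL'; first by rewrite /q in hi; lia.
    case: (ltnP i p) => hip; first by apply: na; rewrite // (subsetP sL').
    have -> : i = p by lia.
    by rewrite -W0; have [|] := WL' x 0 xL'.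
  have [|j jn [[_ [E _]]|[_ [E [Ej _]]]]] := Farc b i; try lia.
  by rewrite E; apply: cCn.
- move=> x i xC lt; split; last exact: cCn.
  by have [] := cL'n _ i (subsetP sC _ xC) lt.
- move=> x i xL' lt; have [ne na'] := cL'n _ i xL' lt; split=> //.
  by rewrite Fend => nE; apply: na' => E; apply: nE; rewrite E.
Qed.

(** * Legs on an odd hole *)

Lemma ncol_drop K (P : G -> Prop) k m : ~ col K (k + m) -> col (sel K P) m ->
  ~ col (sel K (fun t => ~ P t)) k.
Proof.
move=> nK cP cN; apply: nK; apply: colS (colU cN cP) => //.
apply/subsetP=> t tK; rewrite inE; apply/orP; case: (classic (P t)) => h.
  by right; apply/selP.
by left; apply/selP.
Qed.

Lemma col_cases K (P Q : G -> Prop) k m : (forall t, t \in K -> P t \/ Q t) ->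
  col (sel K P) k -> col (sel K Q) m -> col K (k + m).
Proof.
move=> H cP cN; apply: colS (colU cP cN) => //.
apply/subsetP=> t tK; rewrite inE; apply/orP.
by case: (H t tK) => h; [left|right]; apply/selP.
Qed.

Definition apart c n K := forall t i, t \in K -> i < n -> c i <> t /\ ~~ e (c i) t.
Definition mono c n (a : G) := exists b, forall i, i < n -> e a (c i) -> odd i = b.
(* a t is the leg of t; legs touching the hole in a single parity class are split off
   separately. *)
Definition legged c n K (a : G -> G) :=
  forall t, t \in K -> e (a t) t /\ ~ mono c n (a t).

Lemma apartS c n K L : L \subset K -> apart c n K -> apart c n L.
Proof. by move=> /subsetP s H t i /s; apply: H. Qed.
Lemma leggedS c n K L a : L \subset K -> legged c n K a -> legged c n L a.
Proof. by move=> /subsetP s H t /s; apply: H. Qed.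

Lemma leg_off c n K (a t : G) : apart c n K -> t \in K -> e a t -> forall i, i < n -> c i <> a.
Proof. by move=> ap tK eat i lti E; have [_] := ap t i tK lti; rewrite E eat. Qed.

Lemma nmono_touch c n a b : ~ mono c n a -> exists i, [/\ i < n, e a (c i) & odd i = b].
Proof.
move=> nm; apply: NNPP => H; apply: nm; exists (~~ b) => i lti ei.
by apply/eqP; apply: contraT => h; case: H; exists i; split=> //; move: h; case: b; case: odd.
Qed.

Lemma leg_notin c n K (a v : G) : apart c n K -> ~ mono c n a -> v \in K -> v <> a.
Proof.
move=> ap nm vK E; have [i [lti ei _]] := nmono_touch true nm.
by have [_] := ap v i vK lti; rewrite E eC ei.
Qed.

(** Without [c n.-1] the hole is an induced path, touched in one parity class: 4 colours for each
    parity. The legs touching [c n.-1] account for another 4. *)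
Lemma mono_col c n K (a : G -> G) : hole c n -> apart c n K ->
  (forall t, t \in K -> e (a t) t /\ exists2 i, i < n & e (a t) (c i)) ->
  (forall t, t \in K -> mono c n (a t)) -> col K 12.
Proof.
move=> H ap lg mo; have n7 := hole_ge7 H.
pose Q t := e (a t) (c n.-1).
apply: (@col_cases _ (fun t => ~ Q t) Q 8 4); first by move=> t _; rewrite /Q; case: e; [right|left].
  have half b : col (sel K (fun t => ~ Q t /\ forall i, i < n -> e (a t) (c i) -> odd i = b)) 4.
    apply: (@path_leg_col c (n - 2) _ b); first by apply: (hole_ipath H); lia.
      by move=> t i /selP[tK _] le; apply: ap => //; lia.
    move=> t /selP[tK [nQ mt]]; have [et [i lti ei]] := lg t tK; exists (a t); split=> //.
      exists i; split; last by rewrite eC.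
      suff : i != n.-1 by lia.
      by apply/eqP=> E; rewrite E in ei.
    by move=> i' le; rewrite eC; apply: mt; lia.
  pose P b t := forall i, i < n -> e (a t) (c i) -> odd i = b.
  apply: (@col_cases _ (P true) (P false) 4 4) => [t /selP[tK nQ]||].
  - by have [[] h] := mo t tK; [left|right].
  - by apply: colS (half true) => //; apply/subsetP=> t /selP[/selP[tK nQ] h]; apply/selP.
  - by apply: colS (half false) => //; apply/subsetP=> t /selP[/selP[tK nQ] h]; apply/selP.
apply: (@vertex_leg_col (c n.-1)); first by move=> t /selP[tK _]; apply: ap => //; lia.
by move=> t /selP[tK q]; exists (a t); rewrite [e (c _) _]eC; have [-> _] := lg t tK.
Qed.

Lemma lin_exists c n (a : G) : hole c n -> (forall i, i < n -> c i <> a) ->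
  exists k b, lin c n k b a.
Proof.
move=> H na; have [|i lt|//|k [b kb]] := @adj_wheel G c n [set a] (fun=> false) H (conn1 (x:=a)).
- by move=> x y /set1P-> /set1P->; rewrite eI.
- by apply/set1P; apply: na.
by exists k, b => i lt ei; apply: kb ei; rewrite ?inE.
Qed.

(** The negation of the conclusion of [even_link]: pairwise independent legs are collected until two
    of them can be linked evenly. *)
Definition indep c n (a a' : G) := ~ exists k b, lin c n k b a /\ lin c n k b a'.

Lemma indepC c n a a' : indep c n a a' -> indep c n a' a.
Proof. by move=> H [k [b [h1 h2]]]; apply: H; exists k, b. Qed.

Lemma lin_lt c n k b a : ~ mono c n a -> lin c n k b a -> 0 < k < n.
Proof.
move=> nm l; have [i [lti ei oi]] := nmono_touch b nm.
have [j [ltj ej oj]] := nmono_touch (~~ b) nm.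
have := l i lti ei; have := l j ltj ej; rewrite oi oj; case: b {l oi oj}; lia.
Qed.

(** Start the hole at the common change [k]. The step from [n.-1] to 0 shifts parities because [n]
    is odd, which cancels the change; so the path omitting [c k.-1] is touched in a single parity
    class. *)
Lemma lin_col c n K (a : G -> G) k b : hole c n -> apart c n K -> legged c n K a ->
  (forall t, t \in K -> lin c n k b (a t)) -> col K 4.
Proof.
move=> H ap lg lk; have n7 := hole_ge7 H; have on : odd n by case: H.
case: (set_0Vmem K) => [->|[t0 t0K]]; first by exists (fun=> 0); split=> v; rewrite inE.
have kn : 0 < k < n by have [_ nm] := lg _ t0K; apply: lin_lt nm (lk _ t0K).
apply: (@path_leg_col (fun i => c ((i + k) %% n)) (n - 2) K (~~ b (+) odd k)).
- by apply: (hole_ipath (hole_rot k H)); lia.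
- by move=> t i tK _; apply: ap => //; rewrite ltn_pmod //; lia.
- move=> t tK; have [et nm] := lg t tK; have l := lk t tK; exists (a t); split=> //.
    have [j [ltj ej oj]] := nmono_touch (~~ b) nm.
    have := l j ltj ej; rewrite oj => hk0.
    have hk : k <= j by clear -hk0; case: b hk0; lia.
    exists (j - k); split; first lia.
    rewrite subnK; last lia.
    by rewrite modn_small // eC.
  move=> i le; rewrite eC; set j := (i + k) %% n => ej.
  have ltj : j < n by rewrite ltn_pmod //; lia.
  have oj := l j ltj ej.
  have : j = if i + k < n then i + k else i + k - n.
    rewrite /j; case: ltnP => h; first by rewrite modn_small.
    have {1}-> : i + k = n + (i + k - n) by lia.
    by rewrite modnDl modn_small //; lia.
  by case: ltnP => h Ej; move: oj; rewrite Ej; clear -h on kn le; case: b; lia.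
Qed.

(* The chosen leg has its parity change as early as possible; then the legs which together
   with it have at most one parity change share this change. *)
Lemma pick_leg c n K (a : G -> G) N : hole c n -> apart c n K -> legged c n K a ->
  ~ col K (N + 13) -> exists w K', [/\ w \in K, K' \subset K, ~ col K' N &
    forall t, t \in K' -> [/\ ~~ e (a w) (a t), ~~ e (a w) t & indep c n (a w) (a t)]].
Proof.
move=> H ap lg nK; have n7 := hole_ge7 H.
have [t0 t0K] := ncol_ex nK.
have exk t : t \in K -> exists k, (exists b, lin c n k b (a t)) /\
    forall m, k < m -> ~ (exists b, lin c n m b (a t)).
  move=> tK; have [et nm] := lg t tK; apply: (@max_nat _ n).
    by have [k [b l]] := lin_exists H (leg_off ap tK et); exists k, b.
  by move=> k [b l]; have := lin_lt nm l; lia.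
have [km kmP] := choose_fun 0 exk.
have [|k [[w [wK kw]] mk]] := @min_nat (fun k => exists w, w \in K /\ km w = k).
  by exists (km t0), t0.
have mk' t : t \in K -> k <= km t.
  by move=> tK; rewrite leqNgt; apply/negP=> /mk; apply; exists t.
have wn := leg_notin ap (lg w wK).2.
pose P1 t := e (a w) t.
pose P2 t := e (a w) (a t).
pose P3 t := exists k b, lin c n k b (a w) /\ lin c n k b (a t).
(* The 13 extra colours: 1 for the neighbours of [a w], 4 for vertices whose leg is adjacent to
   [a w], and 4 for each value of [b] in a change at [k]. *)
have n1 : ~ col (sel K (fun t => ~ P1 t)) (N + 12).
  apply: (@ncol_drop _ _ _ 1); first by rewrite -addnA.
  by apply: colS (nb_col (a w)) => //; apply/subsetP=> t /selP[_]; rewrite inE.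
set K1 := sel K _ in n1.
have n2 : ~ col (sel K1 (fun t => ~ P2 t)) (N + 8).
  apply: (@ncol_drop _ _ _ 4); first by rewrite -addnA.
  apply: (@vertex_leg_col (a w)) => t /selP[/selP[tK nP1] P2t].
    by split; [apply/nesym/wn|apply/negP].
  by exists (a t); split=> //; have [] := lg t tK.
set K2 := sel K1 _ in n2.
have K2K t : t \in K2 -> [/\ t \in K, ~ P1 t & ~ P2 t] by move=> /selP[/selP[? ?] ?].
have half b : col (sel K2 (fun t => lin c n k b (a t))) 4.
  apply: (@lin_col c n _ a k b H).
  - by move=> t i /selP[/K2K[tK _ _] _]; apply: ap.
  - by move=> t /selP[/K2K[tK _ _] _]; apply: lg.
  - by move=> t /selP[].
have n3 : ~ col (sel K2 (fun t => ~ P3 t)) N.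
  apply: (@ncol_drop _ _ _ 8) => //.
  apply: (@colS (sel K2 (fun t => lin c n k true (a t)) :|: sel K2 (fun t => lin c n k false (a t))) _ (4 + 4)); last 2 first.
  - by [].
  - by apply: colU.
  apply/subsetP=> t /selP[tK2 [k' [b' [lw lt]]]].
  have [tK _ _] := K2K t tK2; have [et nm] := lg t tK.
  have [[bt ltt] _] := kmP t tK; have [_ mw] := kmP w wK.
  have lek : k' <= k by rewrite leqNgt -kw; apply/negP=> /mw; apply; exists b'.
  have lekt := mk' t tK.
  (* A contact of parity [b'] shows that both descriptions of [a t] begin with the same parity.
     Hence there is no contact between [k'] and [km t], and the change may be placed at [k]. *)
  have L : lin c n k b' (a t).
    move=> i lti ei; have E1 := lt i lti ei; have E2 := ltt i lti ei.
    have [j [ltj ej oj]] := nmono_touch b' nm.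
    have E3 := lt j ltj ej; have E4 := ltt j ltj ej.
    move: E1 E2 E3 E4; rewrite oj; case: b' {lw lt oj}; case: bt {ltt}; lia.
  by rewrite inE; case: b' {lw lt} L => L; apply/orP; [left|right]; apply/selP.
exists w, (sel K2 (fun t => ~ P3 t)); split=> //.
  by apply/subsetP=> t /selP[/K2K[]].
by move=> t /selP[/K2K[tK n4 n5] n6]; split=> //; apply/negP.
Qed.

Lemma pick_legs c n K (a : G -> G) r : hole c n -> apart c n K -> legged c n K a ->
  ~ col K (13 * r) -> exists A, [/\ A \subset K, #|A| = r &
    forall x y, x \in A -> y \in A -> x <> y -> ~~ e (a x) (a y) /\ indep c n (a x) (a y)].
Proof.
move=> H; elim: r K => [|r IH] K ap lg nK.
  by exists set0; rewrite sub0set cards0; split=> // x y; rewrite inE.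
have [|w [K' [wK sK nK' wP]]] := @pick_leg c n K a (13 * r) H ap lg; first by rewrite addnC -mulnS.
have [A [sA cA pA]] := IH K' (apartS sK ap) (leggedS sK lg) nK'.
have wA : w \notin A.
  apply/negP=> /(subsetP sA) h; have [_ h' _] := wP w h.
  by have [h'' _] := lg w wK; rewrite h'' in h'.
exists (w |: A); split.
- by rewrite subUset sub1set wK (subset_trans sA sK).
- by rewrite cardsU1 wA cA.
move=> x y /setU1P[->|xA] /setU1P[->|yA] // ne.
- by have [? _ ?] := wP y (subsetP sA _ yA).
- by have [? _ ?] := wP x (subsetP sA _ xA); rewrite eC; split=> //; apply: indepC.
- exact: pA.
Qed.

Lemma pigeon A (m r : nat) (cl : G -> nat) : (forall x, x \in A -> cl x < m) -> m * r < #|A| ->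
  exists k, r < #|[set x in A | cl x == k]|.
Proof.
move=> H lt; apply: NNPP => nE.
have : #|A| <= m * r; last by rewrite leqNgt lt.
have -> : #|A| = \sum_(k < m) #|[set x in A | cl x == k]|.
  rewrite -sum1_card (eq_bigr (fun x => \sum_(k < m | cl x == k) 1)); last first.
    by move=> x /H lt'; rewrite (big_pred1 (Ordinal lt')) // => i; rewrite eq_sym.
  rewrite (exchange_big_dep xpredT) //=; apply: eq_bigr => k _.
  by rewrite -sum1_card; apply: eq_bigl => x; rewrite inE.
rewrite -[X in X * r]card_ord -sum_nat_const; apply: leq_sum => k _.
by rewrite leqNgt; apply/negP=> h; apply: nE; exists (k : nat).
Qed.

(* Vertices of the same type touch some arc of the hole with a common parity. *)
Definition arc_type c n ty (a : G) : Prop :=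
  match ty with
  | 0 => is_true (e a (c n.-1))
  | 1 => (exists2 i, i.+1 < n & e a (c i)) /\ forall i, i.+1 < n -> e a (c i) -> odd i = true
  | 2 => (exists2 i, i.+1 < n & e a (c i)) /\ forall i, i.+1 < n -> e a (c i) -> odd i = false
  | 3 => ~ mono c n a /\ exists k, lin c n k true a
  | _ => ~ mono c n a /\ exists k, lin c n k false a
  end.

Lemma arc_type_ex c n a : hole c n -> (forall i, i < n -> c i <> a) ->
  (exists2 i, i < n & e a (c i)) -> exists2 ty, ty < 5 & arc_type c n ty a.
Proof.
move=> H na [i lti ei]; case: (classic (mono c n a)) => [[b m]|nm]; last first.
  by have [k [[] l]] := lin_exists H na; [exists 3|exists 4] => //; split=> //; exists k.
case: (i =P n.-1) => [E|nE]; first by exists 0; rewrite //= -E.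
have lt' : i.+1 < n by lia.
case: b m => m; [exists 1|exists 2] => //; split; try by exists i.
  by move=> j ltj; apply: m; lia.
by move=> j ltj; apply: m; lia.
Qed.

Definition linked_along c n (a a' : G) :=
  exists f m be, [/\ ipath f m, forall j, j <= m -> exists2 i, i < n & f j = c i,
    (exists2 j, j <= m & e a (f j)) /\ (forall j, j <= m -> e a (f j) -> odd j = be) &
    (exists2 j, j <= m & e a' (f j)) /\ (forall j, j <= m -> e a' (f j) -> odd j = be)].

(** For changes at [k1 < k2] use the arc from [k2] through [c n.-1] to [c k1.-1]: both legs change
    parity exactly at the step from [n.-1] to 0, where the odd length cancels the change. If the
    places agree, the arc before them serves. *)
Lemma arc_type_link c n ty a a' : hole c n -> arc_type c n ty a -> arc_type c n ty a' ->
  linked_along c n a a'.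
Proof.
move=> H; have n7 := hole_ge7 H; have on : odd n by case: H.
have const b : (exists2 i, i.+1 < n & e a (c i)) /\ (forall i, i.+1 < n -> e a (c i) -> odd i = b) ->
  (exists2 i, i.+1 < n & e a' (c i)) /\ (forall i, i.+1 < n -> e a' (c i) -> odd i = b) ->
  linked_along c n a a'.
  move=> [[i lti ei] h] [[i' lti' ei'] h']; exists c, (n - 2), b; split.
  - by apply: (hole_ipath H); lia.
  - by move=> j le; exists j => //; lia.
  - by split; [exists i => //; lia|move=> j le; apply: h; lia].
  - by split; [exists i' => //; lia|move=> j le; apply: h'; lia].
have chg b : (~ mono c n a /\ exists k, lin c n k b a) ->
  (~ mono c n a' /\ exists k, lin c n k b a') ->
  linked_along c n a a'.
  have main x y k1 k2 : ~ mono c n x -> ~ mono c n y -> lin c n k1 b x -> lin c n k2 b y -> k1 <= k2 ->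
    linked_along c n x y.
    move=> nx ny lx ly; have kx := lin_lt nx lx; have ky := lin_lt ny ly.
    have [i [lti ei oi]] := nmono_touch b nx; have := lx i lti ei; rewrite oi => hi.
    have {}hi : i < k1 by case: b {lx ly oi} hi; lia.
    rewrite leq_eqVlt => /orP[/eqP Ek|ltk].
      subst k2; have [i' [lti' ei' oi']] := nmono_touch b ny; have := ly i' lti' ei'; rewrite oi' => hi'.
      have {}hi' : i' < k1 by case: b {lx ly oi oi'} hi'; lia.
      exists c, k1.-1, b; split.
      - by apply: (hole_ipath H); lia.
      - by move=> j le; exists j => //; lia.
      - split; first by exists i => //; lia.
        by move=> j le ej; rewrite lx //; case: b {lx ly oi oi'}; lia.
      - split; first by exists i' => //; lia.
        by move=> j le ej; rewrite ly //; case: b {lx ly oi oi'}; lia.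
    have [i' [lti' ei' oi']] := nmono_touch (~~ b) ny; have := ly i' lti' ei'; rewrite oi' => hi'.
    have {}hi' : k2 <= i' by case: b {lx ly oi oi'} hi'; lia.
    exists (fun i => c ((i + k2) %% n)), (n - k2 + k1).-1, (~~ b (+) odd k2).
    have Em j : j <= (n - k2 + k1).-1 -> (j + k2) %% n = if j + k2 < n then j + k2 else j + k2 - n.
      move=> le; case: ltnP => h; first by rewrite modn_small.
      have {1}-> : j + k2 = n + (j + k2 - n) by lia.
      by rewrite modnDl modn_small //; lia.
    split.
    - by apply: (hole_ipath (hole_rot k2 H)); lia.
    - by move=> j _; exists ((j + k2) %% n) => //; rewrite ltn_pmod //; lia.
    - split.
        exists (i + n - k2); first lia.
        rewrite subnK; last lia.
        by rewrite modnDr modn_small.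
      move=> j le ej; have n0 : 0 < n by lia.
      have := lx _ (ltn_pmod _ n0) ej; rewrite Em //; clear -le kx ky ltk on; case: ltnP => h; case: b; lia.
    - split.
        exists (i' - k2); first lia.
        by rewrite subnK // modn_small.
      move=> j le ej; have n0 : 0 < n by lia.
      have := ly _ (ltn_pmod _ n0) ej; rewrite Em //; clear -le kx ky ltk on; case: ltnP => h; case: b; lia.
  move=> [na [k1 l1]] [na' [k2 l2]]; case: (leqP k1 k2) => le; first exact: main le.
  have [f [m [be [h1 h2 h3 h4]]]] := main a' a k2 k1 na' na l2 l1 (ltnW le).
  by exists f, m, be.
case: ty => [|[|[|[|ty]]]] /= h h'.
- exists (fun=> c n.-1), 0, false; split.
  + by move=> i j; lia.
  + by move=> j _; exists n.-1 => //; lia.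
  + by split; [exists 0|case].
  + by split; [exists 0|case].
- exact: const h h'.
- exact: const h h'.
- exact: chg h h'.
- exact: chg h h'.
Qed.

(** Of six pairwise independent legs, two have the same one of the five arc types on [c'] and are
    linked evenly along it; hence the bound 13 * 6. *)
Lemma two_holes_col c n c' n' K (a : G -> G) : hole c n -> hole c' n' ->
  (forall i j, i < n -> j < n' -> c i <> c' j /\ ~~ e (c i) (c' j)) ->
  apart c n K -> legged c n K a ->
  (forall t, t \in K -> (forall i, i < n' -> c' i <> a t) /\ exists2 i, i < n' & e (a t) (c' i)) ->
  col K 78.
Proof.
move=> H H' an ap lg tK; apply: NNPP => nK.
have [|A [sA cA pA]] := @pick_legs c n K a 6 H ap lg; first exact: nK.
have AK x : x \in A -> x \in K by exact: (subsetP sA).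
have ext x : x \in A -> exists ty, ty < 5 /\ arc_type c' n' ty (a x).
  move=> /AK/tK[h1 h2]; have [ty h3 h4] := arc_type_ex H' h1 h2; by exists ty.
have [ty tyP] := choose_fun 0 ext.
have [|k /card_gt1P[x [y [xA yA ne]]]] := @pigeon A 5 1 ty (fun x xA => (tyP x xA).1); first by rewrite cA.
move: xA yA; rewrite !inE => /andP[xA /eqP kx] /andP[yA /eqP ky].
have [nxy ind] := pA x y xA yA (elimN eqP ne).
have [_ tx] := tyP x xA; have [_ ty'] := tyP y yA; rewrite kx in tx; rewrite ky in ty'.
have [f [m [be [Hf fc [f1 f2] [f3 f4]]]]] := arc_type_link H' tx ty'.
apply: ind; apply: (even_link H Hf _ nxy (be := be)).
- by move=> i j lti lej; have [j' ltj' ->] := fc j lej; apply: an.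
- split=> //; first exact: leg_off ap (AK _ xA) (lg _ (AK _ xA)).1.
  by move=> j lej; have [j' ltj' ->] := fc j lej; have [h _] := tK _ (AK _ xA); apply: h.
- split=> //; first exact: leg_off ap (AK _ yA) (lg _ (AK _ yA)).1.
  by move=> j lej; have [j' ltj' ->] := fc j lej; have [h _] := tK _ (AK _ yA); apply: h.
Qed.

Lemma tail L x y : conn L -> (exists2 t, t \in L & e x t) -> (exists2 t, t \in L & e y t) ->
  exists g k, [/\ geod L g k, forall i, i <= k -> g i \in L,
    forall i, i <= k -> e x (g i) = (i == 0) & forall i, i <= k -> e y (g i) = (i == k)].
Proof.
move=> cL [tx txL ex] [ty tyL ey].
have [||g [k [gd]]] := @shortest_path L (L :&: nb x) (L :&: nb y) cL (subsetIl _ _) (subsetIl _ _).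
- by exists tx; rewrite !inE txL.
- by exists ty; rewrite !inE tyL.
rewrite !inE => /andP[_ e0] /andP[_ ek] H1 H2; have [gL _] := gd.
exists g, k; split=> //.
  move=> i le; apply/idP/eqP => [ei|->//].
  have [|_] := H1 i (g i) le _ (or_introl erefl); first by rewrite !inE gL.
  exact.
move=> i le; apply/idP/eqP => [ei|->//].
have [|_] := H2 i (g i) le _ (or_introl erefl); first by rewrite !inE gL.
exact.
Qed.

Lemma chain_pjoin F l L g k : chain F l L -> ipath g k -> (forall i, i <= k -> g i \in L) ->
  (forall i, i <= k -> e (F l) (g i) = (i == 0)) -> ipath (pjoin F l g) (l + k).+1.
Proof.
move=> [HF _ FL na _] Hg gL gz; apply: pjoin_ipath => //; first by rewrite gz.
move=> i j hi hj; split; first by move=> E; have := FL i hi; rewrite E gL.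
case: (ltnP i l) => lt; first by rewrite (negbTE (na _ _ lt (gL _ hj))).
have -> : i = l by lia.
by rewrite gz // => /eqP.
Qed.

(* Both parities are available for a path from om to a, so one of the two is an even link. *)
Lemma two_tails c n F len L z (om a : G) : hole c n -> (forall b : bool, chain (F b) (len b) L) ->
  (forall b, F b (len b) = z) -> (forall b, F b 0 = om) -> odd (len true) != odd (len false) ->
  (forall b i j, 0 < i <= len b -> j < n -> c j <> F b i /\ ~~ e (c j) (F b i)) ->
  apart c n L -> (forall j, j < n -> c j <> om) -> (forall j, j < n -> c j <> a) ->
  a \notin L -> (exists2 t, t \in L & e a t) ->
  (forall b i, i <= len b -> F b i <> a /\ ~~ e a (F b i)) ->
  exists k b, lin c n k b om /\ lin c n k b a.
Proof.
move=> H ch Fz F0 par apF apL com ca aL ea nF.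
have ez : exists2 t, t \in L & e z t by rewrite -(Fz true); have [] := ch true.
have cL : conn L by have [] := ch true.
have [g [k [/geod_ipath Hg gL gz ga]]] := tail cL ez ea.
have [b hb] : exists b, ~~ odd (len b + k).
  by case: (boolP (odd (len true + k))) => h; [exists false; lia|exists true].
pose h := pjoin (F b) (len b) g.
have Hh : ipath h (len b + k).+1.
  by apply: chain_pjoin (ch b) Hg gL _ => i le; rewrite Fz gz.
have h0 : h 0 = om by rewrite /h /pjoin /= F0.
have hL i : len b < i -> h i = g (i - (len b).+1) by move=> lt; rewrite /h /pjoin leqNgt lt.
have hF i : i <= len b -> h i = F b i by rewrite /h /pjoin => ->.
have Hf := @ipath_sub h (len b + k).+1 1 (len b + k) Hh (leqnn _).
apply: (even_link H Hf (be := false)).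
- move=> i j lti lej; case: (leqP (1 + j) (len b)) => hj; first by rewrite hF //; apply: apF.
  by rewrite hL //; apply: apL => //; apply: gL; lia.
- by rewrite eC -(F0 b); have [] := nF b 0.
- split=> //.
  + move=> j lej; rewrite -h0 => E.
    by have := @ipath_inj h (len b + k).+1 (1 + j) 0 Hh ltac:(lia) (leq0n _) E.
  + by exists 0 => //; rewrite -h0; apply: ipath_step Hh _.
  + by move=> j lej; rewrite -h0 (ipathE Hh) //; lia.
- split=> //.
  + move=> j lej; case: (leqP (1 + j) (len b)) => hj; first by rewrite hF //; have [] := nF b (1 + j).
    by rewrite hL // => E; case/negP: aL; rewrite -E gL //; lia.
  + exists (len b + k) => //; rewrite hL; last lia.
    by rewrite ga; lia.
  + move=> j lej; case: (leqP (1 + j) (len b)) => hj.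
      by rewrite hF // (negbTE (nF b _ hj).2).
    by rewrite hL // ga; lia.
Qed.

(* Every leg touches the initial part of F and the path Q. Two legs with crossing contacts are
   evenly linked through one of the two arcs, so the contacts are nested, and the outermost
   leg closes an odd hole on which the wheel lemma makes every other leg touch one of the two
   sides with constant parity. *)
Lemma no_nested_legs c n K (a : G -> G) w F len L z Q m B :
  hole c n -> apart c n K -> legged c n K a ->
  (forall b : bool, chain (F b) (len b) L) -> (forall b, F b (len b) = z) ->
  odd (len true) != odd (len false) -> (forall b, w < len b) ->
  (forall b i, i <= w -> F b i = F true i) ->
  (forall b i, 0 < i <= len b -> F b i \in K) -> L \subset K ->
  ipath Q m -> Q 0 = z -> (forall i, 0 < i <= m -> Q i \in L) ->
  B \subset K -> 5 < #|B| ->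
  (forall x y, x \in B -> y \in B -> x <> y -> ~~ e (a x) (a y) /\ indep c n (a x) (a y)) ->
  (forall x, x \in B -> exists2 i, 0 < i <= w & e (a x) (F true i)) ->
  (forall x b i, x \in B -> w < i <= len b -> ~~ e (a x) (F b i)) ->
  (forall x, x \in B -> exists2 i, 0 < i <= m & e (a x) (Q i)) -> False.
Proof.
move=> H ap lg ch Fz par wl com FK /subsetP LK HQ Q0 QL /subsetP BK cB pB tL nR tR.
have exL x : x \in B -> exists i, (0 < i <= w /\ e (a x) (F true i)) /\
    forall j, i < j -> ~ (0 < j <= w /\ e (a x) (F true j)).
  move=> /tL[i h ei]; apply: (@max_nat (fun i => 0 < i <= w /\ e (a x) (F true i)) w).
    by exists i.
  by move=> j []; lia.
have exR x : x \in B -> exists i, (0 < i <= m /\ e (a x) (Q i)) /\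
    forall j, j < i -> ~ (0 < j <= m /\ e (a x) (Q j)).
  move=> /tR[i h ei]; apply: (@min_nat (fun i => 0 < i <= m /\ e (a x) (Q i))).
  by exists i.
have [iL iLP] := choose_fun 0 exL; have [iR iRP] := choose_fun 0 exR.
pose h b := pjoin (F b) (len b) (fun i => Q i.+1).
have B0 : 0 < #|B| by lia.
have m0 : 0 < m.
  by have /card_gt0P[x xB] := B0; have [[? _] _] := iRP x xB; lia.
have hF b i : i <= len b -> h b i = F b i by rewrite /h /pjoin => ->.
have hQ b i : 0 < i -> h b (len b + i) = Q i.
  by move=> i0; rewrite /h /pjoin leqNgt (_ : len b < len b + i) /=; [congr Q|]; lia.
have Hh b : ipath (h b) (len b + m).
  have -> : len b + m = (len b + m.-1).+1 by lia.
  apply: chain_pjoin (ch b) _ _ _; first by apply: (@ipath_sub Q m 1 m.-1 HQ); lia.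
    by move=> i le; apply: QL; lia.
  by move=> i le; rewrite Fz -Q0 (ipathE HQ); lia.
have hK b i : 0 < i <= len b + m -> h b i \in K.
  move=> hi; case: (leqP i (len b)) => le; first by rewrite hF //; apply: FK; lia.
  have -> : i = len b + (i - len b) by lia.
  by rewrite hQ; [apply/LK/QL|]; lia.
have off x : x \in B -> forall v, v \in K -> v <> a x.
  by move=> xB v vK; apply: leg_notin ap (lg x (BK x xB)).2 vK.
have offc x : x \in B -> forall i, i < n -> c i <> a x.
  by move=> xB; have xK := BK x xB; apply: leg_off ap xK (lg x xK).1.
have touchL x b i : x \in B -> 0 < i <= len b -> e (a x) (h b i) -> i <= iL x.
  move=> xB hi; rewrite hF; last lia.
  case: (leqP i w) => hw; last by rewrite (negbTE (nR x b i xB _)) //; lia.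
  rewrite com // => ei; rewrite leqNgt; apply/negP=> lt; have [_ mx] := iLP x xB.
  by apply: (mx i lt); split=> //; lia.
have touchR x b i : x \in B -> len b < i <= len b + m -> e (a x) (h b i) -> len b + iR x <= i.
  move=> xB hi; have Ei : i = len b + (i - len b) by lia.
  rewrite Ei hQ; last lia.
  move=> ei; rewrite leq_add2l leqNgt; apply/negP=> lt; have [_ mn] := iRP x xB.
  by apply: (mn _ lt); split=> //; lia.
have rL x : x \in B -> 0 < iL x <= w /\ forall b, e (a x) (h b (iL x)).
  move=> xB; have [[hi ei] _] := iLP x xB; split=> // b.
  by rewrite hF ?com //; have := wl b; lia.
have rR x : x \in B -> 0 < iR x <= m /\ forall b, e (a x) (h b (len b + iR x)).
  by move=> xB; have [[hi ei] _] := iRP x xB; split=> // b; rewrite hQ //; lia.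
have apR b s k : 0 < s -> s + k <= len b + m -> forall i j, i < n -> j <= k ->
    c i <> h b (s + j) /\ ~~ e (c i) (h b (s + j)).
  by move=> s0 hk i j lti lej; apply: ap => //; apply: hK; lia.
(* Otherwise the path from index [iL y] on [F] to index [iR x] on [Q] is touched by both legs at its
   ends only, and a choice of [b] makes its length even. *)
have cross x y : x \in B -> y \in B -> x <> y -> iL x <= iL y -> iR y < iR x.
  move=> xB yB ne lexy; rewrite ltnNge; apply/negP=> leR.
  have [nxy ind] := pB x y xB yB ne; apply: ind.
  have [hx ex] := rL x xB; have [hy ey] := rL y yB.
  have [hx' ex'] := rR x xB; have [hy' ey'] := rR y yB.
  have [b hb] : exists b, ~~ odd (len b + iR x - iL y).
    have wt := wl true; have wf := wl false.
    by case: (boolP (odd (len true + iR x - iL y))) => h'; [exists false; lia|exists true].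
  have wb := wl b.
  have Hf := @ipath_sub (h b) (len b + m) (iL y) (len b + iR x - iL y) (Hh b) ltac:(lia).
  apply: (even_link H Hf (be := false) _ nxy).
  - by apply: apR; lia.
  - split; [exact: offc| | |].
    + by move=> j lej; apply: off => //; apply: hK; lia.
    + by exists (len b + iR x - iL y) => //; rewrite subnKC ?ex' //; lia.
    + move=> j lej ej; case: (leqP (iL y + j) (len b)) => hj.
        by have := touchL x b (iL y + j) xB ltac:(lia) ej; lia.
      by have := touchR x b (iL y + j) xB ltac:(lia) ej; lia.
  - split; [exact: offc| | |].
    + by move=> j lej; apply: off => //; apply: hK; lia.
    + by exists 0 => //; rewrite addn0 ey.
    + move=> j lej ej; case: (leqP (iL y + j) (len b)) => hj.
        by have := touchL y b (iL y + j) yB ltac:(lia) ej; lia.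
      by have := touchR y b (iL y + j) yB ltac:(lia) ej; lia.
have [|l [[x0 [x0B l0]] ml]] := @min_nat (fun l => exists x, x \in B /\ iL x = l).
  by have /card_gt0P[x xB] := B0; exists (iL x), x.
have out y : y \in B -> y <> x0 -> iL x0 < iL y /\ iR y < iR x0.
  move=> yB ne; have le : iL x0 <= iL y.
    by rewrite leqNgt l0; apply/negP=> /ml; apply; exists y.
  have ltR := cross x0 y x0B yB (nesym ne) le; split=> //.
  by rewrite ltnNge; apply/negP=> /(cross y x0 yB x0B ne); lia.
have [h0 e0] := rL x0 x0B; have [h0' e0'] := rR x0 x0B.
have [b hb] : exists b, odd (len b + iR x0 - iL x0).
  have wt := wl true; have wf := wl false.
  by case: (boolP (odd (len true + iR x0 - iL x0))) => h'; [exists true|exists false; lia].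
have wb := wl b.
set M := len b + iR x0 - iL x0 in hb.
pose f i := h b (iL x0 + i).
have Hf : ipath f M by apply: (ipath_sub (Hh b)); lia.
have fK i : i <= M -> f i \in K by move=> le; apply: hK; lia.
have HT : hole (pjoin f M (fun=> a x0)) (M + 0).+2.
  apply: pjoin_hole => //; try lia.
  - by move=> i j; lia.
  - by rewrite eC /f subnKC ?e0' //; lia.
  - by rewrite /f addn0 e0.
  - move=> i j hi j0; split; first exact: off (fK i hi).
    rewrite eC /f => ei; case: (leqP (iL x0 + i) (len b)) => hj.
      by have := touchL x0 b (iL x0 + i) x0B ltac:(lia) ei; lia.
    by have := touchR x0 b (iL x0 + i) x0B ltac:(lia) ei; lia.
rewrite addn0 in HT.
pose P k y := match k with
  | 0 => forall i, i <= w - iL x0 -> e (a y) (f i) -> odd i = true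
  | 1 => forall i, i <= w - iL x0 -> e (a y) (f i) -> odd i = false
  | 2 => forall i, len b - iL x0 < i <= M -> e (a y) (f i) -> odd i = true
  | _ => forall i, len b - iL x0 < i <= M -> e (a y) (f i) -> odd i = false end.
(* If the single change of [a y] comes no later than the end of [F b], its contacts on [Q] have
   constant parity, otherwise those on the initial part do. This gives four cases for at least five
   legs. *)
have exP y : y \in B :\ x0 -> exists k, k < 4 /\ P k y.
  rewrite !inE => /andP[/eqP ne yB]; have [nxy ind] := pB y x0 yB x0B ne.
  have [|k [b' l']] := @lin_exists _ _ (a y) HT.
    move=> i lti; rewrite /pjoin; case: leqP => hi; first exact: off (fK i hi).
    move=> E; apply: ind; rewrite E.
    by have [k [b' l']] := lin_exists H (offc y yB); exists k, b'.
  have l2 i : i <= M -> e (a y) (f i) -> odd i = b' (+) (k <= i).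
    by move=> le ei; apply: l'; [lia|rewrite /pjoin le].
  case: (leqP k (len b - iL x0)) => hk.
    by exists (if b' then 3 else 2); case: b' {l'} l2 => l2; split=> // i hi ei; rewrite l2 //; lia.
  by exists (if b' then 0 else 1); case: b' {l'} l2 => l2; split=> // i hi ei; rewrite l2 //; lia.
have [ty tyP] := choose_fun 0 exP.
have [|k /card_gt1P[x [y [xA yA ne]]]] := @pigeon (B :\ x0) 4 1 ty (fun x xA => (tyP x xA).1).
  by move: cB; rewrite (cardsD1 x0) x0B; lia.
move: xA yA => /setIdP[xA /eqP kx] /setIdP[yA /eqP ky].
have [_ tx] := tyP x xA; have [_ ty'] := tyP y yA.
rewrite kx in tx; rewrite ky in ty'.
move: xA yA => /setD1P[/eqP nex xB] /setD1P[/eqP ney yB].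
have [nxy ind] := pB x y xB yB (elimN eqP ne); apply: ind.
have left z' be : z' \in B -> z' <> x0 -> (forall i, i <= w - iL x0 -> e (a z') (f i) -> odd i = be) ->
    even_touches c n f (w - iL x0) (a z') be.
  move=> zB nez Hz; split=> //; first exact: offc.
    by move=> j lej; apply: off => //; apply: fK; lia.
  have [? _] := out z' zB nez; have [? ez] := rL z' zB.
  by exists (iL z' - iL x0); [lia|rewrite /f subnKC ?ez //; lia].
pose s := (len b - iL x0).+1.
have right z' be : z' \in B -> z' <> x0 ->
    (forall i, len b - iL x0 < i <= M -> e (a z') (f i) -> odd i = be) ->
    even_touches c n (fun i => f (s + i)) (M - s) (a z') (be (+) odd s).
  move=> zB nez Hz; split; [exact: offc| | |].
  - by move=> j lej; apply: off => //; apply: fK; lia.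
  - have [_ ?] := out z' zB nez; have [? ez] := rR z' zB.
    exists (iR z' - 1); first lia.
    by rewrite /f (_ : iL x0 + (s + (iR z' - 1)) = len b + iR z') ?ez //; lia.
  - by move=> j lej ej; have := Hz (s + j) ltac:(lia) ej; lia.
have {}left be : (forall i, i <= w - iL x0 -> e (a x) (f i) -> odd i = be) ->
    (forall i, i <= w - iL x0 -> e (a y) (f i) -> odd i = be) ->
    exists k b, lin c n k b (a x) /\ lin c n k b (a y).
  move=> Hx Hy; apply: (even_link H (@ipathS f M (w - iL x0) Hf ltac:(lia)) _ nxy (left _ _ xB nex Hx) (left _ _ yB ney Hy)).
  by apply: (apR b (iL x0)); lia.
have {}right be : (forall i, len b - iL x0 < i <= M -> e (a x) (f i) -> odd i = be) ->
    (forall i, len b - iL x0 < i <= M -> e (a y) (f i) -> odd i = be) ->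
    exists k b, lin c n k b (a x) /\ lin c n k b (a y).
  move=> Hx Hy; apply: (even_link H (@ipath_sub f M s (M - s) Hf ltac:(lia)) _ nxy (right _ _ xB nex Hx) (right _ _ yB ney Hy)).
  move=> i j lti lej; rewrite /f addnA; apply: (apR b (iL x0 + s) (M - s)) => //; lia.
case: k {kx ky} tx ty' => [|[|[|k]]] /= tx ty'.
- exact: left tx ty'.
- exact: left tx ty'.
- exact: right tx ty'.
- exact: right tx ty'.
Qed.

(** Legs independent of a first leg [om1] must, by [two_tails], touch a route of a link starting at
    [om1]; without those on its hole they touch the part before the branching. A second leg [om2]
    and a second link force contacts on paths that start at the end [z1] of the first link. Six legs
    touching both sides contradict [no_nested_legs]. The constants: 1063 = 1050 + 13, 1050 = 2 (521
    + 4), 521 = 78 + 13 + 430, 430 = 6 + 424, 424 = 2 (208 + 4), 208 = 13 * 16. *)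
Lemma leg_col_nonmono c n K (a : G -> G) : hole c n -> apart c n K -> legged c n K a ->
  col K 1063.
Proof.
move=> H ap lg; apply: NNPP => nK'.
have [K0 [sK0 cK0 nK0 _]] := component nK'.
have {}ap : apart c n K0 := apartS sK0 ap.
have {}lg : legged c n K0 a := leggedS sK0 lg.
clear nK' sK0 K; rename K0 into K.
have off t v : t \in K -> v \in K -> v <> a t.
  by move=> tK vK; apply: leg_notin ap (lg t tK).2 vK.
have offs t A : t \in K -> A \subset K -> a t \notin A.
  by move=> tK sA; apply/negP=> /(subsetP sA) h; apply: (off t _ tK h).
have offc t : t \in K -> forall i, i < n -> c i <> a t.
  by move=> tK; apply: leg_off ap tK (lg t tK).1.
have [w1 [K1 [w1K sK1 nK1 w1P]]] := @pick_leg c n K a 1050 H ap lg nK0.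
have [L0 [sL0 cL0 nL0 _]] := component nK1.
have sL0K : L0 \subset K := subset_trans sL0 sK1.
set om1 := a w1 in w1P *.
have cS1 : conn (om1 |: K).
  by apply: (connU (conn1 (x:=om1)) cK0 _ w1K (lg _ w1K).1); rewrite inE.
have [||||P [p [chP P0 PS]]] := @chain_reach (om1 |: K) L0 om1 cS1 cL0.
- by apply: subset_trans sL0K _; apply: subsetUr.
- exact: ncol_ex nL0.
- by rewrite !inE eqxx.
- exact: offs.
have PK i : 0 < i <= p -> P i \in K.
  move=> /andP[i0 ip]; have := PS i ip; rewrite !inE => /orP[/eqP E|//].
  have [HP _ _ _ _] := chP; have := @ipath_inj P p i 0 HP ip (leq0n _).
  by rewrite E P0 => /(_ erefl); lia.
have p0 : 0 < p.
  rewrite lt0n; apply/eqP=> E; have [_ _ _ _ [x xL0 ex]] := chP.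
  by have [_ h _] := w1P x (subsetP sL0 _ xL0); move: ex; rewrite E P0 (negbTE h).
have [w [F [len [c1 [n1 [L' [C lk]]]]]]] := @link_exists P p L0 521 chP nL0.
have ch := lk_chain lk.
have wl := lk_len lk; have pw := lk_w lk.
have F0 b : F b 0 = om1 by rewrite (lk_pre lk).
have FK b i : 0 < i <= len b -> F b i \in K.
  move=> hi; case: (leqP i p) => h; first by rewrite (lk_pre lk) //; apply: PK; lia.
  by apply: (subsetP sL0K); apply: (lk_in lk); lia.
have sL'L0 := lk_sub lk; have sL'K : L' \subset K := subset_trans sL'L0 sL0K.
have sCL' := lk_C lk; have sCK : C \subset K := subset_trans sCL' sL'K.
have CK1 t : t \in C -> t \in K1.
  by move=> /(subsetP sCL') /(subsetP sL'L0) /(subsetP sL0).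
have H1 := lk_hole lk.
have c1K i : i < n1 -> c1 i \in K.
  by move=> lt; case: (lk_c lk lt) => [/(subsetP sL0K)//|->]; apply: PK; lia.
have touch1 t : t \in C -> exists b i, 0 < i <= len b /\ e (a t) (F b i).
  move=> tC; apply: NNPP => nE; have tK := subsetP sCK _ tC.
  have [h1 h2 h3] := w1P t (CK1 t tC); have [et nm] := lg t tK.
  apply: h3; apply: (two_tails H ch (lk_end lk) F0 (lk_par lk)).
  - by move=> b i j hi ltj; apply: ap => //; apply: FK.
  - exact: apartS sL'K ap.
  - exact: offc.
  - exact: offc.
  - exact: offs.
  - by exists t => //; apply: (subsetP sCL').
  - move=> b i le; case: (posnP i) => [->|i0].
      by rewrite F0; split; [move=> E; rewrite E et in h2|rewrite eC].
    split; first by apply: off => //; apply: FK; rewrite i0.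
    by apply/negP=> ei; apply: nE; exists b, i; rewrite i0.
set z1 := F true (len true).
have Fz b : F b (len b) = z1 by exact: lk_end lk b.
have [jz ltjz Ejz] : exists2 j, j < n1 & z1 = c1 j by apply: (lk_arc lk); have := wl true; lia.
pose P1 t := exists2 j, j < n1 & e (a t) (c1 j).
have nC1 : ~ col (sel C (fun t => ~ P1 t)) 443.
  apply: (@ncol_drop _ _ _ 78); first exact: (lk_ncol lk).
  apply: (two_holes_col H H1 _ (a := a)).
  - by move=> i j lti ltj; apply: ap => //; apply: c1K.
  - by apply: apartS ap; apply: subset_trans (sel_sub _ _) sCK.
  - by apply: leggedS lg; apply: subset_trans (sel_sub _ _) sCK.
  - move=> t /selP[tC Pt]; split=> //; move=> i lti; apply: off; last exact: c1K.
    exact: (subsetP sCK).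
set C1 := sel C _ in nC1.
have sC1C : C1 \subset C := sel_sub _ _.
have sC1K : C1 \subset K := subset_trans sC1C sCK.
have nD1 t j : t \in C1 -> j < n1 -> ~~ e (a t) (c1 j).
  by move=> /selP[_ h] ltj; apply/negP=> ej; apply: h; exists j.
have left t : t \in C1 -> (exists2 i, 0 < i <= w & e (a t) (F true i)) /\
    (forall b i, w < i <= len b -> ~~ e (a t) (F b i)).
  move=> tC1; have tC := subsetP sC1C _ tC1.
  have nw b i : w <= i <= len b -> ~~ e (a t) (F b i).
    by move=> hi; have [j ltj ->] := lk_arc lk hi; apply: nD1.
  split; last by move=> b i hi; apply: nw; lia.
  have [b [i [hi ei]]] := touch1 t tC.
  case: (leqP w i) => hw; first by move: (nw b i ltac:(lia)); rewrite ei.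
  by exists i; [lia|rewrite -(lk_common lk b) // ltnW].
have [w2 [K2 [w2C sK2 nK2 w2P]]] := @pick_leg c n C1 a 430 H (apartS sC1K ap) (leggedS sC1K lg) nC1.
have w2K : w2 \in K := subsetP sC1K _ w2C.
set om2 := a w2 in w2P *.
have z1K : z1 \in K by rewrite Ejz; apply: c1K.
have [L'P cL' z1L' _ [x0 x0L' ex0]] := ch true.
rewrite -/z1 in ex0.
have z1L : z1 \notin L' by apply: z1L'.
have cY0 : conn (z1 |: L').
  by apply: connU (conn1 (x:=z1)) cL' _ x0L' ex0; rewrite inE.
have w2L' : w2 \in L' := subsetP sCL' _ (subsetP sC1C _ w2C).
pose Y := om2 |: (z1 |: L').
have cY : conn Y.
  apply: (connU (conn1 (x:=om2)) cY0 (x := om2) (y := w2)); rewrite ?inE ?w2L' ?orbT //.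
  exact: (lg _ w2K).1.
have om2z : om2 <> z1 by apply/nesym/off.
have YE v : v \in Y -> v <> z1 -> v <> om2 -> v \in L'.
  by rewrite !inE => /or3P[/eqP->|/eqP->|].
(* [J] is taken shortest so that its closed neighbourhood can be deleted at the price of 6
   colours. *)
have [||||J [k [gJ J0 Jk _ _]]] := @shortest_path Y [set z1] [set om2] cY.
- by apply/subsetP=> v /set1P->; rewrite !inE eqxx orbT.
- by apply/subsetP=> v /set1P->; rewrite !inE eqxx.
- by exists z1; rewrite inE.
- by exists om2; rewrite inE.
move: J0 Jk => /set1P J0 /set1P Jk.
have HJ := geod_ipath gJ; have [JY _] := gJ.
have k0 : 0 < k by rewrite lt0n; apply/eqP=> E; apply: om2z; rewrite -J0 -Jk E.
have JL i : 0 < i < k -> J i \in L'.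
  move=> hi; apply: YE; first by apply: JY; lia.
    rewrite -J0 => E; have := @ipath_inj J k i 0 HJ ltac:(lia) ltac:(lia) E; lia.
  rewrite -Jk => E; have := @ipath_inj J k i k HJ ltac:(lia) ltac:(lia) E; lia.
pose NJ := sel Y (fun v => exists i, i <= k /\ (v = J i \/ e v (J i))).
have nL4 : ~ col (K2 :\: NJ) 424 by apply: ncolD (geod_nbhd_col gJ).
have [L4 [sL4 cL4 nL4' _]] := component nL4.
have L4K2 t : t \in L4 -> t \in K2 by move/(subsetP sL4); rewrite inE => /andP[].
have L4C1 t : t \in L4 -> t \in C1 by move/L4K2/(subsetP sK2).
have L4L' t : t \in L4 -> t \in L' by move/L4C1/(subsetP sC1C)/(subsetP sCL').
have L4Y t : t \in L4 -> t \in Y by move/L4L'; rewrite !inE => ->; rewrite !orbT.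
have L4J t i : t \in L4 -> i <= k -> J i <> t /\ ~~ e (J i) t.
  move=> tL le; have := subsetP sL4 _ tL; rewrite inE => /andP[/negP nN _]; split.
    by move=> E; apply: nN; apply/selP; split; [exact: L4Y|exists i; split; [|left]].
  apply/negP=> ei; apply: nN; apply/selP; split; first exact: L4Y.
  by exists i; split=> //; right; rewrite eC.
have [||||P' [p' [chP' P'0 P'Y]]] := @chain_reach (z1 |: L') L4 z1 cY0 cL4.
- by apply/subsetP=> t /L4L'; rewrite !inE => ->; rewrite orbT.
- exact: ncol_ex nL4'.
- by rewrite !inE eqxx.
- by apply/negP=> h; have [/(_ J0)] := L4J _ 0 h (leq0n _).
have [HP' _ P'L P'na [tl tlL etl]] := chP'.
(* The end om2 of J is left out here: a path through om2 is not apart from the hole. *)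
pose near v := exists i, i < k /\ (v = J i \/ e v (J i)).
have [|i0 [[i0p nr] mi0]] := @max_nat (fun i => i <= p' /\ near (P' i)) p' _ (fun i H' => H'.1).
  by exists 0; split=> //; exists 0; split=> //; left; rewrite P'0.
have far i : i0 < i <= p' -> forall j, j < k -> P' i <> J j /\ ~~ e (P' i) (J j).
  move=> /andP[h1 h2] j le; split.
    by move=> E; apply: (mi0 i h1); split=> //; exists j; split=> //; left.
  by apply/negP=> E; apply: (mi0 i h1); split=> //; exists j; split=> //; right.
have notJ j : j < k -> P' i0 <> J j.
  move=> le E; case: (ltnP i0 p') => h.
    have [|_] := far i0.+1 _ j le; first by rewrite ltnSn.
    by rewrite -E eC (ipath_step HP' h).
  have Ep : p' = i0 by lia.
  by have [_] := L4J tl j tlL (ltnW le); rewrite -E -Ep etl.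
have exA : exists j, j < k /\ e (P' i0) (J j).
  by case: nr => j [le [E|ej]]; [case: (notJ j le E)|exists j].
have [d1 [[d1k ed1] md1]] := min_nat exA.
have [|d2 [[d2k ed2] md2]] := @max_nat (fun j => j < k /\ e (P' i0) (J j)) k exA.
  by move=> j []; lia.
(* [A] starts at the last index near [J]. Its later vertices have no contact with [J], except
   possibly with the end [om2]. *)
pose A i := P' (i0 + i); pose q := p' - i0.
have HA : ipath A q by apply: (ipath_sub HP'); rewrite /q; lia.
have chA : chain A q L4.
  split=> //.
  - by move=> i le; apply: P'L; rewrite /q in le; lia.
  - by move=> i x lt xL; apply: P'na => //; rewrite /q in lt; lia.
  - by exists tl => //; rewrite /A /q subnKC.
have Afar i : 0 < i <= q -> forall j, j < k -> A i <> J j /\ ~~ e (A i) (J j).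
  by move=> hi; apply: far; rewrite /q in hi; lia.
have A0 : A 0 = P' i0 by rewrite /A addn0.
have AJ i j : i <= q -> j < k -> A i <> J j.
  move=> le lej; case: (posnP i) => [->|i1]; first by rewrite A0; apply: notJ.
  by have [|] := Afar i _ j lej; first by rewrite i1.
have AL i : i <= q -> A i \in L'.
  move=> le; have := P'Y (i0 + i); rewrite !inE => h.
  have {h} := h ltac:(rewrite /q in le; lia); case/orP=> // /eqP E.
  by case: (AJ i 0 le k0); rewrite J0.
have [v [F2 [len2 [c2 [n2 [L2 [C2 lk2]]]]]]] := @link_exists A q L4 208 chA nL4'.
have ch2 := lk_chain lk2.
have F2E b i : i <= len2 b -> (i <= q /\ F2 b i = A i) \/ (q < i /\ F2 b i \in L4).
  move=> le; case: (leqP i q) => h; [left|right]; split=> //; first exact: lk_pre lk2 _ _ h.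
  by apply: (lk_in lk2); rewrite h.
have F2L b i : i <= len2 b -> F2 b i \in L'.
  by move=> /F2E[[h ->]|[_ /L4L'//]]; apply: AL.
have F2om b i : i <= len2 b -> F2 b i <> om2.
  by move=> le; apply: off => //; apply/(subsetP sL'K)/F2L.
have F2J b i j : i <= len2 b -> j < k -> F2 b i <> J j /\ (e (F2 b i) (J j) -> i = 0 /\ d1 <= j <= d2).
  move=> le lej; case: (F2E b i le) => [[h ->]|[h h']]; last first.
    have [n3 n4] := L4J _ j h' (ltnW lej); split; first exact: nesym.
    by rewrite eC (negbTE n4).
  split; first exact: AJ.
  case: (posnP i) => [->|i1].
    rewrite A0 => ej; split=> //; apply/andP; split.
      by rewrite leqNgt; apply/negP=> /md1; apply.
    by rewrite leqNgt; apply/negP=> /md2; apply.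
  by have [|_ /negbTE->] := Afar i _ j lej; first by rewrite i1.
have F20 b : F2 b 0 = P' i0 by rewrite (lk_pre lk2) // A0.
have sL2L4 := lk_sub lk2.
have sC2L2 := lk_C lk2.
(* The route from [om2] to the second link goes directly to the last neighbour of [om2] on [A] if
   there is one; otherwise it follows [J] back to [d2], the neighbour of [A 0] closest to [om2]. *)
have [d [s0 [dk s0q eds sep]]] : exists d s0, [/\ d <= k, s0 <= q, forall b, e (F2 b s0) (J d) &
    forall b i j, s0 <= i <= len2 b -> d <= j <= k -> e (F2 b i) (J j) -> i = s0 /\ j = d].
  case: (classic (exists i, i <= q /\ e (A i) om2)) => [ex|nex].
    have [|i1 [[i1q ei1] mi1]] := max_nat (b := q) ex; first by move=> i [].
    exists k, i1; split=> // [b|b i j hi hj].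
      by rewrite (lk_pre lk2) // Jk.
    have -> : j = k by lia.
    rewrite Jk => ei; split=> //; case: (F2E b i) => [|[h E]|[h h']]; first lia.
      rewrite E in ei; case: (ltngtP i i1) => // h'; first lia.
      by case: (mi1 i h'); split.
    by have [_] := L4J _ k h' (leqnn _); rewrite Jk eC ei.
  exists d2, 0; split=> // [|b|b i j hi hj ei]; first exact: ltnW.
    by rewrite F20.
  case: (ltnP j k) => h; first by have [|_ /(_ ei)] := F2J b i j _ h; lia.
  have Ej : j = k by lia.
  rewrite Ej Jk in ei; case: (F2E b i) => [|[h' E]|[h' h'']]; first lia.
    by case: nex; exists i; rewrite -E.
  by have [_] := L4J _ k h'' (leqnn _); rewrite Jk eC ei.
have qlen b : q < len2 b by have := lk_w lk2; have := lk_len lk2 b; lia.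
pose R i := J (k - i).
have HR : ipath R (k - d).
  by move=> i j h1 h2; apply: (ipath_rev HJ) => //; lia.
pose g b := pjoin R (k - d) (fun i => F2 b (s0 + i)); pose glen b := (k - d + (len2 b - s0)).+1.
have Hg b : ipath (g b) (glen b).
  have [HF2 _ _ _ _] := ch2 b; have lt := qlen b.
  apply: pjoin_ipath => //.
  - by apply: (ipath_sub HF2); lia.
  - by rewrite /R addn0 eC subKn.
  move=> i j hi hj; split.
    rewrite /R; case: (posnP i) => [->|i1] E.
      by case: (F2om b (s0 + j)); [lia|rewrite -E subn0].
    by have [ne _] := F2J b (s0 + j) (k - i) ltac:(lia) ltac:(lia); case: ne.
  by rewrite eC => ei; have := sep b (s0 + j) (k - i) ltac:(lia) ltac:(lia) ei; lia.
have gR b i : i <= k - d -> g b i = R i by rewrite /g /pjoin => ->.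
have gF b i : k - d < i -> g b i = F2 b (s0 + (i - (k - d).+1)).
  by move=> h; rewrite /g /pjoin leqNgt h.
have chg b : chain (g b) (glen b) L2.
  have [HF2 cL2 FL2 Fna2 [y yL2 ey]] := ch2 b.
  split=> //.
  - move=> i le; case: (leqP i (k - d)) => h.
      rewrite gR //; apply/negP=> /(subsetP sL2L4) h'.
      by have [|/(_ erefl)] := L4J _ (k - i) h'; first lia.
    by rewrite gF //; apply: FL2; have := qlen b; rewrite /glen in le; lia.
  - move=> i x lt xL; case: (leqP i (k - d)) => h.
      by rewrite gR //; have [|] := L4J x (k - i) (subsetP sL2L4 _ xL); first lia.
    by rewrite gF //; apply: Fna2; rewrite // /glen in lt *; have := qlen b; lia.
  - exists y => //; rewrite gF /glen; last lia.
    by rewrite subSS addKn subnKC //; have := qlen b; lia.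
have gK b i : 0 < i <= glen b -> g b i \in K.
  move=> hi; case: (leqP i (k - d)) => h.
    rewrite gR // /R; case: (posnP (k - i)) => [->|ki]; first by rewrite J0.
    by apply/(subsetP sL'K)/JL; lia.
  by rewrite gF //; apply/(subsetP sL'K)/F2L; have := qlen b; rewrite /glen in hi; lia.
have sC2L' : C2 \subset L' by apply/subsetP=> t /(subsetP sC2L2)/(subsetP sL2L4)/L4L'.
have sC2K : C2 \subset K := subset_trans sC2L' sL'K.
have C2C1 t : t \in C2 -> t \in C1 by move=> /(subsetP sC2L2)/(subsetP sL2L4)/L4C1.
have nz t : t \in C2 -> ~~ e (a t) z1.
  by move=> /C2C1 tC; rewrite Ejz; apply: nD1.
(* Three paths from [z1] cover all contacts on the routes [g b]: [J], and [J] up to [d1] continued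
   by either branch of the second link. Of 16 legs, six touch the same path. *)
pose Q s := if s is 0 then J else pjoin J d1 (F2 (s == 1)).
pose m s := if s is 0 then k.-1 else (d1 + len2 (s == 1)).+1.
have touch2 t : t \in C2 -> exists s, s < 3 /\ exists2 i, 0 < i <= m s & e (a t) (Q s i).
  move=> tC2; have tK := subsetP sC2K _ tC2; have [et nm] := lg t tK.
  have [h1 h2 h3] := w2P t (L4K2 _ (subsetP sL2L4 _ (subsetP sC2L2 _ tC2))).
  have [b [i [hi ei]]] : exists b i, 0 < i <= glen b /\ e (a t) (g b i).
    apply: NNPP => nE; apply: h3.
    apply: (two_tails H chg (z := F2 true (len2 true))).
    - move=> b; rewrite gF /glen; last lia.
      by rewrite subSS addKn subnKC ?(lk_end lk2) //; have := qlen b; lia.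
    - by move=> b; rewrite gR // /R subn0 Jk.
    - by have := lk_par lk2; have := qlen true; have := qlen false; rewrite /glen; lia.
    - by move=> b i j hi ltj; apply: ap => //; apply: gK.
    - by apply: apartS ap; apply/subsetP=> x /(subsetP sL2L4)/L4L'/(subsetP sL'K).
    - exact: offc.
    - exact: offc.
    - by apply: offs => //; apply/subsetP=> x /(subsetP sL2L4)/L4L'/(subsetP sL'K).
    - by exists t => //; apply: (subsetP sC2L2).
    - move=> b i le; case: (posnP i) => [->|i1].
        by rewrite gR // /R subn0 Jk; split; [move=> E; rewrite -/om2 E et in h2|rewrite eC].
      split; first by apply: off => //; apply: gK; rewrite i1.
      by apply/negP=> ei; apply: nE; exists b, i; rewrite i1.
  case: (leqP i (k - d)) => h.
    exists 0; split=> //; rewrite gR // /R in ei; exists (k - i) => //=.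
    case: (posnP (k - i)) => E; last lia.
    by rewrite E J0 (negbTE (nz t tC2)) in ei.
  rewrite gF // in ei; exists (if b then 1 else 2); split; first by case: b {hi ei}.
  exists (d1.+1 + (s0 + (i - (k - d).+1))).
    have -> : m (if b then 1 else 2) = (d1 + len2 b).+1 by case: b {hi ei}.
    by rewrite /glen in hi; have := qlen b; lia.
  have -> : Q (if b then 1 else 2) = pjoin J d1 (F2 b) by case: b {hi ei}.
  by rewrite /pjoin leqNgt (_ : d1 < _) /=; [rewrite addKn|lia].
have [|A6 [sA6 cA6 pA6]] := @pick_legs c n C2 a 16 H (apartS sC2K ap) (leggedS sC2K lg).
  exact: (lk_ncol lk2).
have [cl clP] := choose_fun 0 touch2.
have [|s cB] := @pigeon A6 3 5 cl (fun x xA => (clP x (subsetP sA6 _ xA)).1).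
  by rewrite cA6.
set B := [set x in A6 | cl x == s] in cB.
have BA x : x \in B -> x \in A6 /\ cl x = s by move=> /setIdP[? /eqP].
have BC x : x \in B -> x \in C2 by move=> /BA[/(subsetP sA6)].
have sBK : B \subset K by apply/subsetP=> x /BC/(subsetP sC2K).
have HQ : ipath (Q s) (m s).
  rewrite /Q /m; case: s {cB B BA BC sBK} => [|s]; first by apply: (ipathS HJ); lia.
  have [HF2 _ _ _ _] := ch2 (s.+1 == 1).
  apply: pjoin_ipath => //; first by apply: (ipathS HJ); lia.
    by rewrite F20 eC.
  move=> i j hi hj; have [|n3 n4] := F2J (s.+1 == 1) j i hj; first lia.
  by split; [apply/nesym | rewrite eC => /n4; lia].
have Q0 : Q s 0 = z1 by rewrite /Q; case: (s) => [|?]; rewrite ?/pjoin ?J0.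
have QL i : 0 < i <= m s -> Q s i \in L'.
  rewrite /Q /m; case: s {cB B BA BC sBK HQ Q0} => [|s] hi; first by apply: JL; lia.
  rewrite /pjoin; case: leqP => h; last by apply: F2L; lia.
  by apply: JL; lia.
apply: (@no_nested_legs c n K a w F len L' z1 (Q s) (m s) B) => //.
- exact: lk_par lk.
- exact: lk_common lk.
- by move=> x y /BA[xA _] /BA[yA _]; apply: pA6.
- by move=> x /BC/C2C1/left[].
- by move=> x b i /BC/C2C1/left[_]; apply.
- by move=> x xB; have [xA E] := BA x xB; have [_] := clP x (subsetP sA6 _ xA); rewrite E.
Qed.

Lemma leg_col c n K (a : G -> G) : hole c n -> apart c n K ->
  (forall t, t \in K -> e (a t) t /\ exists2 i, i < n & e (a t) (c i)) -> col K 1075.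
Proof.
move=> H ap lg; apply: (@col_cases _ (fun t => ~ mono c n (a t)) (fun t => mono c n (a t)) 1063 12).
- by move=> t _; case: (classic (mono c n (a t))); [right|left].
- apply: (@leg_col_nonmono c n _ a H (apartS (sel_sub _ _) ap)) => t /selP[tK nm].
  by split=> //; have [] := lg t tK.
- apply: (@mono_col c n _ a H (apartS (sel_sub _ _) ap)) => t /selP[tK m] //.
  exact: lg.
Qed.

(** * Composition of chains and the rope *)

Lemma col0 : col (set0 : {set G}) 0.
Proof. by exists (fun=> 0); split=> v; rewrite inE. Qed.

Lemma chain0 z L : conn L -> z \notin L -> (exists2 x, x \in L & e z x) -> chain (fun=> z) 0 L.
Proof. by move=> cL zL ex; split=> //; move=> i j; lia. Qed.

Lemma chain_comp P p L Q q L' : chain P p L -> chain Q q L' -> Q 0 = P p ->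
  (forall i, 0 < i <= q -> Q i \in L) -> L' \subset L -> chain (pglue P p Q) (p + q) L'.
Proof.
move=> ch [HQ cL' QL' Qna exQ] E QL sL; split=> //.
- exact: chain_glue ch HQ E QL.
- move=> i le; rewrite /pglue; case: leqP => h; last by apply: QL'; lia.
  by have [_ _ PL _ _] := ch; apply: contra (PL i h); apply: (subsetP sL).
- move=> i x lt xL'; rewrite /pglue; case: leqP => h; last by apply: Qna => //; lia.
  have [_ _ _ Pna _] := ch; case: (ltnP i p) => h'; first by apply: Pna; rewrite // (subsetP sL).
  have -> : i = p by lia.
  case: (posnP q) => q0; first by lia.
  by rewrite -E; apply: Qna.
- have [x xL' ex] := exQ; exists x => //; rewrite /pglue; case: leqP => h; last by rewrite addKn.
  have q0 : q = 0 by lia.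
  by rewrite q0 addn0 -E -q0.
Qed.

Lemma pglueL (P Q : nat -> G) p i : i <= p -> pglue P p Q i = P i.
Proof. by rewrite /pglue => ->. Qed.
Lemma pglueR (P Q : nat -> G) p i : Q 0 = P p -> pglue P p Q (p + i) = Q i.
Proof.
rewrite /pglue; case: leqP => h E; last by rewrite addKn.
have -> : i = 0 by lia.
by rewrite addn0 E.
Qed.

(** Parents stay in the ball and lead to [z]. *)
Lemma ball_conn S z (d : G -> nat) (par : G -> G) m :
  (forall v, v \in S -> (d v = 0 <-> v \in [set z])) ->
  (forall v, v \in S -> 0 < d v -> [/\ par v \in S, e v (par v) & d v = (d (par v)).+1]) ->
  conn [set v in S | d v <= m].
Proof.
move=> d0 dp.
have up v : v \in [set v in S | d v <= m] -> forall Q : G -> Prop,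
    (forall u v, u \in [set v in S | d v <= m] -> v \in [set v in S | d v <= m] -> e u v -> Q u -> Q v) ->
    (Q v <-> Q z).
  rewrite inE => /andP[vS lev] Q Qst.
  move: v vS lev; suff H k v : v \in S -> d v <= m -> d v = k -> (Q v <-> Q z) by move=> v vS lev; apply: (H (d v)).
  elim: k v => [|k IH] v vS lev E; first by have /(d0 v vS)/set1P-> := E.
  have [|pvS ev dpv] := dp v vS; first lia.
  rewrite -(IH (par v)) //; try lia.
  have vB : v \in [set v in S | d v <= m] by rewrite inE vS.
  have pB : par v \in [set v in S | d v <= m] by rewrite inE pvS; lia.
  by split; apply: Qst => //; rewrite eC.
move=> Q [y yB Qy] Qst y' yB'.
by apply/(up y' yB' Q Qst)/(up y yB Q Qst).
Qed.

(* One stage of a rope: the marked vertices P x and P x', followed by a link. *)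
Record stage (conf : G -> {set G}) z L N P p L1 w F len c n L' C (x x' : nat) : Prop := Stage {
  st_link : link P p L1 N w F len c n L' C;
  st_P0 : P 0 = z;
  st_PL : forall i, 0 < i <= p -> P i \in L;
  st_sub : L1 \subset L;
  st_x : 0 < x < x' /\ x' <= p;
  st_odd : odd x' = ~~ odd x;
  st_conf : P x' \notin conf (P x);
  st_conf' : forall v, v \in L1 -> v \notin conf (P x) /\ v \notin conf (P x') }.

(** Five extensions cost one colour each, and two of them also exclude the conflict set of a mark:
    this is the summand [2 * r + 5]. The first mark ends the first extension, and what follows the
    second extension avoids its conflicts. *)
Lemma stage_exists conf r z L N : (forall v, col (conf v) r) -> conn L -> z \notin L ->
  (exists2 x, x \in L & e z x) -> ~ col L (2 * (N + 4) + (2 * r + 5)) ->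
  exists P p L1 w F len c n L' C (x x' : nat), stage conf z L N P p L1 w F len c n L' C x x'.
Proof.
move=> cr cL zL ex nL.
have ch0 := chain0 cL zL ex.
have [|P1 [p1 [L1 [ch1 lt1 E1 in1 [sL1 nL1]]]]] :=
  @chain_ext _ 0 L set0 (2 * (N + 4) + (2 * r + 4)) 0 ch0 col0.
  by apply: ncolS nL => //; lia.
have [|P2 [p2 [L2 [ch2 lt2 E2 in2 [sL2 nL2]]]]] :=
  @chain_ext P1 p1 L1 (conf (P1 p1)) (2 * (N + 4) + (r + 3)) r ch1 (cr _).
  by apply: ncolS nL1 => //; lia.
have [|P3 [p3 [L3 [ch3 lt3 E3 in3 [sL3 nL3]]]]] :=
  @chain_ext P2 p2 L2 set0 (2 * (N + 4) + (r + 2)) 0 ch2 col0.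
  by apply: ncolS nL2 => //; lia.
have [|P4 [p4 [L4 [ch4 lt4 E4 in4 [sL4 nL4]]]]] :=
  @chain_ext P3 p3 L3 set0 (2 * (N + 4) + (r + 1)) 0 ch3 col0.
  by apply: ncolS nL3 => //; lia.
(* The fourth extension guarantees that index [p3.+1] exists, so the second mark can be placed at
   the parity opposite to the first. *)
pose x' := if odd p3 == odd p1 then p3.+1 else p3.
have hx' : p3 <= x' <= p3.+1 by rewrite /x'; case: ifP; lia.
have [|P5 [p5 [L5 [ch5 lt5 E5 in5 [sL5 nL5]]]]] :=
  @chain_ext P4 p4 L4 (conf (P4 x')) (2 * (N + 4)) r ch4 (cr _).
  by apply: ncolS nL4 => //; lia.
have [w [F [len [c [n [L' [C lk]]]]]]] := link_exists ch5 nL5.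
have s1 v : v \in L1 -> v \in L by move/(subsetP sL1); rewrite inE => /andP[].
have s2 v : v \in L2 -> v \in L1 /\ v \notin conf (P1 p1).
  by move/(subsetP sL2); rewrite inE => /andP[].
have s3 v : v \in L3 -> v \in L2 by move/(subsetP sL3); rewrite inE => /andP[].
have s4 v : v \in L4 -> v \in L3 by move/(subsetP sL4); rewrite inE => /andP[].
have s5 v : v \in L5 -> v \in L4 /\ v \notin conf (P4 x').
  by move/(subsetP sL5); rewrite inE => /andP[].
have Ex : P5 p1 = P1 p1.
  by rewrite E5 ?E4 ?E3 ?E2 //; lia.
have Ex' : P5 x' = P4 x' by rewrite E5 //; lia.
exists P5, p5, L5, w, F, len, c, n, L', C, p1, x'; split=> //.
- by rewrite E5 ?E4 ?E3 ?E2 ?E1 //; lia.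
- move=> i hi; case: (leqP i p4) => h4; last first.
    have [h _] : P5 i \in L4 /\ True by split=> //; apply: in5; lia.
    by apply/s1; have /s3/s2[] := s4 _ h.
  rewrite E5 //; case: (leqP i p3) => h3; last first.
    have h : P4 i \in L3 by apply: in4; lia.
    by apply/s1; have /s2[] := s3 _ h.
  rewrite E4 //; case: (leqP i p2) => h2; last first.
    have h : P3 i \in L2 by apply: in3; lia.
    by apply/s1; have [] := s2 _ h.
  rewrite E3 //; case: (leqP i p1) => h1; last by apply/s1/in2; lia.
  by rewrite E2 //; apply: in1; lia.
- by apply/subsetP=> v /s5[/s4/s3/s2[/s1]].
- by split; lia.
- by rewrite /x'; case: ifP => /=; lia.
- rewrite Ex Ex'; case: (leqP x' p3) => h.
    have -> : x' = p3 by lia.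
    rewrite E4 //; have h3 : P3 p3 \in L2 by apply: in3; lia.
    by have [] := s2 _ h3.
  have h4 : P4 x' \in L3 by apply: in4; lia.
  by have /s2[] := s3 _ h4.
- move=> v /s5[/s4/s3/s2[_ h1] h2]; by rewrite Ex Ex'.
Qed.

(** Marks 0, 1 precede the first link, 2, 3 lie between the first two links, 4, 5 follow the second;
    [l1] and [l2] are the parities of the branches. Two marks of one stage differ already, and the
    other consecutive pairs of a triple have separate links between them. *)
Lemma triple_parity (B : nat -> bool) (l1 l2 : bool -> bool) a b d :
  l1 true != l1 false -> l2 true != l2 false ->
  B 1 = ~~ B 0 -> B 3 = ~~ B 2 -> B 5 = ~~ B 4 -> a < b -> b < d -> d < 6 ->
  let pi b1 b2 i := B i (+) ((1 < i) && l1 b1) (+) ((3 < i) && l2 b2) in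
  exists b1 b2, pi b1 b2 a != pi b1 b2 b /\ pi b1 b2 b != pi b1 b2 d.
Proof.
move=> h1 h2 B1 B3 B5 ab bd d6 pi.
have ch (l : bool -> bool) be : l true != l false -> exists b0, l b0 = be.
  move=> h; case E: (l true == be); first by exists true; apply/eqP.
  by exists false; move: h E; case: (l true); case: (l false); case: be.
pose be1 := if (1 < b) && (b < 4) then ~~ (B a (+) B b)
            else if (b < 2) && (d < 4) then ~~ (B b (+) B d) else false.
pose be2 := if b < 4 then ~~ (B b (+) B d) else ~~ (B a (+) B b).
have [b1 E1] := ch l1 be1 h1; have [b2 E2] := ch l2 be2 h2.
exists b1, b2; rewrite /pi E1 E2 /be1 /be2 {E1 E2 be1 be2 pi h1 h2 ch}; clear b1 b2 l1 l2.
move: a b d ab bd d6 => [|[|[|[|a]]]] [|[|[|[|[|b]]]]] [|[|[|[|[|[|d]]]]]] //= _ _ _.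
all: by rewrite ?B1 ?B3 ?B5; move: (B 0) (B 2) (B 4) => [] [] [].
Qed.

Lemma mono_triple (cls : nat -> bool) : exists a b d,
  [/\ a < b, b < d, d < 6, cls a = cls b & cls b = cls d].
Proof.
have H a b d : a < b -> b < d -> d < 6 -> (cls a == cls b) && (cls b == cls d) ->
    exists a b d, [/\ a < b, b < d, d < 6, cls a = cls b & cls b = cls d].
  by move=> h1 h2 h3 /andP[/eqP ? /eqP ?]; exists a, b, d.
apply: NNPP => nE.
have nH a b d : a < b -> b < d -> d < 6 -> ~~ ((cls a == cls b) && (cls b == cls d)).
  by move=> h1 h2 h3; apply/negP=> /(H a b d h1 h2 h3).
have := nH 0 1 2 isT isT isT; have := nH 0 1 3 isT isT isT; have := nH 0 1 4 isT isT isT.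
have := nH 0 2 3 isT isT isT; have := nH 0 2 4 isT isT isT; have := nH 0 3 4 isT isT isT.
have := nH 1 2 3 isT isT isT; have := nH 1 2 4 isT isT isT; have := nH 1 3 4 isT isT isT.
have := nH 2 3 4 isT isT isT.
by case: (cls 0); case: (cls 1); case: (cls 2); case: (cls 3); case: (cls 4).
Qed.

Definition stage_col r N := 2 * (N + 4) + (2 * r + 5).
(** 1075 colours for each of the three holes of the links; 1075 for a hole closed through one
    parent, plus 6 for the neighbourhood of the tail used there and 1 for the neighbours of this
    parent. *)
Definition core_col := 1082 + 1075 + 1075 + 1075.
Definition rope_col r := 2 * iter 3 (stage_col r) core_col.

(** The stages run inside a level and start at [q0] in the level before. If the parent of some [t]
    in the last core touches no route, a path through earlier levels joins it to [q0], and the third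
    link makes the closed hole odd. If there is no such [t], the core is colourable. The marks are
    fixed before [cls], because their classes come from a set built on the grandparents of these
    marks. *)
Lemma rope H conf r : (forall v, col (conf v) r) -> ~ col H (rope_col r) ->
  exists o : nat -> G, [/\ forall i, i < 6 -> o i \in H,
    forall i j, i < j -> j < 6 -> o j \notin conf (o i) &
    forall cls : nat -> bool, exists c n (X : nat -> nat) a b d,
      [/\ hole c n, forall i, i < n -> c i \in H,
          [/\ a < b, b < d, d < 6, cls a = cls b & cls b = cls d],
          [/\ X a < X b, X b < X d & X d < n] &
          [/\ odd (X a) != odd (X b), odd (X b) != odd (X d) &
              [/\ c (X a) = o a, c (X b) = o b & c (X d) = o d]]]].
Proof.
move=> cr nH0; have [S [sSH cS nS _]] := component nH0.
have [z0 z0S] := ncol_ex nS.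
have [||dd [par [d0 dp dl]]] := @bfs S [set z0] cS; [by rewrite sub1set|by exists z0; rewrite inE|].
have [|j j2 nj] := @deep_level S z0 dd par _ _ d0 dp dl nS.
  by rewrite /= /stage_col; lia.
have [K [sK cK nK _]] := component nj.
have KP v : v \in K -> v \in S /\ dd v = j by move/(subsetP sK); rewrite inE => /andP[? /eqP].
have [xk xkK] := ncol_ex nK; have [xkS dxk] := KP _ xkK.
have [|q0S exq dq0] := dp xk xkS; first by lia.
set q0 := par xk in q0S exq dq0.
have q0K : q0 \notin K by apply/negP=> /KP[_]; lia.
have exz1 : exists2 x, x \in K & e q0 x by exists xk; rewrite // eC.
have [|P1 [p1 [M1 [w1 [F1 [len1 [c1 [n1 [L1 [C1 [x1 [x1' st1]]]]]]]]]]]] :=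
    @stage_exists conf r q0 K (iter 2 (stage_col r) core_col) cr cK q0K exz1; first exact: nK.
have lk1 := st_link st1.
pose z1 := F1 true (len1 true).
have [_ cL1 FL1 _ exz2] := lk_chain lk1 true.
have z1L1 : z1 \notin L1 by apply: FL1.
have [|P2 [p2 [M2 [w2 [F2 [len2 [c2 [n2 [L2 [C2 [x2 [x2' st2]]]]]]]]]]]] :=
    @stage_exists conf r z1 L1 (stage_col r core_col) cr cL1 z1L1 exz2.
  by apply: ncolS (lk_ncol lk1); [exact: lk_C lk1|exact: leqnn].
have lk2 := st_link st2.
pose z2 := F2 true (len2 true).
have [_ cL2 FL2 _ exz3] := lk_chain lk2 true.
have z2L2 : z2 \notin L2 by apply: FL2.
have [|P3 [p3 [M3 [w3 [F3 [len3 [c3 [n3 [L3 [C3 [x3 [x3' st3]]]]]]]]]]]] :=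
    @stage_exists conf r z2 L2 core_col cr cL2 z2L2 exz3.
  by apply: ncolS (lk_ncol lk2); [exact: lk_C lk2|exact: leqnn].
have lk3 := st_link st3.
pose z3 := F3 true (len3 true).
have sM1K := st_sub st1; have sL1M1 := lk_sub lk1.
have sM2L1 := st_sub st2; have sL2M2 := lk_sub lk2.
have sM3L2 := st_sub st3; have sL3M3 := lk_sub lk3.
have sC3L3 := lk_C lk3.
have sL1K := subset_trans sL1M1 sM1K.
have sL2L1 := subset_trans sL2M2 sM2L1.
have sL3L2 := subset_trans sL3M3 sM3L2.
have sL2K := subset_trans sL2L1 sL1K.
have sL3K := subset_trans sL3L2 sL2K.
have [[hx1 hx1'] [hx2 hx2'] [hx3 hx3']] := And3 (st_x st1) (st_x st2) (st_x st3).
have pw1 := lk_w lk1; have pw2 := lk_w lk2; have pw3 := lk_w lk3.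
have wl1 := lk_len lk1; have wl2 := lk_len lk2; have wl3 := lk_len lk3.
have F1P b i : i <= p1 -> F1 b i = P1 i by apply: (lk_pre lk1).
have F2P b i : i <= p2 -> F2 b i = P2 i by apply: (lk_pre lk2).
have F3P b i : i <= p3 -> F3 b i = P3 i by apply: (lk_pre lk3).
have F10 b : F1 b 0 = q0 by rewrite F1P // (st_P0 st1).
have F20 b : F2 b 0 = z1 by rewrite F2P // (st_P0 st2).
have F30 b : F3 b 0 = z2 by rewrite F3P // (st_P0 st3).
have F1K b i : 0 < i <= len1 b -> F1 b i \in K.
  move=> hi; case: (leqP i p1) => h; first by rewrite F1P //; apply: (st_PL st1); lia.
  by apply/(subsetP sM1K)/(lk_in lk1); lia.
have F2L b i : 0 < i <= len2 b -> F2 b i \in L1.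
  move=> hi; case: (leqP i p2) => h; first by rewrite F2P //; apply: (st_PL st2); lia.
  by apply/(subsetP sM2L1)/(lk_in lk2); lia.
have F3L b i : 0 < i <= len3 b -> F3 b i \in L2.
  move=> hi; case: (leqP i p3) => h; first by rewrite F3P //; apply: (st_PL st3); lia.
  by apply/(subsetP sM3L2)/(lk_in lk3); lia.
pose g2 b1 b2 := pglue (F1 b1) (len1 b1) (F2 b2).
pose g3 b1 b2 b3 := pglue (g2 b1 b2) (len1 b1 + len2 b2) (F3 b3).
have E1 b1 b2 : F2 b2 0 = F1 b1 (len1 b1) by rewrite F20 (lk_end lk1).
have ch2 b1 b2 : chain (g2 b1 b2) (len1 b1 + len2 b2) L2.
  by apply: chain_comp (lk_chain lk1 b1) (lk_chain lk2 b2) (E1 _ _) (F2L _) sL2L1.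
have E2 b1 b2 b3 : F3 b3 0 = g2 b1 b2 (len1 b1 + len2 b2).
  by rewrite F30 /g2 pglueR ?(lk_end lk2).
have ch3 b1 b2 b3 : chain (g3 b1 b2 b3) (len1 b1 + len2 b2 + len3 b3) L3.
  by apply: chain_comp (ch2 b1 b2) (lk_chain lk3 b3) (E2 _ _ _) (F3L _) sL3L2.
have g31 b1 b2 b3 i : i <= len1 b1 -> g3 b1 b2 b3 i = F1 b1 i.
  by move=> h; rewrite /g3 pglueL ?/g2 ?pglueL //; lia.
have g32 b1 b2 b3 i : i <= len2 b2 -> g3 b1 b2 b3 (len1 b1 + i) = F2 b2 i.
  by move=> h; rewrite /g3 pglueL ?/g2 ?pglueR //; lia.
have g33 b1 b2 b3 i : g3 b1 b2 b3 (len1 b1 + len2 b2 + i) = F3 b3 i.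
  by rewrite /g3 pglueR.
have g3end b1 b2 b3 : g3 b1 b2 b3 (len1 b1 + len2 b2 + len3 b3) = z3 by rewrite g33 (lk_end lk3).
have g3cases b1 b2 b3 i : 0 < i <= len1 b1 + len2 b2 + len3 b3 ->
   [\/ 0 < i <= len1 b1 /\ g3 b1 b2 b3 i = F1 b1 i,
      exists2 k, 0 < k <= len2 b2 & i = len1 b1 + k /\ g3 b1 b2 b3 i = F2 b2 k |
      exists2 k, 0 < k <= len3 b3 & i = len1 b1 + len2 b2 + k /\ g3 b1 b2 b3 i = F3 b3 k].
  move=> hi; case: (leqP i (len1 b1)) => h1; first by constructor 1; split; [lia|rewrite g31].
  case: (leqP i (len1 b1 + len2 b2)) => h2.
    constructor 2; exists (i - len1 b1); first lia.
    by split; [lia|rewrite -{1}(subnKC (ltnW h1)) g32 //; lia].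
  constructor 3; exists (i - (len1 b1 + len2 b2)); first lia.
  by split; [lia|rewrite -{1}(subnKC (ltnW h2)) g33].
have g3K b1 b2 b3 i : 0 < i <= len1 b1 + len2 b2 + len3 b3 -> g3 b1 b2 b3 i \in K.
  move=> /(g3cases b1 b2 b3 i)[[h ->]|[k h [_ ->]]|[k h [_ ->]]]; first exact: F1K.
    by apply/(subsetP sL1K)/F2L.
  by apply/(subsetP sL2K)/F3L.
have g30 b1 b2 b3 : g3 b1 b2 b3 0 = q0 by rewrite g31.
pose touch t := (exists b i, 0 < i <= len1 b /\ e (par t) (F1 b i)) \/
  (exists b i, 0 < i <= len2 b /\ e (par t) (F2 b i)) \/
  (exists b i, 0 < i <= len3 b /\ e (par t) (F3 b i)).
have parK t : t \in K -> [/\ par t \in S, e (par t) t & (dd (par t)).+1 = j].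
  move=> /KP[tS dt]; have [|pS ep dpt] := dp t tS; first lia.
  by split=> //; [rewrite eC | lia].
have parnK t : t \in K -> forall v, v \in K -> v <> par t.
  by move=> /parK[_ _ h] v /KP[_ h'] E; rewrite -E h' in h; lia.
have [[t tC nt]|alltouch] := classic (exists2 t, t \in C3 & ~ touch t); last first.
  exfalso.
  have sC3K := subset_trans sC3L3 sL3K.
  have apD1 : apart c1 n1 C3.
    move=> t i tC lti; have tL3 := subsetP sC3L3 _ tC.
    have [h1 h2] := lk_cL lk1 (subsetP sL2L1 _ (subsetP sL3L2 _ tL3)) lti; split=> //.
    case: (classic (c1 i = F1 true (len1 true))) => E; last exact: h2.
    have [_ _ _ na _] := lk_chain lk2 true; rewrite E -/z1 -(F20 true).
    by apply: na; [have := wl2 true; lia|apply: (subsetP sL3L2)].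
  have apD2 : apart c2 n2 C3.
    move=> t i tC lti; have tL3 := subsetP sC3L3 _ tC.
    have [h1 h2] := lk_cL lk2 (subsetP sL3L2 _ tL3) lti; split=> //.
    case: (classic (c2 i = F2 true (len2 true))) => E; last exact: h2.
    have [_ _ _ na _] := lk_chain lk3 true; rewrite E -/z2 -(F30 true).
    by apply: na => //; have := wl3 true; lia.
  have apD3 : apart c3 n3 C3 by move=> t i; apply: (lk_cC lk3).
  pose tD c n t := exists2 i, i < n & e (par t) (c i).
  have cD c n C : hole c n -> apart c n C -> C \subset K -> col (sel C (tD c n)) 1075.
    move=> Hc ap sC; apply: (@leg_col c n _ par Hc (apartS (sel_sub _ _) ap)).
    by move=> t /selP[/(subsetP sC) /parK[_ et _] h].
  have m1 := @ncol_drop C3 (tD c1 n1) (1082 + 1075 + 1075) 1075 (lk_ncol lk3)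
     (cD _ _ _ (lk_hole lk1) apD1 sC3K).
  set C4 := sel C3 _ in m1.
  have sC43 : C4 \subset C3 := sel_sub _ _.
  have m2 := @ncol_drop C4 (tD c2 n2) (1082 + 1075) 1075 m1
     (cD _ _ _ (lk_hole lk2) (apartS sC43 apD2) (subset_trans sC43 sC3K)).
  set C5 := sel C4 _ in m2.
  have sC53 : C5 \subset C3 := subset_trans (sel_sub _ _) sC43.
  have m3 := @ncol_drop C5 (tD c3 n3) 1082 1075 m2
     (cD _ _ _ (lk_hole lk3) (apartS sC53 apD3) (subset_trans sC53 sC3K)).
  set C6 := sel C5 _ in m3.
  have sC63 : C6 \subset C3 := subset_trans (sel_sub _ _) sC53.
  have sC6K : C6 \subset K := subset_trans sC63 sC3K.
  have nD1 t i : t \in C6 -> i < n1 -> ~~ e (par t) (c1 i).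
    by move=> /selP[/selP[/selP[_ h] _] _] lti; apply/negP=> ei; apply: h; exists i.
  have nD2 t i : t \in C6 -> i < n2 -> ~~ e (par t) (c2 i).
    by move=> /selP[/selP[_ h] _] lti; apply/negP=> ei; apply: h; exists i.
  have nD3 t i : t \in C6 -> i < n3 -> ~~ e (par t) (c3 i).
    by move=> /selP[_ h] lti; apply/negP=> ei; apply: h; exists i.
  pose l12 := len1 true + len2 true.
  pose gg b := g3 true true b.
  have ggw b i : i <= l12 + w3 -> gg b i = gg true i.
    move=> le; case: (leqP i l12) => h; first by rewrite /gg /g3 !pglueL.
    by rewrite /gg -(subnKC (ltnW h)) !g33; apply: (lk_common lk3); lia.
  (* A contact on an arc is a contact with one of the three holes. The remaining contacts lie on
     parts common to both branches, so they all appear on the single route [gg true]. *)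
  have tch t : t \in C6 -> exists y, 0 < y < l12 + w3 /\ e (par t) (gg true y).
    move=> tC; have tr : touch t by apply: NNPP => nt; apply: alltouch; exists t => //; apply: (subsetP sC63).
    case: tr => [[b [i [hi ei]]]|[[b [i [hi ei]]]|[b [i [hi ei]]]]].
    - case: (leqP w1 i) => h.
        have [|k ltk Ek] := lk_arc lk1 (b := b) (i := i); first lia.
        by have := nD1 t k tC ltk; rewrite -Ek ei.
      have lt := wl1 true; exists i; split; first by rewrite /l12; lia.
      by rewrite /gg g31; [rewrite -(lk_common lk1 b) // ltnW|lia].
    - case: (leqP w2 i) => h.
        have [|k ltk Ek] := lk_arc lk2 (b := b) (i := i); first lia.
        by have := nD2 t k tC ltk; rewrite -Ek ei.
      have lt := wl2 true; exists (len1 true + i); split; first by rewrite /l12; lia.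
      by rewrite /gg g32; [rewrite -(lk_common lk2 b) // ltnW|lia].
    - case: (leqP w3 i) => h.
        have [|k ltk Ek] := lk_arc lk3 (b := b) (i := i); first lia.
        by have := nD3 t k tC ltk; rewrite -Ek ei.
      exists (l12 + i); split; first by lia.
      by rewrite /gg g33 -(lk_common lk3 b) // ltnW.
  have tmax t : t \in C6 -> exists y, (0 < y < l12 + w3 /\ e (par t) (gg true y)) /\
      forall i, y < i -> ~ (0 < i < l12 + w3 /\ e (par t) (gg true i)).
    move=> tC; apply: (@max_nat (fun y => 0 < y < l12 + w3 /\ e (par t) (gg true y)) (l12 + w3)).
      exact: tch.
    by move=> y []; lia.
  have [ym ymP] := choose_fun 0 tmax.
  have [t0 t0C] := ncol_ex m3.
  (* With [ts] chosen so that its last contact is earliest, the hole through [par ts] starting at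
     this contact contains the last contact of every other parent. *)
  have [|y [[ts [tsC Ey]] my]] := @min_nat (fun y => exists t, t \in C6 /\ ym t = y).
    by exists (ym t0), t0.
  have tsK := subsetP sC6K _ tsC.
  have [[hy ey] lasty] := ymP ts tsC; rewrite Ey in hy ey lasty.
  have noD b i : l12 + w3 <= i <= l12 + len3 b -> ~~ e (par ts) (gg b i).
    move=> hi; have [|k ltk Ek] := lk_arc lk3 (b := b) (i := i - l12); first lia.
    rewrite (_ : i = l12 + (i - l12)) /gg ?g33 ?Ek; last lia.
    exact: nD3.
  have [_ cL3 _ _ exz4] := lk_chain lk3 true.
  have [|T [k [gT TL Tz Tp]]] := @tail L3 z3 (par ts) cL3 exz4.
    by exists ts; [apply/(subsetP sC3L3)/(subsetP sC63)|have [_ ? _] := parK ts tsK].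
  have HT := geod_ipath gT.
  have [b hb] : exists b, odd (l12 + len3 b - y + k).+1.
    have := lk_par lk3; have := wl3 true; have := wl3 false.
    case: (boolP (odd (l12 + len3 true - y + k).+1)) => h; first by exists true.
    by exists false; lia.
  have lt3 := wl3 b.
  set l := l12 + len3 b in hb.
  have [Hgg _ ggL ggna _] := ch3 true true b.
  rewrite -/l12 -/l -/(gg b) in Hgg ggL ggna.
  pose f := pjoin (gg b) l T.
  have Hf : ipath f (l + k).+1.
    by apply: chain_pjoin (ch3 true true b) HT TL _ => i le; rewrite /l g3end Tz.
  have Hf' := @ipath_sub f (l + k).+1 y (l - y + k).+1 Hf ltac:(rewrite /l; lia).
  have fK i : 0 < i <= (l + k).+1 -> f i \in K.
    move=> hi; rewrite /f /pjoin; case: leqP => h; first by apply: g3K; lia.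
    by apply/(subsetP sL3K)/TL; lia.
  have HH : hole (pjoin (fun i => f (y + i)) (l - y + k).+1 (fun=> par ts)) ((l - y + k).+1 + 0).+2.
    apply: pjoin_hole => //; try lia.
    - by move=> i i'; lia.
    - rewrite eC /f /pjoin leqNgt (_ : l < _) /=; last by rewrite /l; lia.
      by rewrite (_ : y + _ - _ = k) ?Tp ?eqxx //; rewrite /l; lia.
    - rewrite addn0 /f /pjoin (_ : y <= l) /=; last by rewrite /l; lia.
      by rewrite ggw //; lia.
    - move=> i i' hi hi'; split; first by apply: parnK => //; apply: fK; lia.
      rewrite eC /f /pjoin; case: leqP => h.
        case: (ltnP (y + i) (l12 + w3)) => h' ei.
          rewrite ggw in ei; last lia.
          case: (posnP i) => i0; first by right; lia.
          by case: (lasty (y + i)); [lia|split=> //; lia].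
        by have := noD b (y + i); rewrite ei; move/(_ ltac:(rewrite /l in h; lia)).
      by rewrite Tp; lia.
  pose near v := exists i, i <= k /\ (v = T i \/ e v (T i)).
  pose NT := sel L3 near.
  have m4 : ~ col (C6 :\: (NT :|: nb (par ts))) 1075.
    by apply: (@ncolD _ _ 1075 7) m3 _; apply: (colU (geod_nbhd_col gT) (nb_col _)).
  apply: m4; apply: (@leg_col _ _ _ par HH).
    move=> t i /setDP[tC]; rewrite in_setU negb_or => /andP[h1]; rewrite inE => h2 lti.
    have tC3 := subsetP sC63 _ tC; have tL3 := subsetP sC3L3 _ tC3.
    have nn i' : i' <= k -> T i' <> t /\ ~~ e (T i') t.
      move=> le; split=> [E|].
        by case/negP: h1; apply/selP; split=> //; exists i'; split=> //; left.
      apply/negP=> ei; case/negP: h1; apply/selP; split=> //; exists i'; split=> //; right.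
      by rewrite eC.
    rewrite /pjoin; case: leqP => hi; last first.
      by split=> //; apply/nesym/parnK => //; apply: (subsetP sC6K).
    rewrite /f /pjoin; case: leqP => h; last by apply: nn; lia.
    split; first by move=> E; have := ggL _ h; rewrite E tL3.
    case: (leqP (y + i) l12) => h'.
      by apply: ggna => //; lia.
    rewrite /gg -(subnKC (ltnW h')) g33; apply: (lk_sepC lk3) => //; rewrite /l in h; lia.
  move=> t /setDP[tC _]; have tK := subsetP sC6K _ tC.
  split; first by have [] := parK t tK.
  have [[hyt eyt] _] := ymP t tC.
  have le : y <= ym t by rewrite leqNgt; apply/negP=> /my; apply; exists t.
  exists (ym t - y); first by rewrite /l; lia.
  rewrite /pjoin (_ : ym t - y <= _) /=; last by rewrite /l; lia.
  rewrite subnKC // /f /pjoin (_ : ym t <= l) /=; last by rewrite /l; lia.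
  by rewrite ggw //; lia.
(* The rope is closed through the levels below j - 1. *)
have tL3 := subsetP sC3L3 _ tC; have tK := subsetP sL3K _ tL3.
have [pS ept dpt] := parK t tK.
have [_ cL3 _ _ exz4] := lk_chain lk3 true.
have [|T [k [gT TL Tz Tp]]] := @tail L3 z3 (par t) cL3 exz4; first by exists t.
have HT := geod_ipath gT.
pose B := [set v in S | dd v <= j - 2].
have cB : conn B by apply: ball_conn d0 dp.
have [pq0S _ dpq0] := dp q0 q0S ltac:(lia).
have e1 : e q0 (par q0) by have [] := dp q0 q0S ltac:(lia).
have [ppS e2 dpp] := dp (par t) pS ltac:(lia).
pose S' := B :|: [set q0; par t].
have cS' : conn S'.
  apply: conn_star => // v /set2P[->|->].
    by exists (par q0) => //; rewrite inE pq0S; lia.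
  by exists (par (par t)) => //; rewrite inE ppS; lia.
have [||||R [k' [gR R0 Rk _ _]]] := @shortest_path S' [set q0] [set par t] cS'.
- by apply/subsetP=> v /set1P->; rewrite !inE eqxx !orbT.
- by apply/subsetP=> v /set1P->; rewrite !inE eqxx !orbT.
- by exists q0; rewrite inE.
- by exists (par t); rewrite inE.
move: R0 Rk => /set1P R0 /set1P Rk.
have HR := geod_ipath gR; have [RS _] := gR.
have q0t : q0 <> par t.
  move=> E; have [_ _ _ na _] := ch3 true true true.
  have := na 0 t ltac:(have := wl1 true; lia) tL3.
  by rewrite g30 E ept.
have k'0 : 0 < k' by rewrite lt0n; apply/eqP=> E; apply: q0t; rewrite -R0 -Rk E.
have RB i : 0 < i < k' -> R i \in B.
  move=> hi; have := RS i ltac:(lia); rewrite in_setU => /orP[//|/set2P[E|E]].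
    have := @ipath_inj R k' i 0 HR ltac:(lia) ltac:(lia); rewrite R0 => /(_ E); lia.
  have := @ipath_inj R k' i k' HR ltac:(lia) ltac:(lia); rewrite Rk => /(_ E); lia.
have q0B v : v \in B -> v \in S /\ dd v <= j - 2 by rewrite inE => /andP[].
have close b1 b2 : exists b3 c n, [/\ hole c n, forall i, i < n -> c i \in S,
    len1 b1 + len2 b2 + len3 b3 < n & forall i, i <= len1 b1 + len2 b2 + len3 b3 -> c i = g3 b1 b2 b3 i].
  have [b3 hb] : exists b3, odd ((len1 b1 + len2 b2 + len3 b3 + k).+1 + k'.-1).
    have := lk_par lk3; case: (boolP (odd ((len1 b1 + len2 b2 + len3 true + k).+1 + k'.-1))) => h; first by exists true.
    by exists false; lia.
  set l := len1 b1 + len2 b2 + len3 b3 in hb *.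
  pose f := pjoin (g3 b1 b2 b3) l T.
  have Hf : ipath f (l + k).+1.
    by apply: chain_pjoin (ch3 b1 b2 b3) HT TL _ => i le; rewrite /l g3end Tz.
  have fK i : 0 < i <= (l + k).+1 -> f i \in K.
    move=> hi; rewrite /f /pjoin; case: leqP => h; first by apply: g3K; lia.
    by apply/(subsetP sL3K)/TL; lia.
  have f0 : f 0 = q0 by rewrite /f /pjoin /= g30.
  exists b3, (pjoin f (l + k).+1 (fun i => R (k' - i))), ((l + k).+1 + k'.-1).+2; split.
  - apply: pjoin_hole => //; try lia.
    + by move=> i i' h1 h2; apply: (ipath_rev HR) => //; lia.
    + rewrite subn0 Rk eC /f /pjoin leqNgt (_ : l < _) /=; last lia.
      by rewrite (_ : _ - _ = k) ?Tp ?eqxx //; lia.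
    + rewrite f0 -R0 (_ : k' - k'.-1 = 1); last lia.
      by rewrite eC; apply: ipath_step HR _.
    + move=> i i' hi hi'; case: (posnP i) => [->|i0].
        rewrite f0 -R0; split.
          by move=> E; have := @ipath_inj R k' 0 (k' - i') HR ltac:(lia) ltac:(lia) E; lia.
        by rewrite (ipathE HR); lia.
      have [fS df] := KP _ (fK i ltac:(lia)).
      case: (posnP i') => [->|i'0].
        rewrite subn0 Rk; split; first by apply: parnK tK _ (fK i ltac:(lia)).
        rewrite eC /f /pjoin; case: leqP => h.
          move=> ei; case: nt; have [|[h' E]|[q hq [_ E]]|[q hq [_ E]]] := g3cases b1 b2 b3 i.
          * by rewrite i0.
          * by left; exists b1, i; rewrite -E.
          * by right; left; exists b2, q; rewrite -E.
          * by right; right; exists b3, q; rewrite -E.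
        by rewrite Tp; lia.
      have [RiS dRi] := q0B _ (RB (k' - i') ltac:(lia)).
      split; first by move=> E; move: df; rewrite E; lia.
      by move=> ei; have := lev_e dl fS RiS ei; rewrite df; lia.
  - move=> i lti; rewrite /pjoin; case: leqP => h.
      case: (posnP i) => [->|i0]; first by rewrite f0.
      by have [] := KP _ (fK i ltac:(lia)).
    have : R (k' - (i - (l + k).+2)) \in S' by apply: RS; lia.
    by rewrite in_setU => /orP[/q0B[]//|/set2P[->|->]].
  - by lia.
  - by move=> i le; rewrite /pjoin (_ : i <= (l + k).+1) /f /pjoin ?le //; lia.
pose o i := match i with 0 => P1 x1 | 1 => P1 x1' | 2 => P2 x2 | 3 => P2 x2' | 4 => P3 x3 | _ => P3 x3' end.
have o1L : (P1 x1 \in K) /\ (P1 x1' \in K) by split; apply: (st_PL st1); lia.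
have o2L : (P2 x2 \in L1) /\ (P2 x2' \in L1) by split; apply: (st_PL st2); lia.
have o3L : (P3 x3 \in L2) /\ (P3 x3' \in L2) by split; apply: (st_PL st3); lia.
have cf1 v : v \in L1 -> v \notin conf (P1 x1) /\ v \notin conf (P1 x1').
  by move=> /(subsetP sL1M1); apply: (st_conf' st1).
have cf2 v : v \in L2 -> v \notin conf (P2 x2) /\ v \notin conf (P2 x2').
  by move=> /(subsetP sL2M2); apply: (st_conf' st2).
exists o; split.
- move=> i _; apply/(subsetP sSH); suff : o i \in K by move/KP=> [].
  have := subsetP sL1K; have := subsetP sL2K => s2 s1.
  by case: i => [|[|[|[|[|i]]]]] /=; [case: o1L|case: o1L|apply: s1; case: o2L|apply: s1; case: o2L|
    apply: s2; case: o3L|apply: s2; case: o3L].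
- have [a1 a2] := cf1 _ o2L.1; have [a3 a4] := cf1 _ o2L.2.
  have [a5 a6] := cf1 _ (subsetP sL2L1 _ o3L.1); have [a7 a8] := cf1 _ (subsetP sL2L1 _ o3L.2).
  have [b1 b2] := cf2 _ o3L.1; have [b3 b4] := cf2 _ o3L.2.
  have [d1 d2 d3] := And3 (st_conf st1) (st_conf st2) (st_conf st3).
  by move=> [|[|[|[|[|[|i]]]]]] [|[|[|[|[|[|i']]]]]] //=.
pose Bs i := match i with 0 => odd x1 | 1 => odd x1' | 2 => odd x2 | 3 => odd x2' | 4 => odd x3 | _ => odd x3' end.
pose X b1 b2 i := match i with 0 => x1 | 1 => x1' | 2 => len1 b1 + x2 | 3 => len1 b1 + x2'
   | 4 => len1 b1 + len2 b2 + x3 | _ => len1 b1 + len2 b2 + x3' end.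
have Xle b1 b2 b3 i : X b1 b2 i <= len1 b1 + len2 b2 + len3 b3.
  have l1 := wl1 b1; have l2 := wl2 b2; have l3 := wl3 b3.
  by rewrite /X; clear -hx1 hx1' hx2 hx2' hx3 hx3' pw1 pw2 pw3 l1 l2 l3; case: i => [|[|[|[|[|i]]]]]; lia.
have Xlt b1 b2 i i' : i < i' -> i' < 6 -> X b1 b2 i < X b1 b2 i'.
  have l1 := wl1 b1; have l2 := wl2 b2.
  rewrite /X; clear -hx1 hx1' hx2 hx2' hx3 hx3' pw1 pw2 pw3 l1 l2.
  by move: i i' => [|[|[|[|[|[|i]]]]]] [|[|[|[|[|[|i']]]]]] //= _ _; lia.
have oX b1 b2 i : i < 6 -> odd (X b1 b2 i) = Bs i (+) ((1 < i) && odd (len1 b1)) (+) ((3 < i) && odd (len2 b2)).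
  rewrite /X /Bs; clear.
  by move: i => [|[|[|[|[|[|i]]]]]] //= _; lia.
have gX b1 b2 b3 i : i < 6 -> g3 b1 b2 b3 (X b1 b2 i) = o i.
  have l1 := wl1 b1; have l2 := wl2 b2; have l3 := wl3 b3.
  rewrite /X /o; case: i => [|[|[|[|[|[|i]]]]]] // _.
  - by rewrite g31 ?F1P //; lia.
  - by rewrite g31 ?F1P //; lia.
  - by rewrite g32 ?F2P //; lia.
  - by rewrite g32 ?F2P //; lia.
  - by rewrite g33 ?F3P //; lia.
  - by rewrite g33 ?F3P //; lia.
have BE i : ~~ odd i && (i < 5) -> Bs i.+1 = ~~ Bs i.
  by case: i => [|[|[|[|[|i]]]]] h; try (by move: h; rewrite ?andbF); [exact: st_odd st1|exact: st_odd st2|exact: st_odd st3].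
clearbody o X Bs.
move=> cls; have [a [b [d [ab bd d6 cab cbd]]]] := mono_triple cls.
have [b1 [b2 []]] := @triple_parity Bs (fun b => odd (len1 b)) (fun b => odd (len2 b)) a b d
    (lk_par lk1) (lk_par lk2) (BE 0 isT) (BE 2 isT) (BE 4 isT) ab bd d6.
have a6 := ltn_trans (ltn_trans ab bd) d6; have b6 := ltn_trans bd d6.
rewrite -!oX // => pab pbd.
have [b3 [c [n [Hc cS1 ltn Ec]]]] := close b1 b2.
have cX i : i < 6 -> c (X b1 b2 i) = o i by move=> i6; rewrite Ec ?(gX b1 b2 b3).
exists c, n, (X b1 b2), a, b, d; split=> //.
- by move=> i /cS1 /(subsetP sSH).
- split; [exact: Xlt|exact: Xlt|exact: leq_ltn_trans (Xle b1 b2 b3 d) ltn].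
- by rewrite !cX.
Qed.

(** * A small connected set through six vertices *)

Lemma not_conn_split S : ~ conn S -> exists A, [/\ A \subset S, exists x, x \in A,
  exists2 y, y \in S & y \notin A &
  forall u v, u \in A -> v \in S -> e u v -> v \in A].
Proof.
move=> nc; apply: NNPP => nE; apply: nc => P [x xS Px] Pst y yS; apply: NNPP => nPy.
apply: nE; exists (sel S P); split.
- exact: sel_sub.
- by exists x; apply/selP.
- by exists y => //; apply/negP=> /selP[].
- by move=> u v /selP[uS Pu] vS euv; apply/selP; split=> //; apply: Pst Pu.
Qed.

Lemma hole_minus_conn c n i : hole c n -> i < n ->
  conn [set v | [exists j : 'I_n, (j != i :> nat) && (c j == v)]].
Proof.
move=> H lti; have n7 := hole_ge7 H.
have -> : [set v | [exists j : 'I_n, (j != i :> nat) && (c j == v)]] =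
   pset (fun k => c ((k + i.+1) %% n)) (n - 2).
  apply/setP=> v; rewrite inE; apply/existsP/psetP => [[j /andP[/eqP ji /eqP<-]]|[k hk <-]].
    have ltj := ltn_ord j; case: (ltnP i j) => hij.
      exists (j - i.+1); first lia.
      by rewrite subnK // modn_small.
    exists (j + n - i.+1); first lia.
    by rewrite subnK ?modnDr ?modn_small //; lia.
  have lt : (k + i.+1) %% n < n by rewrite ltn_pmod //; lia.
  exists (Ordinal lt) => /=; rewrite eqxx andbT.
  case: (ltnP (k + i.+1) n) => h; first by rewrite modn_small //; lia.
  have -> : k + i.+1 = n + (k + i.+1 - n) by lia.
  by rewrite modnDl modn_small; lia.
by apply: conn_ipath; apply: (hole_ipath (hole_rot i.+1 H)); lia.
Qed.

(* In a minimal such J every vertex of an odd hole is a terminal or separates a terminal from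
   the hole, and these terminals are distinct; but odd holes have at least 7 vertices. *)
Lemma steiner B (xo : nat -> G) : conn B -> (forall i, i < 6 -> xo i \in B) ->
  exists J, [/\ J \subset B, conn J, forall i, i < 6 -> xo i \in J & col J 2].
Proof.
move=> cB xB.
have [|J [[sJ cJ xJ] mJ]] := @min_set _ (fun J : {set G} =>
    [/\ J \subset B, conn J & forall i, i < 6 -> xo i \in J]); first by exists B.
exists J; split=> //; apply: NNPP => /ncol2_hole[c [n [H cJn]]].
have n7 := hole_ge7 H.
pose Tm := [set xo i | i : 'I_6].
have xT i : i < 6 -> xo i \in Tm by move=> lt; apply/imsetP; exists (Ordinal lt).
have TmJ v : v \in Tm -> v \in J by move=> /imsetP[i _ ->]; apply: xJ.
have side i : i < n -> c i \notin Tm -> exists A, [/\ A \subset J, c i \notin A,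
    forall k, k < n -> c k \notin A, forall u v, u \in A -> v \in J -> e u v -> v \in A \/ v = c i &
    exists2 x, x \in A & x \in Tm].
  move=> lti nT.
  have ncJ : ~ conn (J :\ c i).
    move=> cJ'; apply: (mJ (J :\ c i)); first by apply: properD1; apply: cJn.
    split=> //; first by apply: subset_trans sJ; apply: subsetDl.
    move=> k ltk; rewrite !inE xJ // andbT; apply: contraNneq nT => <-; exact: xT.
  have [A0 [sA0 [a0 a0A] [b0 b0J b0A] clA0]] := not_conn_split ncJ.
  pose Hi := [set v | [exists k : 'I_n, (k != i :> nat) && (c k == v)]].
  have cH := hole_minus_conn H lti; rewrite -/Hi in cH.
  have HiP k : k < n -> k != i -> c k \in Hi.
    by move=> ltk ki; rewrite inE; apply/existsP; exists (Ordinal ltk); rewrite /= ki eqxx.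
  have HiJ v : v \in Hi -> v \in J :\ c i.
    rewrite inE => /existsP[k /andP[ki /eqP<-]]; rewrite !inE cJn // andbT.
    by apply/eqP=> E; have := hole_inj H (ltn_ord k) lti E => E'; rewrite E' eqxx in ki.
  (* The rest of the hole is connected and lies on one side of the cut; [A] is the other side. *)
  have [A [sA [a aA] clA nH]] : exists A, [/\ A \subset J :\ c i, exists a, a \in A,
      forall u v, u \in A -> v \in J :\ c i -> e u v -> v \in A & forall v, v \in Hi -> v \notin A].
    case: (classic (exists2 v, v \in Hi & v \in A0)) => [[v vH vA]|nE]; last first.
      exists A0; split=> //; first by exists a0.
      by move=> v vH; apply/negP=> vA; apply: nE; exists v.
    have allA : forall w, w \in Hi -> w \in A0.
      apply: (cH (fun w => w \in A0)); first by exists v.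
      by move=> x y xH yH exy xA; apply: clA0 xA (HiJ _ yH) exy.
    exists ((J :\ c i) :\: A0); split.
    - exact: subsetDl.
    - by exists b0; rewrite inE b0A.
    - move=> u w; rewrite inE => /andP[uA uJ] wJ euw; rewrite inE wJ andbT.
      by apply: contra uA => wA; apply: clA0 wA uJ _; rewrite eC.
    - by move=> w wH; rewrite inE allA.
  have AJ v : v \in A -> v \in J /\ v != c i by move/(subsetP sA); rewrite !inE => /andP[].
  have ciA : c i \notin A by apply/negP=> /AJ[_]; rewrite eqxx.
  have nb u v : u \in A -> v \in J -> e u v -> v \in A \/ v = c i.
    move=> uA vJ euv; case: (v =P c i) => [|/eqP ne]; first by right.
    by left; apply: clA uA _ euv; rewrite !inE ne.
  exists A; split=> //.
  - by apply/subsetP=> v /AJ[].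
  - by move=> k ltk; case: (k =P i) => [->//|/eqP ki]; apply/nH/HiP.
  (* [A] is attached to the rest of [J] only at [c i], so without a terminal in it, [A] could be
     deleted from [J]. *)
  apply: NNPP => nE; apply: (mJ (J :\: A)).
    apply/properP; split; first exact: subsetDl.
    by have [aJ _] := AJ a aA; exists a; rewrite // inE aA.
  split.
  - by apply: subset_trans sJ; apply: subsetDl.
  - move=> P [x]; rewrite inE => /andP[xA xJ'] Px Pst.
    have ciJ : c i \in J :\: A by rewrite inE ciA cJn.
    have all : forall v, v \in J -> if v \in A then P (c i) else P v.
      apply: (cJ (fun v => if v \in A then P (c i) else P v)); first by exists x; rewrite // (negbTE xA).
      move=> u v uJ vJ euv; case: (boolP (u \in A)) => uA; case: (boolP (v \in A)) => vA // Pu.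
      + by case: (nb u v uA vJ euv) => [vA'|->//]; rewrite vA' in vA.
      + case: (nb v u vA uJ) => [|uA'|<- //]; first by rewrite eC.
        by rewrite uA' in uA.
      + by apply: Pst Pu; rewrite ?inE ?uA ?vA.
    by move=> v; rewrite inE => /andP[vA vJ]; have := all v vJ; rewrite (negbTE vA).
  - move=> k ltk; rewrite inE xJ // andbT; apply/negP=> xA.
    by apply: nE; exists (xo k) => //; apply: xT.
have ext (i : 'I_n) : True -> exists t, t \in Tm /\ (t = c i \/ c i \notin Tm /\ exists A, [/\ A \subset J, t \in A,
    forall k, k < n -> c k \notin A & forall u v, u \in A -> v \in J -> e u v -> v \in A \/ v = c i]).
  move=> _; case: (boolP (c i \in Tm)) => h; first by exists (c i); split=> //; left.
  have [A [sA _ nA clA [t tA tT]]] := side i (ltn_ord i) h.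
  by exists t; split=> //; right; split=> //; exists A.
have [ta taP] := choose_fun (c 0) ext.
have inj : injective ta.
  move=> i i' E; apply/val_inj => /=; apply: NNPP => ne.
  have [tT Hi] := taP i I; have [tT' Hi'] := taP i' I; rewrite -E in tT' Hi'.
  have cne : c i <> c i' by move/(hole_inj H (ltn_ord i) (ltn_ord i')).
  case: Hi => [Et|[ni [A [sA tA nA clA]]]]; case: Hi' => [Et'|[ni' [A' [sA' tA' nA' clA']]]].
  - by apply: cne; rewrite -Et -Et'.
  - by have := nA' i (ltn_ord i); rewrite -Et tA'.
  - by have := nA i' (ltn_ord i'); rewrite -Et' tA.
  (* If one terminal is behind both [c i] and [c i'], the intersection of the two sides is closed
     under adjacency in [J] and would contain the hole. *)
  have all : forall v, v \in J -> v \in A :&: A'.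
    apply: cJ; first by exists (ta i); [apply: (subsetP sA)|rewrite inE tA].
    move=> u v uJ vJ euv; rewrite !inE => /andP[uA uA'].
    case: (clA u v uA vJ euv) => [vA|Ev]; case: (clA' u v uA' vJ euv) => [vA'|Ev'].
    - by rewrite vA.
    - by have := nA i' (ltn_ord i'); rewrite -Ev' vA.
    - by have := nA' i (ltn_ord i); rewrite -Ev vA'.
    - by case: cne; rewrite -Ev -Ev'.
  by have := all _ (cJn i (ltn_ord i)); rewrite inE (negbTE (nA i (ltn_ord i))).
have c1 : #|Tm| <= 6 by apply: leq_trans (leq_imset_card _ _) _; rewrite card_ord.
have c2 : n <= #|Tm|.
  rewrite -[X in X <= _]card_ord -(card_codom inj); apply: subset_leq_card.
  by apply/subsetP=> v /codomP[i ->]; have [] := taP i I.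
lia.
Qed.

(** * Parents and grandparents of the marks *)

Section Levels.
Variables (S : {set G}) (z : G) (d : G -> nat) (par : G -> G).
Hypotheses (d0 : forall v, v \in S -> (d v = 0 <-> v \in [set z]))
  (dp : forall v, v \in S -> 0 < d v -> [/\ par v \in S, e v (par v) & d v = (d (par v)).+1])
  (dl : forall u v, u \in S -> v \in S -> e u v -> d u <= (d v).+1).

Variable j : nat.
Hypothesis j3 : 2 < j.
Let N := [set v in S | d v == j].
Let p t := par t.
Let x t := par (par t).

Lemma parP t : t \in N -> [/\ p t \in S, x t \in S, e (p t) t, e (x t) (p t) & d (p t) = j.-1 /\ d (x t) = j.-2].
Proof.
move=> /setIdP[tS /eqP dt]; have [|pS ep dpt] := dp tS; first lia.
have [|xS ex dx] := dp pS; first lia.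
by split=> //; rewrite 1?eC //; rewrite /p /x; lia.
Qed.

Lemma far_levels u v : u \in S -> v \in S -> (d u).+1 < d v -> ~~ e v u.
Proof. by move=> uS vS lt; apply/negP=> /(dl vS uS); lia. Qed.

(* o' is in conflict with o if the paths o - p o - x o and o' - p o' - x o' are joined by an
   edge incident with p o or p o'. *)
Definition conflict v : {set G} :=
  if v \in N then sel N (fun t => [|| e (p t) (p v), e (p t) (x v) | e (x t) (p v)]) else set0.

(** One colour for the neighbours of [p v], and 4 for each of the three kinds of conflict. If [x t]
    sees [p v], the hub consists of [p v] and its neighbours in level [j.-2]; in the other two kinds
    the legs are attached to the single vertex [p v] or [x v]. *)
Lemma conflict_col v : col (conflict v) 13.
Proof.
rewrite /conflict; case: ifP => vN; last exact: colS (sub0set _) _ col0.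
have [pvS xvS epv exv [dpv dxv]] := parP vN.
have NS t : t \in N -> t \in S /\ d t = j by move=> /setIdP[? /eqP].
apply: (@col_cases _ (fun t => ~ e (p v) t) (fun t => e (p v) t) 12 1).
- by move=> t _; case: e; [right|left].
- apply: (@col_cases _ (fun t => ~ e (p t) (p v)) (fun t => e (p t) (p v)) 8 4).
  + by move=> t _; case: e; [right|left].
  + apply: (@col_cases _ (fun t => e (x t) (p v)) (fun t => e (p t) (x v)) 4 4).
    * by move=> t /selP[/selP[/selP[_ /or3P[h|h|h]] _] np] //; [right|left].
    * apply: (@hub_leg_col ([set p v] :|: [set y in S | (d y == j.-2) && e (p v) y]) (fun y => y != p v)).
      - by apply: conn_star (conn1 (x := p v)) _ => t; rewrite inE => /and3P[_ _ et]; exists (p v); rewrite ?inE // eC.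
      - move=> y y'; rewrite !inE => /orP[/eqP->|/and3P[_ _ ey]] /orP[/eqP->|/and3P[_ _ ey']] eyy'.
        + by rewrite eI in eyy'.
        + by rewrite eqxx /=; case: (y' =P p v) => // E; rewrite E eI in eyy'.
        + by rewrite eqxx /=; case: (y =P p v) => // E; rewrite E eI in eyy'.
        + by have := no_triangle ey eyy'; rewrite ey'.
      - move=> t /selP[/selP[/selP[/selP[tN _] _] _] _]; have [tS dt] := NS t tN.
        by rewrite !inE tS dt; apply/negP=> /orP[/eqP E|/and3P[_ /eqP h _]]; [move: dt; rewrite E|]; lia.
      - move=> t y /selP[/selP[/selP[/selP[tN _] /negP npt] _] _]; have [tS dt] := NS t tN.
        rewrite !inE => /orP[/eqP->//|/and3P[yS /eqP dy _]].
        by rewrite eC; apply: far_levels => //; lia.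
      - move=> t /selP[/selP[/selP[/selP[tN _] _] /negP nep] ext].
        have [ptS xtS ept ext' [dpt dxt]] := parP tN; exists (p t); split=> //.
          exists (x t); split=> //; first by rewrite !inE xtS dxt eqxx [e (p v) _]eC ext orbT.
          by apply/eqP=> E; move: dxt; rewrite E; lia.
        by move=> y; rewrite negbK => _ /eqP->; rewrite eC.
    * apply: (@vertex_leg_col (x v)) => t /selP[/selP[/selP[/selP[tN _] _] _] ext]; have [tS dt] := NS t tN.
        split; first by move=> E; move: dt; rewrite -E; lia.
        by rewrite eC; apply: far_levels => //; lia.
      by exists (p t); have [_ _ ept _ _] := parP tN; rewrite [e (x v) _]eC.
  + apply: (@vertex_leg_col (p v)) => t /selP[/selP[/selP[tN _] /negP npt] ext]; have [tS dt] := NS t tN.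
      by split=> // E; move: dt; rewrite -E; lia.
    by exists (p t); have [_ _ ept _ _] := parP tN; rewrite [e (p v) _]eC.
- by apply: colS (nb_col (p v)) => //; apply/subsetP=> t /selP[_ h]; rewrite inE.
Qed.

(** The hub is [J] with the parents of three marks whose grandparents have one colour. [J] is at
    least two levels away from the rope, while the three parents touch it at indices of alternating
    parity. The absence of conflicts makes the parents nonadjacent and attached to one class of [J]
    only, so the hub is bipartite. *)
Lemma level_rope_col : z \in S -> col N (rope_col 13).
Proof.
move=> zS; apply: NNPP => nN.
have [o [oN oc rp]] := rope conflict_col nN.
pose B0 := [set v in S | d v <= j - 3].
pose B := B0 :|: [set x (o i) | i : 'I_6].
have oP i : i < 6 -> [/\ p (o i) \in S, x (o i) \in S, e (p (o i)) (o i), e (x (o i)) (p (o i)) &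
    d (p (o i)) = j.-1 /\ d (x (o i)) = j.-2] by move=> /oN; apply: parP.
have cB : conn B.
  apply: conn_star; first exact: ball_conn d0 dp.
  move=> t /imsetP[i _ ->]; have [_ xS _ _ [_ dx]] := oP i (ltn_ord i).
  have [|qS eq dq] := dp xS; first lia.
  by exists (par (x (o i))); rewrite // inE qS; lia.
have [J [sJ cJ xJ [f [f2 fp]]]] := @steiner B (fun i => x (o i)) cB
    (fun i lt => ltac:(by rewrite !inE; apply/orP; right; apply/imsetP; exists (Ordinal lt))).
have [c [n [X [a [b [dd [Hc cN [ab bd d6 cab cbd] [Xab Xbd Xn] [oab obd [ca cb cd]]]]]]]]] := rp (fun i => f (x (o i)) == 0).
have JS v : v \in J -> v \in S /\ d v <= j.-2.
  move/(subsetP sJ); rewrite in_setU => /orP[/setIdP[vS le]|/imsetP[i _ ->]]; first by split=> //; lia.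
  by have [_ xS _ _ [_ ->]] := oP i (ltn_ord i).
have NS t : t \in N -> t \in S /\ d t = j by move=> /setIdP[? /eqP].
have nconf i k : i < 6 -> k < 6 -> i != k ->
    [/\ ~~ e (p (o i)) (p (o k)), ~~ e (p (o i)) (x (o k)) & ~~ e (x (o i)) (p (o k))].
  have main i' k' : i' < k' -> k' < 6 -> ~~ [|| e (p (o k')) (p (o i')), e (p (o k')) (x (o i')) | e (x (o k')) (p (o i'))].
    move=> h1 h2; have := oc i' k' h1 h2; rewrite /conflict oN; last lia.
    by apply: contra => h; apply/selP; split=> //; apply: oN.
  move=> hi hk; rewrite neq_ltn => /orP[lt|lt].
    have := main i k lt hk; rewrite !negb_or => /and3P[h1 h2 h3].
    by split; rewrite eC.
  have := main k i lt hi; rewrite !negb_or => /and3P[h1 h2 h3].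
  by split=> //; rewrite eC.
pose tri i := [|| i == a, i == b | i == dd].
pose Tp := [set p (o i) | i : 'I_6 & tri i].
have TpP t : t \in Tp -> exists2 i, i < 6 & tri i /\ t = p (o i).
  by move=> /imsetP[i]; rewrite inE => ti ->; exists i.
have TpJ t : t \in Tp -> t \notin J.
  move=> /TpP[i lti [_ ->]]; apply/negP=> /JS[_]; have [_ _ _ _ [-> _]] := oP i lti; lia.
have sc i : tri i -> (f (x (o i)) == 0) = (f (x (o a)) == 0).
  by case/or3P=> /eqP->; rewrite -?cbd -?cab.
have f01 i i' : i < 2 -> i' < 2 -> (i == 0) = (i' == 0) -> i = i' by lia.
have scE i : i < 6 -> tri i -> f (x (o i)) = f (x (o a)).
  by move=> lti ti; apply: f01 (sc i ti); apply: f2; apply: xJ; lia.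
have JTp u t : u \in J -> t \in Tp -> e u t -> f u = f (x (o a)).
  move=> uJ /TpP[i lti [ti ->]] eut; have [pS xS _ _ [dp' dx']] := oP i lti.
  have := subsetP sJ _ uJ; rewrite in_setU => /orP[/setIdP[uS le]|/imsetP[k _ Ek]].
    by have := far_levels uS pS; rewrite eC eut => /(_ ltac:(lia)).
  have [Eik|ne] := eqVneq i k; first by rewrite Ek -Eik scE.
  by have [_ _] := nconf k i (ltn_ord k) lti ltac:(by rewrite eq_sym); rewrite -Ek eut.
have [||||k [bb wh]] := @adj_wheel G c n (J :|: Tp) (fun v => (v \in J) && (f v == f (x (o a)))) Hc.
- apply: conn_star => // t /TpP[i lti [_ ->]]; exists (x (o i)); first exact: xJ.
  by have [_ _ _ ? _] := oP i lti; rewrite eC.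
- move=> u v; rewrite !in_setU => /orP[uJ|uT] /orP[vJ|vT] euv.
  + rewrite uJ vJ /=; have := fp u v uJ vJ euv; have := f2 u uJ; have := f2 v vJ.
    by have := f2 _ (xJ a ltac:(lia)); lia.
  + by rewrite uJ (JTp u v) // (negbTE (TpJ v vT)) eqxx.
  + by rewrite vJ (JTp v u) 1?eC // (negbTE (TpJ u uT)) eqxx.
  + case/TpP: uT euv => i lti [_ ->]; case/TpP: vT => i' lti' [_ ->].
    case: (eqVneq i i') => [->|ne]; first by rewrite eI.
    by have [/negbTE->] := nconf i i' lti lti' ne.
- move=> i lti; have [cS dc] := NS _ (cN i lti); rewrite in_setU; apply/negP=> /orP[/JS[_]|/TpP[i' lti' [_ E]]]; first lia.
  by have [_ _ _ _ [h _]] := oP i' lti'; move: dc; rewrite E h; lia.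
- move=> v i _ /andP[vJ _] lti; have [cS dc] := NS _ (cN i lti); have [vS dv] := JS v vJ.
  by rewrite eC; apply: far_levels => //; lia.
have hub i q : i < 6 -> tri i -> q < n -> c q = o i -> odd q = bb (+) (k <= q).
  move=> lti ti ltq cq; apply: (wh (p (o i))) => //.
  - by rewrite in_setU; apply/orP; right; apply/imsetP; exists (Ordinal lti); rewrite ?inE.
  - by rewrite (negbTE (TpJ _ _)) //; apply/imsetP; exists (Ordinal lti); rewrite ?inE.
  - by rewrite cq; have [] := oP i lti.
have h1 : odd (X a) = bb (+) (k <= X a) by apply: (hub a) => //; rewrite /tri ?eqxx //; lia.
have h2 : odd (X b) = bb (+) (k <= X b) by apply: (hub b) => //; rewrite /tri ?eqxx ?orbT //; lia.
have h3 : odd (X dd) = bb (+) (k <= X dd) by apply: (hub dd) => //; rewrite /tri ?eqxx ?orbT //; lia.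
clear -h1 h2 h3 oab obd Xab Xbd; case: bb h1 h2 h3; lia.
Qed.

End Levels.

Lemma main_col : col [set: G] (2 * rope_col 13).
Proof.
apply: NNPP => nV; have [S [_ cS nS _]] := component nV.
have [z zS] := ncol_ex nS.
have [||d [par [d0 dp dl]]] := @bfs S [set z] cS; [by rewrite sub1set|by exists z; rewrite inE|].
have k0 : 4 <= rope_col 13 by rewrite /rope_col /= {1}/stage_col; lia.
have [j j2 nj] := @deep_level S z d par (rope_col 13) (ltn_trans (ltn0Sn 2) k0) d0 dp dl nS.
apply: nj; case: (ltnP 2 j) => j3; first exact: level_rope_col d0 dp dl _ j3 zS.
(* In level 2 all legs are attached to [z], so 4 colours suffice. *)
have Ej : j = 2 by lia.
apply: (@colS _ [set v in S | d v == j] 4) => //.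
have dz : d z = 0 by apply/(d0 z zS); rewrite inE.
apply: (@vertex_leg_col z) => t /setIdP[tS /eqP dt].
  split; first by move=> E; move: dz; rewrite E; lia.
  by apply/negP; rewrite eC => /(dl t z tS zS); lia.
have [|pS ep dpt] := dp t tS; first lia.
have [|ppS epp dppt] := dp (par t) pS; first lia.
have /(d0 _ ppS)/set1P Ez : d (par (par t)) = 0 by lia.
by exists (par t); rewrite -Ez eC ep eC.
Qed.

End Graphs.

(** * The stable set polytope *)

Section Walks.
Variables (V : finType) (e : rel V).

Fixpoint steps (R : rel V) u s := if s is v :: s' then R u v + steps R v s' else 0.

Lemma steps_le (R R' : rel V) u s : (forall x y, x \in u :: s -> y \in s -> e x y -> R x y -> R' x y) ->
  path e u s -> steps R u s <= steps R' u s.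
Proof.
elim: s u => [//|v s IH] u H /= /andP[euv ps]; apply: leq_add.
  by case E: (R u v) => //; rewrite H ?inE ?eqxx.
by apply: IH => // x y xs ys; apply: H; rewrite inE ?ys ?xs ?orbT.
Qed.

Lemma steps_ex (R : rel V) u s : path e u s -> 0 < steps R u s ->
  exists x y, [/\ x \in u :: s, y \in s, e x y, R x y &
    forall R' : rel V, R' x y -> 0 < steps R' u s].
Proof.
elim: s u => [//|v s IH] u /= /andP[euv ps]; case: (boolP (R u v)) => [Ruv _|_ /= lt].
  by exists u, v; rewrite !inE !eqxx; split=> // R' ->.
have [x [y [xs ys exy Rxy H]]] := IH v ps lt.
exists x, y; rewrite inE xs orbT inE ys orbT; split=> // R' R'xy.
by rewrite addn_gt0 H ?orbT.
Qed.

Lemma steps_cross (U : pred V) u s :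
  odd (steps (fun x y => U x != U y) u s) = (U u != U (last u s)).
Proof.
elim: s u => [|v s IH] u /=; first by rewrite eqxx.
by rewrite oddD IH; case: (U u); case: (U v); case: (U (last v s)).
Qed.

(** Count the ends of steps that lie in [B]: a step has exactly one such end or is counted by
    [steps], and every position except the first and the last belongs to two steps. *)
Lemma steps_class (B : pred V) u s :
  (forall x y, x \in u :: s -> y \in s -> e x y -> ~~ (B x && B y)) -> path e u s ->
  size s + B u + B (last u s) = steps (fun x y => ~~ B x && ~~ B y) u s + 2 * count B (u :: s).
Proof.
elim: s u => [|v s IH] u H /=; first by case: (B u); lia.
move=> /andP[euv ps].
have nb : ~~ (B u && B v) by apply: H; rewrite ?inE ?eqxx.
have := IH v (fun x y xs ys => H x y (mem_behead (s := u :: v :: s) xs) (mem_behead (s := v :: s) ys)) ps.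
rewrite ![count _ _]/=; move: (steps _ v s) (count B s) (size s) (B (last v s)) => a b m d.
by case: (B u) nb; case: (B v) => // _; case: d; lia.
Qed.

Variables (supp B : pred V).

(* The number of steps of d inside the lower class is odd; it is not 1, because by the cut
   hypothesis d crosses some cut only at such steps, and it crosses every cut evenly. *)
Lemma cycle_class d : cycle e d -> odd (size d) -> all supp d ->
  (forall x y, supp x -> supp y -> e x y -> ~~ (B x && B y)) ->
  (forall x y, supp x -> supp y -> e x y -> ~~ B x -> ~~ B y -> exists U : pred V, U x != U y /\
     forall x' y', supp x' -> supp y' -> e x' y' -> U x' != U y' -> ~~ B x' && ~~ B y') ->
  2 * count B d + 3 <= size d.
Proof.
case: d => [//|v0 s] /= cyc ods /andP[sv /allP ss] nB cut.
set s' := rcons s v0 in cyc.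
have supp' x : x \in v0 :: s' -> supp x.
  by rewrite inE mem_rcons inE => /or3P[/eqP->|/eqP->|/ss].
have supp1 x : x \in s' -> supp x by move=> xs; apply: supp'; rewrite inE xs orbT.
have E := @steps_class B v0 s' (fun x y xs ys => nB x y (supp' x xs) (supp1 y ys)) cyc.
set aa := steps _ v0 s' in E.
have Es : size s' = (size s).+1 by rewrite size_rcons.
have El : last v0 s' = v0 by rewrite last_rcons.
have Ec : count B (v0 :: s') = B v0 + (B v0 + count B s).
  by rewrite /= /s' -cats1 count_cat /= addn0 [count B s + _]addnC.
rewrite Es El Ec in E.
suff : aa != 1 by move: E ods; case: (B v0) => /=; lia.
apply/eqP=> aa1.
have [|x [y [xs ys exy /andP[Bx By] H]]] := @steps_ex (fun x y => ~~ B x && ~~ B y) v0 s' cyc.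
  by rewrite -/aa aa1.
have [U [Uxy HU]] := cut x y (supp' x xs) (supp1 y ys) exy Bx By.
have le : steps (fun x y => U x != U y) v0 s' <= aa.
  by apply: steps_le cyc => a b as' bs'; apply: HU; [apply: supp'|apply: supp1].
have := steps_cross U v0 s'; rewrite El eqxx.
have := H (fun x y => U x != U y) Uxy; lia.
Qed.

End Walks.

(** * Weighted stable sets in t-perfect graphs *)

Section Polytope.
Local Open Scope ring_scope.
Variables (R : realType) (G : sgraph).
Hypothesis tp : t_perfect R G.
Local Notation e := (@edge G).

Lemma halfspace_convex (w : G -> R) (m : R) :
  @convex_set R {ffun G -> R^o} [set y : {ffun G -> R^o} | \sum_v w v * y v <= m]%classic.
Proof.
move=> x y l /set_mem /= hx /set_mem /= hy; apply/mem_set => /=.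
have p0 : 0 <= l%:num :> R by exact: ge0.
have p1 : 0 <= 1 - l%:num :> R by rewrite subr_ge0; exact: le1.
set p : R := l%:num in p0 p1.
have E v : (conv l x y : {ffun G -> R^o}) v = p * x v + (1 - p) * y v by rewrite !ffunE.
rewrite (eq_bigr (fun v => p * (w v * x v) + (1 - p) * (w v * y v))); last first.
  by move=> v _; rewrite E mulrDr ![w v * _]mulrCA.
rewrite big_split -!mulr_sumr /=.
have -> : m = p * m + (1 - p) * m by rewrite -mulrDl subrKC mul1r.
by apply: lerD; apply: ler_wpM2l.
Qed.

(** The half-space bounded by the largest weight of a stable set contains all incidence vectors,
    hence their convex hull. *)
Lemma stab_weight (x : {ffun G -> R^o}) (w : G -> R) : TSTAB R G x ->
  exists2 S : {set G}, stable S & \sum_v w v * x v <= \sum_v w v * (v \in S)%:R.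
Proof.
rewrite -tp => Hx.
have st0 : stable (set0 : {set G}) by apply/forall_inP=> u; rewrite inE.
pose W (S : {set G}) : R := \sum_v w v * (v \in S)%:R.
case: (@arg_maxP _ _ _ (set0 : {set G}) (@stable G) W st0) => S stS mS.
exists S => //; apply: (Hx [set y : {ffun G -> R^o} | \sum_v w v * y v <= W S]%classic); split.
  exact: halfspace_convex.
move=> _ [T stT <-] /=; rewrite (eq_bigr (fun v => w v * (v \in T)%:R)); last by move=> v _; rewrite ffunE.
exact: mS.
Qed.

Lemma incidence_tstab (S : {set G}) : stable S -> TSTAB R G (incidence R S).
Proof.
move=> stS; rewrite -tp => A [_ HA]; apply: HA; by exists S.
Qed.

Lemma stable_cycle (S : {set G}) (c : seq G) : stable S -> odd_cycle c ->
  (2 * count [in S] c < size c)%N.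
Proof.
move=> /incidence_tstab[_ _ H] oc; have := H c oc.
have -> : \sum_(v <- c) incidence R S v = (count [in S] c)%:R.
  rewrite -sum1_count natr_sum [RHS]big_mkcond /=; apply: eq_bigr => v _; rewrite ffunE.
  by case: (v \in S).
case/and3P: oc => s2 _ _.
rewrite ler_pdivlMr // -natrM lerBrDr natr1 ler_nat; lia.
Qed.

(* A large weight on the edges where x sums to 1 forces S to meet them. *)
Lemma stab_weight_tight (x : {ffun G -> R^o}) (w : G -> R) : TSTAB R G x ->
  exists S : {set G}, [/\ stable S, \sum_v w v * x v <= \sum_v w v * (v \in S)%:R &
    forall u v, e u v -> x u + x v = 1 -> (u \in S) || (v \in S)].
Proof.
move=> Hx.
pose ti u v := e u v && (x u + x v == 1).
have tiC u v : ti u v = ti v u by rewrite /ti edge_sym addrC.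
pose wx := \sum_v w v * x v.
(* [M] exceeds any possible gain in [w], so a single missed tight edge cannot be compensated. *)
pose M : R := 1 + `|wx| + \sum_v `|w v|.
pose ta v : R := \sum_u (ti v u)%:R.
have [S stS] := @stab_weight x (fun v => w v + 2 * M * ta v) Hx.
have split_sum (y : G -> R) : \sum_v (w v + 2 * M * ta v) * y v =
    \sum_v w v * y v + M * \sum_v \sum_u (ti v u)%:R * (y v + y u).
  have E1 : \sum_v \sum_u (ti v u)%:R * y v = \sum_v ta v * y v.
    by apply: eq_bigr => v _; rewrite mulr_suml.
  have E2 : \sum_v \sum_u (ti v u)%:R * y u = \sum_v ta v * y v.
    rewrite exchange_big; apply: eq_bigr => v _; rewrite mulr_suml.
    by apply: eq_bigr => u _; rewrite tiC.
  have -> : \sum_v \sum_u (ti v u)%:R * (y v + y u) = 2 * \sum_v ta v * y v.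
    rewrite mulr_natl mulr2n -{1}E1 -E2 -big_split; apply: eq_bigr => v _.
    by rewrite -big_split; apply: eq_bigr => u _; rewrite mulrDr.
  rewrite mulrA [M * 2]mulrC mulr_sumr -big_split; apply: eq_bigr => v _.
  by rewrite mulrDl mulrA.
rewrite (split_sum (fun v => x v)) (split_sum (fun v => (v \in S)%:R)) => le.
have M0 : 0 < M.
  have := normr_ge0 wx; have : 0 <= \sum_v `|w v| by apply: sumr_ge0.
  by rewrite /M; lra.
have wS : `|\sum_v w v * (v \in S)%:R| <= \sum_v `|w v|.
  apply: le_trans (ler_norm_sum _ _ _) _; apply: ler_sum => v _.
  by rewrite normrM; case: (v \in S); rewrite ?normr1 ?normr0 ?mulr1 ?mulr0.
have stE u v : e u v -> ((u \in S) + (v \in S) <= 1)%N.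
  move=> euv; case uS: (u \in S); case vS: (v \in S) => //.
  by have := forall_inP (forall_inP stS u uS) v vS; rewrite euv.
have term v u : (ti v u)%:R * ((v \in S)%:R + (u \in S)%:R) <= (ti v u)%:R * (x v + x u) :> R.
  rewrite /ti; case E: (e v u) => /=; last by rewrite !mul0r.
  case: eqP => [->|_]; last by rewrite !mul0r.
  by rewrite !mul1r -natrD -[X in _ <= X]/(1%:R) ler_nat; apply: stE.
exists S; split=> //.
  have h : \sum_v \sum_u (ti v u)%:R * ((v \in S)%:R + (u \in S)%:R) <= \sum_v \sum_u (ti v u)%:R * (x v + x u) :> R.
    by apply: ler_sum => v _; apply: ler_sum => u _; apply: term.
  have := ler_wpM2l (ltW M0) h; lra.
move=> u0 v0 e0 x0; apply: contraT; rewrite negb_or => /andP[nu nv].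
have t0 : ti u0 v0 by rewrite /ti e0 x0 eqxx.
have h : \sum_v \sum_u (ti v u)%:R * ((v \in S)%:R + (u \in S)%:R) + 1 <= \sum_v \sum_u (ti v u)%:R * (x v + x u) :> R.
  rewrite (bigD1 u0) //= [X in _ <= X](bigD1 u0) //= (bigD1 v0) //= [X in _ <= X + _](bigD1 v0) //=.
  have a1 : \sum_(i | i != v0) (ti u0 i)%:R * ((u0 \in S)%:R + (i \in S)%:R) <= \sum_(i | i != v0) (ti u0 i)%:R * (x u0 + x i) :> R.
    by apply: ler_sum => u _; apply: term.
  have a2 : \sum_(i | i != u0) \sum_u (ti i u)%:R * ((i \in S)%:R + (u \in S)%:R) <=
      \sum_(i | i != u0) \sum_u (ti i u)%:R * (x i + x u) :> R.
    by apply: ler_sum => v _; apply: ler_sum => u _; apply: term.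
  rewrite t0 x0 (negbTE nu) (negbTE nv) /= addr0 mulr0 mulr1 add0r.
  rewrite (negbTE nu) in a1.
  by rewrite [leLHS]addrC addrA; apply: lerD a2; rewrite lerD2l.
have := ler_wpM2l (ltW M0) h; rewrite mulrDr mulr1.
have n1 := ler_norm (\sum_v w v * (v \in S)%:R); have n2 := ler_norm (- wx).
rewrite normrN in n2.
move: le wS M0 n1 n2; rewrite -/wx /M; lra.
Qed.

Lemma path_pairs (x : G -> R) v s : (forall u v, e u v -> x u + x v <= 1) ->
  path e v s -> ~~ odd (size s) -> \sum_(u <- s) x u <= (size s)%:R / 2.
Proof.
move=> xe; have [n] := ubnP (size s); elim: n v s => // n IH v [|a [|b s]] //=.
  by rewrite big_nil mul0r.
rewrite ltnS => le /and3P[_ eab ps]; rewrite negbK => ev.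
rewrite !big_cons addrA; have h := IH b s (ltnW le) ps ev.
have := xe _ _ eab.
have -> : (size s).+2%:R = (size s)%:R + 2 :> R by rewrite -addn2 natrD.
move: h; lra.
Qed.

(** The vertices other than [v] form a path with an even number of vertices and pair up along edges.
    Thus only cycles inside the support of a point have to be checked. *)
Lemma cycle_zero (x : G -> R) c v : (forall u v, e u v -> x u + x v <= 1) ->
  odd_cycle c -> v \in c -> x v = 0 -> \sum_(u <- c) x u <= ((size c)%:R - 1) / 2.
Proof.
move=> xe /and3P[s2 os /andP[cyc un]] vc xv.
have [i s E] := rot_to vc.
have Es : size c = (size s).+1 by rewrite -(size_rot i) E.
rewrite (perm_big (rot i c)) /=; last by rewrite perm_sym perm_rot.
rewrite E big_cons xv add0r Es -natr1 addrK.
have : cycle e (rot i c) by rewrite rot_cycle.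
rewrite E /= rcons_path => /andP[ps _].
by apply: path_pairs ps _ => //; move: os; rewrite Es.
Qed.

Lemma hole_odd_cycle c n : is_hole e c n -> odd_cycle (mkseq c n).
Proof.
move=> H; have [n2 on _] := H.
have E i j : (i < n)%N -> (j < n)%N -> e (c i) (c j) = [|| j == i.+1, i == j.+1, (i == 0%N) && (j == n.-1) | (j == 0%N) && (i == n.-1)].
  by move=> lti ltj; apply: (is_hole_e (@edge_sym G) (@edge_irr G) H).
rewrite /odd_cycle size_mkseq n2 on /=; apply/andP; split; last first.
  rewrite map_inj_in_uniq ?iota_uniq // => i j; rewrite !mem_iota !add0n => lti ltj.
  exact: (is_hole_inj H).
have En : n = n.-1.+1 by lia.
rewrite {1}En /mkseq /= rcons_path; apply/andP; split; last first.
  have -> : n.-1 = (n.-2 + 1)%N by lia.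
  by rewrite iotaD cats1 map_rcons last_rcons E; lia.
apply/(pathP (c 0%N)) => i; rewrite size_map size_iota => lti.
rewrite (nth_map 0%N) ?size_iota // nth_iota //.
have -> : nth (c 0%N) (c 0%N :: [seq c i | i <- iota 1 n.-1]) i = c i.
  by case: i lti => //= i lti; rewrite (nth_map 0%N) ?size_iota ?nth_iota //; lia.
by rewrite E; lia.
Qed.

Definition frac k : R := k%:R / (2 * k).+1%:R.

Lemma fracE k : frac k * (2 * k).+1%:R = k%:R.
Proof. by rewrite /frac divfK // pnatr_eq0. Qed.

Lemma frac_ge0 k : 0 <= frac k.
Proof. by apply: divr_ge0; rewrite ler0n. Qed.

(** For a cycle of length [m] in [W], [m * k / (2k+1)] is at most [(m - 1) / 2] exactly when [m] is
    at least [2k+1]. *)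
Lemma tstab_uniform (W : {set G}) k : (forall c, odd_cycle c -> {subset c <= W} -> (2 * k < size c)%N) ->
  TSTAB R G [ffun v => if v \in W then frac k else 0].
Proof.
move=> girth; have k0 := frac_ge0 k; have kE := fracE k.
have D0 : 0 < (2 * k).+1%:R :> R by rewrite ltr0n.
have k1 : frac k + frac k <= 1.
  rewrite -(ler_pM2r D0) mulrDl kE mul1r -natrD ler_nat; lia.
have xe u v : e u v -> [ffun v => if v \in W then frac k else 0] u +
   [ffun v => if v \in W then frac k else 0] v <= 1.
  by rewrite !ffunE => _; case: ifP; case: ifP => _ _; lra.
split=> //; first by move=> v; rewrite ffunE; case: ifP.
move=> c oc; case: (boolP (all [in W] c)) => [/allP cW|/allPn[v vc vW]]; last first.
  by apply: (cycle_zero xe oc vc); rewrite ffunE (negbTE vW).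
have E : \sum_(v <- c) [ffun v => if v \in W then frac k else 0] v = frac k * (size c)%:R :> R.
  rewrite (eq_big_seq (fun=> frac k)); last by move=> v /cW vW; rewrite ffunE vW.
  by rewrite big_const_seq count_predT iter_addr_0 mulr_natr.
apply: (@le_trans _ _ (frac k * (size c)%:R)); first by rewrite -E.
rewrite ler_pdivlMr // -(ler_pM2r D0).
have -> : frac k * (size c)%:R * 2 * (2 * k).+1%:R = (frac k * (2 * k).+1%:R) * ((size c)%:R * 2) by ring.
have := girth c oc cW; case/and3P: oc => s2 os _ lt.
have -> : (size c)%:R - 1 = (size c).-1%:R :> R by case: (size c) s2 => //= m _; rewrite -natr1 addrK.
by rewrite kE -!natrM ler_nat; nia.
Qed.

(** The uniform point has weight [k] on each cycle and a stable set at most [k]; a stable set at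
    least as heavy in total must reach [k], which is positive, on every one of them. *)
Lemma hit_cycles (W : {set G}) k : (0 < k)%N ->
  (forall c, odd_cycle c -> {subset c <= W} -> (2 * k < size c)%N) ->
  exists2 S : {set G}, stable S &
    forall c, odd_cycle c -> {subset c <= W} -> size c = (2 * k).+1 -> has [in S] c.
Proof.
move=> k0 girth; have Hx := tstab_uniform girth.
set x := [ffun v => _] in Hx.
pose good (t : (2 * k).+1.-tuple G) := odd_cycle t && all [in W] t.
(* A cycle is counted once for every way to list it; the comparison is made tuple by tuple, so this
   is harmless. *)
pose w v : R := \sum_(t | good t) (count_mem v t)%:R.
have sumw (y : G -> R) : \sum_v w v * y v = \sum_(t | good t) \sum_(v <- tval t) y v.
  rewrite (eq_bigr (fun v => \sum_(t | good t) (count_mem v t)%:R * y v)); last by move=> v _; rewrite mulr_suml.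
  rewrite exchange_big /=; apply: eq_bigr => t _.
  rewrite [RHS](eq_bigr (fun u => \sum_v (u == v)%:R * y v)); last first.
    move=> u _; rewrite (bigD1 u) //= eqxx mul1r big1 ?addr0 // => v.
    by rewrite eq_sym => /negbTE->; rewrite mul0r.
  rewrite exchange_big /=; apply: eq_bigr => v _.
  rewrite -mulr_suml; congr (_ * _); rewrite -sum1_count natr_sum [LHS]big_mkcond /=.
  by apply: eq_bigr => u _; case: eqP.
have [S stS] := stab_weight w Hx; rewrite !sumw => le.
exists S => // c oc cW sc; apply: contraT => nh.
have stt : size c == (2 * k).+1 by rewrite sc.
have gt0 : good (Tuple stt) by rewrite /good /= oc; apply/allP.
have xs (t : (2 * k).+1.-tuple G) : good t -> \sum_(v <- tval t) x v = k%:R.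
  case/andP=> _ /allP tW; rewrite (eq_big_seq (fun=> frac k)); last by move=> v /tW vW; rewrite ffunE vW.
  by rewrite big_const_seq count_predT iter_addr_0 size_tuple -[LHS]mulr_natr; apply: fracE.
have ys (t : (2 * k).+1.-tuple G) : \sum_(v <- tval t) (v \in S)%:R = (count [in S] t)%:R :> R.
  by rewrite -sum1_count natr_sum [RHS]big_mkcond /=; apply: eq_bigr => v _; case: (v \in S).
have yk (t : (2 * k).+1.-tuple G) : good t -> (count [in S] t <= k)%N.
  by case/andP=> ot _; have := stable_cycle stS ot; rewrite size_tuple; lia.
move: le; rewrite (eq_bigr _ xs) (eq_bigr _ (fun t _ => ys t)).
rewrite (bigD1 (Tuple stt)) //= [X in _ <= X](bigD1 (Tuple stt)) //=.
have -> : count [in S] c = 0%N by apply/eqP; rewrite -leqn0 leqNgt -has_count.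
have : \sum_(t | good t && (t != Tuple stt)) (count [in S] t)%:R <= \sum_(t | good t && (t != Tuple stt)) k%:R :> R.
  by apply: ler_sum => t /andP[/yk h _]; rewrite ler_nat.
have : 0 < k%:R :> R by rewrite ltr0n.
by move=> h1 h2; rewrite leNgt => /negP[]; rewrite mulr0n add0r; apply: (le_lt_trans h2); rewrite ltrDr.
Qed.

End Polytope.

(** * The wheel lemma *)

(** The greedy stable set in the gaps between touched indices: false at a touched index, then true,
    false, true, and so on up to the next one. *)
Fixpoint gap_parity (t : pred nat) i := if i is j.+1 then ~~ t i && ~~ gap_parity t j else false.

(** The greedy choice stays ahead: the induction keeps one unit in reserve wherever [gap_parity]
    holds and [s] does not. *)
Lemma sum_hits_le n (s t : pred nat) : (forall i, i.+1 < n -> ~~ (s i && s i.+1)) ->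
  (forall i, i < n -> t i -> ~~ s i) -> t 0 ->
  \sum_(i < n) s i <= \sum_(i < n) gap_parity t i.
Proof.
move=> nc ts t0.
have H m : m < n -> \sum_(i < m.+1) s i + (gap_parity t m && ~~ s m) <= \sum_(i < m.+1) gap_parity t i.
  elim: m => [|m IH] lem.
    by rewrite !big_ord_recl !big_ord0 /= (negbTE (ts 0 lem t0)).
  rewrite big_ord_recr [X in _ <= X]big_ord_recr /=.
  have := IH ltac:(lia); have := nc m lem; have := ts m.+1 lem.
  set p := \sum_(i < m.+1) _; set q := \sum_(i < m.+1) _.
  by case: (s m); case: (s m.+1); case: (t m.+1); case: (gap_parity t m) => //=;
    (try by move=> /(_ isT)) => _ _; lia.
case: n H {nc ts} => [|n] H; first by rewrite !big_ord0.
by have := H n (ltnSn n); lia.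
Qed.

Section Wheel.
Variables (R : realType) (G : sgraph).
Hypothesis tp : t_perfect R G.
Local Notation e := (@edge G).
Variables (c : nat -> G) (n : nat) (X : {set G}) (ka : G -> bool).
Hypotheses (Hc : is_hole e c n) (cX : connected e X)
  (pX : forall x y, x \in X -> y \in X -> e x y -> ka x != ka y)
  (cnX : forall i, i < n -> c i \notin X)
  (kX : forall x i, x \in X -> ka x -> i < n -> ~~ e x (c i)).

Definition touched i := [exists x in X, ~~ ka x && e x (c i)].
Local Notation t := touched.
Local Notation be := (gap_parity t).
Definition rim v := [exists i : 'I_n, c i == v].
(** The vertices of value 2/3 in [wheel_point]; the others of hub and rim get 1/3. Edges inside the
    hub become tight, and the large values on the rim form the greedy stable set of untouched
    indices. *)
Definition upper v := if v \in X then ka v else [exists i : 'I_n, (c i == v) && be i].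
Definition wsupp v := (v \in X) || rim v.

Lemma rimP v : reflect (exists2 i, i < n & c i = v) (rim v).
Proof.
apply: (iffP existsP) => [[i /eqP<-]|[i lti <-]]; first by exists i.
by exists (Ordinal lti).
Qed.

Lemma upperE i : i < n -> upper (c i) = be i.
Proof.
move=> lti; rewrite /upper (negbTE (cnX lti)); apply/existsP/idP => [[j /andP[/eqP E]]|b].
  by rewrite (is_hole_inj Hc (ltn_ord j) lti E).
by exists (Ordinal lti); rewrite /= eqxx.
Qed.

Lemma touched_even i : t i -> be i = false.
Proof. by case: i => //= i ->. Qed.

Lemma hub_rim x i : x \in X -> i < n -> e x (c i) -> ~~ upper x && ~~ upper (c i).
Proof.
move=> xX lti exi; have nk : ~~ ka x by apply/negP=> k; have := kX xX k lti; rewrite exi.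
rewrite {1}/upper xX nk upperE // touched_even //.
by apply/existsP; exists x; rewrite xX nk.
Qed.

Section NoLinear.
(** The situation, after rotation, of a hole with more than one parity change: the gap after the
    last touched index [q] has an even number of vertices, and some touched index is odd. *)
Hypotheses (t0 : t 0) (q : nat) (ltq : q < n) (oq : odd (n - q))
  (lastq : forall i, q < i < n -> ~~ t i) (tq : t q)
  (j0 : nat) (ltj0 : j0 < n) (oj0 : odd j0) (tj0 : t j0).

Lemma be_last : be n.-1 = false.
Proof.
have H m : q + m < n -> be (q + m) = odd m.
  elim: m => [|m IH] lt; first by rewrite addn0 touched_even.
  rewrite addnS /= IH; last lia.
  by rewrite -addnS lastq //; lia.
have -> : n.-1 = q + (n.-1 - q) by lia.
by rewrite H; lia.
Qed.

(** Otherwise the values alternate along the whole rim, which fails at the odd touched index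
    [j0]. *)
Lemma ex_even_edge : exists2 j, 0 < j < n & ~~ be j.-1 && ~~ be j.
Proof.
apply: NNPP => nE.
have H i : i < n -> be i = odd i.
  elim: i => [//|i IH] lt; have bi := IH (ltnW lt).
  have : ~~ (~~ be i && ~~ be i.+1) by apply/negP=> h; apply: nE; exists i.+1.
  by rewrite /= bi; case: (odd i); case: (t i.+1).
by have := H j0 ltj0; rewrite touched_even // oj0.
Qed.

Lemma rim_edge i j : i < n -> j < n -> i < j -> e (c i) (c j) -> j = i.+1 \/ i = 0 /\ j = n.-1.
Proof. by move=> lti ltj ltij; rewrite (is_hole_e (@edge_sym G) (@edge_irr G) Hc) //; lia. Qed.

Lemma not_both_upper u v : wsupp u -> wsupp v -> e u v -> ~~ (upper u && upper v).
Proof.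
have sym x y : e x y -> ~~ upper x && ~~ upper y -> ~~ (upper x && upper y) by case: (upper x).
move=> /orP[uX|/rimP[i lti <-]] /orP[vX|/rimP[j ltj <-]] euv.
- by have := pX uX vX euv; rewrite /upper uX vX; case: (ka u); case: (ka v).
- exact/(sym _ _ euv)/hub_rim.
- by rewrite edge_sym in euv; rewrite andbC; apply/(sym _ _ euv)/hub_rim.
rewrite !upperE //.
have main a b : a < n -> b < n -> a < b -> e (c a) (c b) -> ~~ (be a && be b).
  move=> lta ltb ltab eab; case: (rim_edge lta ltb ltab eab) => [->|[-> ->]] //=.
  by case: (t a.+1); case: (be a).
case: (ltngtP i j) => [lt|lt|E]; first exact: main.
  by rewrite andbC; apply: main; rewrite // edge_sym.
by rewrite E edge_irr in euv.
Qed.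

Definition below j v := [exists i : 'I_n, (c i == v) && (i < j)].

Lemma belowE j i : i < n -> below j (c i) = (i < j).
Proof.
move=> lti; apply/existsP/idP => [[k /andP[/eqP E ltk]]|lt].
  by rewrite -(is_hole_inj Hc (ltn_ord k) lti E).
by exists (Ordinal lti); rewrite /= eqxx.
Qed.

(** The initial segment leaves the rim through two edges, the one entering [c j] and the one closing
    the rim. Both have two lower ends, the latter by [be_last], and so have all edges between hub
    and rim. *)
Lemma initial_cut j : 0 < j < n -> ~~ be j.-1 && ~~ be j ->
  forall u v, wsupp u -> wsupp v -> e u v ->
  below j u != below j v ->
  ~~ upper u && ~~ upper v.
Proof.
move=> hj bj.
have nU x : x \in X -> below j x = false.
  by move=> xX; apply/existsP=> [[k /andP[/eqP E _]]]; have := cnX (ltn_ord k); rewrite E xX.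
have main a b : a < n -> b < n -> a < b -> e (c a) (c b) -> (a < j) != (b < j) -> ~~ be a && ~~ be b.
  move=> lta ltb ltab eab; case: (rim_edge lta ltb ltab eab) => [->|[-> ->]] h.
    have E : j = a.+1 by lia.
    by move: bj; rewrite E.
  by rewrite be_last.
move=> u v /orP[uX|/rimP[i lti <-]] /orP[vX|/rimP[k ltk <-]] euv.
- by rewrite !nU ?eqxx.
- by move=> _; apply: hub_rim.
- by move=> _; rewrite andbC; apply: hub_rim; rewrite // edge_sym.
rewrite !belowE // !upperE // => h.
case: (ltngtP i k) => [lt|lt|E]; first exact: main.
  by rewrite andbC; apply: main; rewrite // 1?edge_sym // eq_sym.
by rewrite E edge_irr in euv.
Qed.

(** The cut hypothesis of [cycle_class]: edges between hub and rim are separated by [X], rim edges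
    by an initial segment, and inside the hub no edge has two lower ends. *)
Lemma even_edge_cut u v : wsupp u -> wsupp v -> e u v -> ~~ upper u -> ~~ upper v ->
  exists U : pred G, U u != U v /\
    forall u' v', wsupp u' -> wsupp v' -> e u' v' -> U u' != U v' -> ~~ upper u' && ~~ upper v'.
Proof.
have hub x y : wsupp x -> wsupp y -> e x y -> (x \in X) != (y \in X) -> ~~ upper x && ~~ upper y.
  move=> /orP[xX|/rimP[i lti <-]] /orP[yX|/rimP[j ltj <-]] exy.
  - by rewrite xX yX.
  - by move=> _; apply: hub_rim.
  - by move=> _; rewrite andbC; apply: hub_rim; rewrite // edge_sym.
  - by rewrite (negbTE (cnX lti)) (negbTE (cnX ltj)).
move=> su sv euv nu nv; case: (boolP ((u \in X) != (v \in X))) => [h|].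
  by exists (fun v => v \in X).
rewrite negbK => /eqP Euv; case: (boolP (u \in X)) => uX.
  by have vX := uX; rewrite Euv in vX; have := pX uX vX euv; move: nu nv; rewrite /upper uX vX; case: (ka u); case: (ka v).
have vX : v \notin X by rewrite -Euv.
move: su sv; rewrite /wsupp (negbTE uX) (negbTE vX) => /rimP[i lti Ei] /rimP[j ltj Ej].
have main a b : a < n -> b < n -> a < b -> e (c a) (c b) -> ~~ be a -> ~~ be b ->
    exists U : pred G, U (c a) != U (c b) /\
    forall u' v', wsupp u' -> wsupp v' -> e u' v' -> U u' != U v' -> ~~ upper u' && ~~ upper v'.
  move=> lta ltb ltab eab na nb; case: (rim_edge lta ltb ltab eab) => [E|[Ea Eb]].
    exists (below b); split; first by rewrite !belowE // ltab ltnn.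
    by apply: initial_cut; [lia|rewrite (_ : b.-1 = a) ?na ?nb // E].
  have [j' hj' bj'] := ex_even_edge.
  exists (below j'); split; first by rewrite !belowE //; lia.
  exact: initial_cut.
rewrite -Ei -Ej in euv nu nv *; rewrite !upperE // in nu nv.
case: (ltngtP i j) => [lt|lt|E]; first exact: main.
  have [|U [h1 h2]] := main j i ltj lti lt _ nv nu; first by rewrite edge_sym.
  by exists U; rewrite eq_sym.
by rewrite E edge_irr in euv.
Qed.

Local Open Scope ring_scope.

Definition wheel_point : {ffun G -> R^o} := [ffun v => if wsupp v then (if upper v then 2 / 3 else 1 / 3) else 0].

Lemma wheel_point_edge u v : e u v -> wheel_point u + wheel_point v <= 1.
Proof.
move=> euv; rewrite !ffunE; have := @not_both_upper u v.
by case: (wsupp u); case: (wsupp v); case: (upper u); case: (upper v) => //= H; try lra;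
  have := H isT isT euv.
Qed.

(** On an odd cycle in the support the coordinates sum to a third of its length plus a third of its
    number of upper vertices, so the inequality needed is that of [cycle_class]. *)
Lemma wheel_point_tstab : TSTAB R G wheel_point.
Proof.
split; [|exact: wheel_point_edge|].
  by move=> v; rewrite ffunE; case: ifP => _; [case: ifP => _|]; lra.
move=> d od; case: (boolP (all wsupp d)) => [sd|/allPn[v vd nv]]; last first.
  by apply: (cycle_zero wheel_point_edge od vd); rewrite ffunE (negbTE nv).
have E : \sum_(v <- d) wheel_point v = ((size d)%:R + (count upper d)%:R) / 3 :> R.
  elim: d sd {od} => [|v d IH] /=; first by rewrite big_nil addr0 mul0r.
  move=> /andP[sv sd]; rewrite big_cons IH // ffunE sv natrD -natr1.
  by case: (upper v) => /=; lra.
rewrite E; case/and3P: od => s2 os /andP[cyc _].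
have := cycle_class cyc os sd not_both_upper even_edge_cut.
rewrite -(ler_nat R) natrD natrM; lra.
Qed.

(** With weight 1 on the rim and [lam = m - nB] on a hub vertex [h] touching [c 0], the point has
    value [m + 1/3]. A stable set without [h] has at most [m] rim vertices. One with [h] contains,
    by tightness along the hub, its whole lower class; it avoids all touched indices, so it has at
    most [nB] rim vertices and again weight at most [m]. *)
Lemma no_linear : False.
Proof.
have /existsP[h /andP[hX /andP[kh eh]]] := t0.
have n3 : (2 < n)%N by case: Hc.
have on : odd n by case: Hc.
pose nB := (\sum_(i < n) be i)%N.
pose m := n./2.
have nm : n = (2 * m).+1 by rewrite /m; lia.
pose lam : R := m%:R - nB%:R.
pose w v : R := \sum_(i < n) (c i == v)%:R + lam * (h == v)%:R.
have sumw (y : G -> R) : \sum_v w v * y v = \sum_(i < n) y (c i) + lam * y h.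
  have pick1 u : \sum_v (u == v)%:R * y v = y u.
    rewrite (bigD1 u) //= eqxx mul1r big1 ?addr0 // => v.
    by rewrite eq_sym => /negbTE->; rewrite mul0r.
  rewrite (eq_bigr (fun v => \sum_(i < n) (c i == v)%:R * y v + lam * ((h == v)%:R * y v))); last first.
    by move=> v _; rewrite mulrDl mulr_suml mulrA.
  rewrite big_split /= -mulr_sumr pick1 exchange_big /=; congr (_ + _).
  by apply: eq_bigr => i _; rewrite pick1.
have [S [stS le tight]] := stab_weight_tight tp w wheel_point_tstab.
have st u v : u \in S -> v \in S -> ~~ e u v by move=> uS; apply: (forall_inP (forall_inP stS u uS)).
rewrite (sumw (fun v => wheel_point v)) (sumw (fun v => (v \in S)%:R)) in le.
have xh : wheel_point h = 1 / 3 by rewrite ffunE /wsupp hX /upper hX (negbTE kh).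
have xc : \sum_(i < n) wheel_point (c i) = (n%:R + nB%:R) / 3.
  have -> : n%:R = \sum_(i < n) 1 :> R by rewrite sumr_const card_ord.
  rewrite /nB natr_sum -big_split /= mulr_suml; apply: eq_bigr => i _.
  have -> : wheel_point (c i) = if be i then 2 / 3 else 1 / 3.
    by rewrite ffunE upperE // /wsupp (introT (rimP _)) ?orbT //; exists i.
  by case: (be i) => /=; lra.
have sc : \sum_(i < n) (c i \in S)%:R = (\sum_(i < n) (c i \in S))%N%:R :> R by rewrite natr_sum.
rewrite xh xc sc /lam in le.
have nR : n%:R = 2 * m%:R + 1 :> R by rewrite -natrM natr1 -nm.
pose s i := c i \in S.
have ns i : (i.+1 < n)%N -> ~~ (s i && s i.+1).
  move=> lt; apply/negP=> /andP[s1 s2]; have := st _ _ s1 s2.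
  by rewrite (is_hole_e (@edge_sym G) (@edge_irr G) Hc) ?eqxx //; exact: ltnW.
case: (boolP (h \in S)) => hS; rewrite ?hS ?(negbTE hS) /= in le.
  have hub v : v \in X -> (v \in S) = ~~ ka v.
    move: v; apply: (cX (P := fun v => (v \in S) = ~~ ka v)); first by exists h; rewrite // hS kh.
    move=> u v uX vX euv Eu; have kk := pX uX vX euv.
    have x1 : wheel_point u + wheel_point v = 1.
      by rewrite !ffunE /wsupp uX vX /upper uX vX /=; case: (ka u) kk; case: (ka v) => //= _; lra.
    have := tight u v euv x1; have := st u v; rewrite euv Eu.
    by case: (ka u) kk; case: (ka v) => //= _; case: (v \in S) => // /(_ isT isT).
  have : (\sum_(i < n) s i <= nB)%N.
    apply: (sum_hits_le (t := t)) => // i lti /existsP[x /andP[xX /andP[kx ex]]].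
    by apply/negP=> si; have := st x (c i); rewrite hub // kx ex => /(_ isT si).
  by rewrite -(ler_nat R) /s; move: le nR; lra.
have := stable_cycle tp stS (hole_odd_cycle Hc).
have -> : count [in S] (mkseq c n) = (\sum_(i < n) s i)%N.
  rewrite -(big_mkord xpredT (fun i => s i : nat)) /index_iota subn0 -sum1_count big_map big_mkcond.
  by apply: eq_bigr => i _; rewrite /s /=; case: ifP.
rewrite size_mkseq => hs.
have {}hs : (2 * \sum_(i < n) s i <= 2 * m)%N by lia.
by move: hs; rewrite -(ler_nat R) !natrM /s; move: le nR; lra.
Qed.

End NoLinear.
End Wheel.

(** * The wheel lemma for arbitrary hubs, the restriction to [W], and the colouring *)

Section Final.
Variables (R : realType) (G : sgraph).
Hypothesis tp : t_perfect R G.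
Local Notation e := (@edge G).

(** Rotate the hole to the first touched index [r] whose parity differs from that of the first
    touched one. If the touched indices are then all even, the parity changes only at [r]. Otherwise
    [no_linear] applies: the last touched index now comes from [p], the one before [r], and [r - p]
    is odd. *)
Lemma wheel (c : nat -> G) n (X : {set G}) (ka : G -> bool) : is_hole e c n -> connected e X ->
  (forall x y, x \in X -> y \in X -> e x y -> ka x != ka y) ->
  (forall i, i < n -> c i \notin X) ->
  (forall x i, x \in X -> ka x -> i < n -> ~~ e x (c i)) ->
  exists k b, forall x i, x \in X -> ~~ ka x -> i < n -> e x (c i) -> odd i = b (+) (k <= i).
Proof.
move=> Hc cX pX cnX kX; pose t := touched c X ka.
have on : odd n by case: Hc.
have n3 : 2 < n by case: Hc.
suff [k [b H]] : exists k b, forall i, i < n -> t i -> odd i = b (+) (k <= i).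
  exists k, b => x i xX nk lti ex; apply: H => //.
  by apply/existsP; exists x; rewrite xX nk.
case: (classic (exists i, i < n /\ t i)) => [ex|nt]; last first.
  by exists 0, false => i lti ti; case: nt; exists i.
have [s [[lts ts] ms]] := min_nat ex.
case: (classic (exists i, [/\ i < n, t i & odd i != odd s])) => [ex'|nE]; last first.
  exists 0, (~~ odd s) => i lti ti; apply/eqP; apply: contraT => h.
  by case: nE; exists i; split=> //; move: h; rewrite /= addbT negbK.
have [r [[ltr tr osr] mr]] := min_nat ex'.
have sr : s < r.
  by rewrite ltnNge leq_eqVlt; apply/negP=> /orP[/eqP E|/ms]; [rewrite E eqxx in osr|apply].
have [||p [[ltp tp'] mp]] := @max_nat (fun i => i < r /\ t i) r; [by exists s|by move=> i []; lia|].
have osp : odd p = odd s.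
  apply/eqP; apply: contraT => h; case: (mr p ltp); split=> //; exact: ltn_trans ltp ltr.
pose c' i := c ((i + r) %% n).
have E i : i < n -> (i + r) %% n = if i + r < n then i + r else i + r - n.
  move=> lti; case: ltnP => h; first by rewrite modn_small.
  have {1}-> : i + r = n + (i + r - n) by lia.
  by rewrite modnDl modn_small //; lia.
have mn i : (i + r) %% n < n by rewrite ltn_pmod //; lia.
have Hc' : is_hole e c' n := is_hole_rot (@edge_sym G) (@edge_irr G) r Hc.
have t'E i : touched c' X ka i = t ((i + r) %% n) by [].
case: (classic (exists j, [/\ j < n, touched c' X ka j & odd j])) => [[j [ltj tj oj]]|nj].
  case: (@no_linear R G tp c' n X ka Hc' cX pX _ _ _ (p + n - r) _ _ _ _ j ltj oj tj).
  - by move=> i _; apply: cnX.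
  - by move=> x i xX kx _; apply: kX.
  - by rewrite t'E add0n modn_small.
  - lia.
  - by move: osr; rewrite -osp; lia.
  - move=> i hi; rewrite t'E E; last lia.
    case: ltnP => h; first lia.
    by apply/negP=> ti; case: (mp (i + r - n)); [lia|split=> //; lia].
  - rewrite t'E subnK; last lia.
    by rewrite modnDr modn_small //; lia.
exists r, (~~ odd r) => i lti ti.
have ev k : k < n -> touched c' X ka k -> ~~ odd k.
  by move=> ltk tk; apply/negP=> ok; apply: nj; exists k.
case: (leqP r i) => h.
  have := ev (i - r) ltac:(lia); rewrite t'E subnK // modn_small // => /(_ ti).
  by rewrite addbT negbK; lia.
have := ev (i + n - r) ltac:(lia); rewrite t'E subnK; last lia.
by rewrite modnDr modn_small // => /(_ ti); rewrite addbF; lia.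
Qed.

Variable W : {set G}.
Hypothesis no35 : forall c, odd_cycle c -> {subset c <= W} -> (6 < size c)%N.
(** Vertices outside [W] stay as isolated vertices, so the vertex type does not change. *)
Definition eW u v := [&& u \in W, v \in W & e u v].

Lemma eW_sym : symmetric eW.
Proof. by move=> u v; rewrite /eW edge_sym; case: (u \in W); case: (v \in W). Qed.
Lemma eW_irr : irreflexive eW.
Proof. by move=> u; rewrite /eW edge_irr !andbF. Qed.

Lemma eW_hole c n : is_hole eW c n -> is_hole e c n /\ forall i, i < n -> c i \in W.
Proof.
move=> H; have [n2 on Hc] := H.
have cW i : i < n -> c i \in W.
  move=> lti; have [j [ltj ej]] : exists j, j < n /\ eW (c i) (c j).
    case: (posnP i) => [->|i0].
      by exists 1; split; [lia|rewrite (is_hole_e eW_sym eW_irr H) //; lia].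
    by exists i.-1; split; [lia|rewrite (is_hole_e eW_sym eW_irr H) //; lia].
  by case/and3P: ej.
split=> //; split=> // i j ltij ltj; have [ne <-] := Hc i j ltij ltj; split=> //.
by rewrite /eW !cW //; apply: ltn_trans ltj.
Qed.

Lemma eW_hole7 c n : is_hole eW c n -> 7 <= n.
Proof.
move=> /eW_hole[H cW]; have := no35 (hole_odd_cycle H); rewrite size_mkseq; apply.
by move=> v /mapP[i]; rewrite mem_iota add0n => lti ->; apply: cW.
Qed.

Lemma eW_wheel c n (X : {set G}) (ka : G -> bool) : is_hole eW c n -> connected eW X ->
  (forall x y, x \in X -> y \in X -> eW x y -> ka x != ka y) ->
  (forall i, i < n -> c i \notin X) ->
  (forall x i, x \in X -> ka x -> i < n -> ~~ eW x (c i)) ->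
  exists k b, forall x i, x \in X -> ~~ ka x -> i < n -> eW x (c i) -> odd i = b (+) (k <= i).
Proof.
move=> H cX pX nX kX; have [He cW] := eW_hole H.
(* A connected set containing an isolated vertex consists of that vertex alone. *)
case: (classic (exists2 x, x \in X & x \notin W)) => [[x0 x0X x0W]|nE].
  have all : forall x, x \in X -> x = x0.
    apply: (cX (fun x => x = x0)); first by exists x0.
    by move=> u v _ _ /and3P[uW _ _] E; rewrite E (negbTE x0W) in uW.
  by exists 0, false => x i /all-> _ _ /and3P[]; rewrite (negbTE x0W).
have XW x : x \in X -> x \in W by move=> xX; apply: contraT => h; case: nE; exists x.
have eE x y : x \in W -> y \in W -> eW x y = e x y by rewrite /eW => -> ->.
have [|x y xX yX exy|//|x i xX kx lti|k [b Hb]] := @wheel c n X ka He.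
- move=> P ex Pst; apply: cX ex _ => u v uX vX /and3P[_ _ euv]; exact: Pst.
- by apply: pX; rewrite ?eE ?XW.
- by apply: contra (kX x i xX kx lti) => ei; rewrite eE ?cW ?XW.
by exists k, b => x i xX nk lti /and3P[_ _ ei]; apply: Hb ei.
Qed.

Definition restricted_wgraph := WGraph eW_sym eW_irr eW_hole7 eW_wheel.

Lemma restricted_col : exists f : G -> nat, forall v, f v < 2 * rope_col 13 /\
  forall u v, u \in W -> v \in W -> e u v -> f u <> f v.
Proof.
have [f [fk fp]] := main_col restricted_wgraph.
exists f => v; split; first by apply: fk; rewrite inE.
move=> {}u {}v uW vW euv; apply: fp; rewrite ?inE //.
by rewrite /= /eW uW vW.
Qed.

End Final.

Theorem theorem1p1 (R : realType) (G : sgraph) :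
  t_perfect R G -> colourable G 199053.
Proof.
move=> tp.
have [|S1 st1 h1] := @hit_cycles R G tp setT 1 isT; first by move=> c /and3P[].
have g1 c : odd_cycle c -> {subset c <= ~: S1} -> (4 < size c)%N.
  move=> oc cW; case/and3P: (oc) => s2 os _.
  rewrite ltnNge; apply/negP=> s4; have /hasP[v vc] := h1 c oc (fun v _ => in_setT v) ltac:(lia).
  by have := cW v vc; rewrite inE => /negbTE /= ->.
have [|S2 st2 h2] := @hit_cycles R G tp (~: S1) 2 isT; first exact: g1.
pose W := ~: S1 :\: S2.
have no35 c : odd_cycle c -> {subset c <= W} -> (6 < size c)%N.
  move=> oc cW; case/and3P: (oc) => s2 os _.
  have cW1 : {subset c <= ~: S1} by move=> v /cW; rewrite inE => /andP[].
  have s4 := g1 c oc cW1.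
  rewrite ltnNge; apply/negP=> s6; have /hasP[v vc] := h2 c oc cW1 ltac:(lia).
  by have := cW v vc; rewrite inE => /andP[/negbTE /= ->].
have [f fP] := restricted_col tp no35.
(* The left side equals 138917; the colours [K] and [K.+1] introduced next are those of [S1] and
   [S2]. *)
have big : (2 * rope_col 13).+1 < 199053 by vm_compute.
move: (2 * rope_col 13) big fP => K big fP.
pose F v := if v \in S1 then K else if v \in S2 then K.+1 else f v.
have lt v : F v < 199053.
  have := (fP v).1; rewrite /F; case: ifP => _; first by move=> _; apply: ltn_trans big.
  by case: ifP => _ // lt; apply: ltn_trans big; apply: leqW.
clear big.
exists (fun i : 'I_199053 => [set v | F v == i]); split.
  move=> i; apply/forall_inP=> u; rewrite inE => /eqP Fu; apply/forall_inP=> v; rewrite inE => /eqP Fv.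
  apply/negP=> euv; have : F u = F v by rewrite Fu Fv.
  have st (S : {set G}) : stable S -> u \in S -> v \in S -> False.
    by move=> st uS vS; have := forall_inP (forall_inP st u uS) v vS; rewrite euv.
  have fu := (fP u).1; have fv := (fP v).1.
  rewrite /F; case: (boolP (u \in S1)) => u1; case: (boolP (v \in S1)) => v1.
  - by move=> _; apply: st st1 u1 v1.
  - by case: ifP => _ E; lia.
  - by case: ifP => _ E; lia.
  case: (boolP (u \in S2)) => u2; case: (boolP (v \in S2)) => v2.
  - by move=> _; apply: st st2 u2 v2.
  - by move=> E; lia.
  - by move=> E; lia.
  by apply: (fP u).2; rewrite // !inE ?u1 ?u2 ?v1 ?v2.
apply/setP=> v; rewrite inE; apply/bigcupP; exists (Ordinal (lt v)) => //.
by rewrite inE.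
Qed.
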